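(* Let $(X,\mathcal B,m)$ be a standard, $\sigma$-finite, non-atomic, infinite measure space. Then: (i) the collection $\mathrm{RWM}(X)$ of rationally weakly mixing transformations is meagre in $\mathrm{MPT}(X)$; (ii) the collection $\mathrm{PSRWM}(X)$ of power, subsequence rationally weakly mixing transformations is residual in $\mathrm{MPT}(X)$.
   Context: $\mathrm{MPT}(X)=\mathrm{MPT}(X,\mathcal B,m)$ is the group of invertible measure preserving transformations of $(X,\mathcal B,m)$ (identified when equal a.e.), with the weak operator topology: $T_n\to T$ if $m(TA\,\Delta\,T_nA)+m(T^{-1}A\,\Delta\,T_n^{-1}A)\to0$ for all $A\in\mathcal B$ with $m(A)<\infty$. With this topology $\mathrm{MPT}(X)$ is a Polish group. A residual set is one whose complement is meagre (of first Baire category). Let $T$ be a conservative, ergodic measure preserving transformation of a standard, non-atomic, $\sigma$-finite infinite measure space $(X,\mathcal B,m)$ (conservative: $m(A\setminus\bigcup_{n\ge1}T^{-n}A)=0$ for all $A\in\mathcal B$). For $F\in\mathcal B$ with $0<m(F)<\infty$ set $u_n(F):=\frac{m(F\cap T^{-n}F)}{m(F)^2}$ and $a_n(F):=\sum_{k=0}^{n-1}u_k(F)$. For an infinite set $\mathfrak K\subset\mathbb N$, $T$ is rationally weakly mixing along $\mathfrak K$ if there is $F\in\mathcal B$ with $0<m(F)<\infty$ such that for all measurable $A,B\subset F$, $\frac1{a_n(F)}\sum_{k=0}^{n-1}|m(A\cap T^{-k}B)-m(A)m(B)u_k(F)|\to0$ as $n\to\infty$, $n\in\mathfrak K$. $T$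 is rationally weakly mixing if this holds with $\mathfrak K=\mathbb N$, and subsequence rationally weakly mixing if it holds for some infinite $\mathfrak K\subset\mathbb N$. For $T\in\mathrm{MPT}(X)$, $\Delta\ge1$ and $(\kappa_1,\dots,\kappa_\Delta)\in\mathbb Z^\Delta$ let $T^{(\kappa_1,\dots,\kappa_\Delta)}:=T^{\kappa_1}\times\cdots\times T^{\kappa_\Delta}\in\mathrm{MPT}(X^\Delta)$, $X^\Delta$ carrying the product measure. $T$ is power, subsequence rationally weakly mixing if $T^{(\kappa_1,\dots,\kappa_\Delta)}$ is subsequence rationally weakly mixing for all $\Delta\ge1$ and all $(\kappa_1,\dots,\kappa_\Delta)\in(\mathbb Z\setminus\{0\})^\Delta$. *)

(* Defs.v *)
From HB Require Import structures.
From mathcomp Require Import all_boot all_order all_algebra.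
From mathcomp Require Import all_classical all_reals all_analysis.

Set Implicit Arguments.
Unset Strict Implicit.
Unset Printing Implicit Defensive.

Import Order.TTheory GRing.Theory Num.Theory.
Import numFieldNormedType.Exports.

Local Open Scope classical_set_scope.
Local Open Scope ring_scope.

Section baire_category.
Context {T : topologicalType}.
Implicit Types A : set T.

Definition nowhere_dense A := interior (closure A) = set0.

Definition meagre A :=
  exists2 F : (set T)^nat, (forall n, nowhere_dense (F n)) &
    A `<=` \bigcup_n F n.

Definition residual A := meagre (~` A).

End baire_category.

Section measure_spaces.
Context {d} {T : measurableType d} {R : realType}.

(* `T` is measurably isomorphic to a Polish space with its Borel sets; for the
   library, a complete metric space is a Hausdorff complete pseudometric one. *)
Definition standard_borel :=
  exists (P : completePseudoMetricType R) (f : T -> P),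
    [/\ hausdorff_space P,
        exists2 D : set P, countable D & dense D,
        bijective f &
        d.-measurable = [set f @^-1` B | B in <<s @open P >>]].

Definition non_atomic (m : set T -> \bar R) :=
  forall A, measurable A -> (0 < m A)%E ->
    exists B, [/\ measurable B, B `<=` A, (0 < m B)%E & (m B < m A)%E].

End measure_spaces.
Arguments standard_borel {d} T R.

(* Everywhere defined bimeasurable bijections.  On a non-atomic standard space
   every invertible transformation defined off a null set agrees a.e. with one
   of these, so the quotient `MPT` below does not depend on this choice. *)
Record mpt {d} {T : measurableType d} {R : realType}
    (m : {measure set T -> \bar R}) := Mpt {
  mpt_fun :> T -> T ;
  mpt_inv : T -> T ;
  mpt_funK : cancel mpt_fun mpt_inv ;
  mpt_invK : cancel mpt_inv mpt_fun ;
  measurable_mpt_fun : measurable_fun setT mpt_fun ;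
  measurable_mpt_inv : measurable_fun setT mpt_inv ;
  mpt_preserving : forall A, measurable A -> m (mpt_fun @^-1` A) = m A }.

Section mpt_operations.
Context {d} {T : measurableType d} {R : realType}.
Context {m : {measure set T -> \bar R}}.

Definition mpt_id : mpt m :=
  Mpt (fun=> erefl) (fun=> erefl) (@measurable_id _ T setT)
    (@measurable_id _ T setT) (fun A _ => erefl (m A)).

Lemma measurable_mpt_preimage (S : mpt m) A :
  measurable A -> measurable (S @^-1` A).
Proof.
by move=> mA; rewrite -[X in measurable X]setTI; exact: measurable_mpt_fun.
Qed.

Lemma mpt_comp_preserving (S S' : mpt m) A : measurable A ->
  m ((S \o S') @^-1` A) = m A.
Proof.
move=> mA; rewrite comp_preimage !mpt_preserving//.
exact: measurable_mpt_preimage.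
Qed.

Definition mpt_comp (S S' : mpt m) : mpt m :=
  Mpt (can_comp (mpt_funK S) (mpt_funK S'))
    (can_comp (mpt_invK S') (mpt_invK S))
    (measurableT_comp (measurable_mpt_fun S) (measurable_mpt_fun S'))
    (measurableT_comp (measurable_mpt_inv S') (measurable_mpt_inv S))
    (mpt_comp_preserving S S').

Lemma mpt_inverse_preserving (S : mpt m) A : measurable A ->
  m (mpt_inv S @^-1` A) = m A.
Proof.
move=> mA; rewrite -(mpt_preserving S).
  by rewrite -comp_preimage; congr (m _); apply/seteqP; split => x /=;
    rewrite mpt_funK.
by rewrite -[X in measurable X]setTI; exact: measurable_mpt_inv.
Qed.

Definition mpt_inverse (S : mpt m) : mpt m :=
  Mpt (mpt_invK S) (mpt_funK S) (measurable_mpt_inv S) (measurable_mpt_fun S)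
    (mpt_inverse_preserving S).

Definition mpt_pow (S : mpt m) (k : int) : mpt m :=
  match k with
  | Posz n => iter n (mpt_comp S) mpt_id
  | Negz n => iter n.+1 (mpt_comp (mpt_inverse S)) mpt_id
  end.

End mpt_operations.

Section rational_weak_mixing.
Context {d} {T : measurableType d} {R : realType}.
Context {m : {measure set T -> \bar R}}.
Implicit Types S : mpt m.

Definition conservative S := forall A, measurable A ->
  m (A `\` \bigcup_(n in [set n | (1 <= n)%N]) iter n S @^-1` A) = 0%E.

Definition ergodic S := forall A, measurable A ->
  m (S @^-1` A `+` A) = 0%E -> m A = 0%E \/ m (~` A) = 0%E.

Definition return_rate S (F : set T) (n : nat) : R :=
  fine (m (F `&` iter n S @^-1` F)) / fine (m F) ^+ 2.

Definition return_sequence S (F : set T) (n : nat) : R :=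
  \sum_(0 <= k < n) return_rate S F k.

(* Rational weak mixing is only considered for conservative ergodic
   transformations, hence these two conditions are part of its definition. *)
Definition rationally_weakly_mixing_along (K : set nat) S :=
  [/\ conservative S, ergodic S &
   exists F : set T, [/\ measurable F, (0 < m F)%E, (m F < +oo)%E &
    forall A B, measurable A -> measurable B -> A `<=` F -> B `<=` F ->
      (\sum_(0 <= k < n)
         `|fine (m (A `&` iter k S @^-1` B))
           - fine (m A) * fine (m B) * return_rate S F k|)
        / return_sequence S F n @[n --> within K \oo] --> (0 : R)]].

Definition rationally_weakly_mixing S := rationally_weakly_mixing_along setT S.

Definition subsequence_rationally_weakly_mixing S :=
  exists2 K : set nat, infinite_set K & rationally_weakly_mixing_along K S.

End rational_weak_mixing.

Section cons_measure.
Context {d} {T : measurableType d} {R : realType} {n : nat}.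
Implicit Types p : T * n.-tuple T.

Definition cons_pair p : n.+1.-tuple T := [tuple of p.1 :: p.2].

Definition uncons_pair (t : n.+1.-tuple T) : T * n.-tuple T :=
  (thead t, [tuple of behead t]).

Lemma cons_pairK : cancel cons_pair uncons_pair.
Proof.
by move=> [x t]; rewrite /uncons_pair theadE; congr pair; exact/val_inj.
Qed.

Lemma uncons_pairK : cancel uncons_pair cons_pair.
Proof. by move=> t; rewrite [RHS]tuple_eta. Qed.

Lemma measurable_cons_pair : measurable_fun setT cons_pair.
Proof. exact: measurable_cons. Qed.

Lemma measurable_uncons_pair : measurable_fun setT uncons_pair.
Proof.
apply: measurable_fun_pair; first exact: measurable_tnth.
exact: measurable_behead.
Qed.

Variables (m : {sigma_finite_measure set T -> \bar R}).
Variable (nu : {sigma_finite_measure set (n.-tuple T) -> \bar R}).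

Definition cons_measure : set (n.+1.-tuple T) -> \bar R :=
  pushforward (m \x nu)%E cons_pair.

Let cons_preimage A : measurable A -> measurable (cons_pair @^-1` A).
Proof.
by move=> mA; rewrite -[X in measurable X]setTI; exact: measurable_cons_pair.
Qed.

Let cons_measure0 : cons_measure set0 = 0%E.
Proof. by rewrite /cons_measure /pushforward preimage_set0 measure0. Qed.

Let cons_measure_ge0 A : (0 <= cons_measure A)%E.
Proof. by rewrite /cons_measure /pushforward measure_ge0. Qed.

Let cons_measure_sigma_additive : semi_sigma_additive cons_measure.
Proof.
move=> F mF tF mUF; rewrite /cons_measure /pushforward preimage_bigcup.
apply: measure_semi_sigma_additive.
- by move=> k; exact: cons_preimage.
- apply/trivIsetP => /= i j _ _ ij; rewrite -preimage_setI.
  by move/trivIsetP : tF => /(_ _ _ _ _ ij) ->//; rewrite preimage_set0.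
- by rewrite -preimage_bigcup; exact: cons_preimage.
Qed.

HB.instance Definition _ := isMeasure.Build _ _ _ cons_measure
  cons_measure0 cons_measure_ge0 cons_measure_sigma_additive.

Let cons_measure_sigma_finite : sigma_finite setT cons_measure.
Proof.
have /sigma_finiteP[F [FT ndF mF]] := sigma_finiteT m.
have /sigma_finiteP[G [GT ndG mG]] := sigma_finiteT nu.
exists (fun i => uncons_pair @^-1` (F i `*` G i)).
  rewrite -preimage_bigcup (_ : \bigcup_i _ = setT) ?preimage_setT//.
  apply/seteqP; split => // -[x t] _.
  have [i _ Fx] : (\bigcup_i F i) x by rewrite -FT.
  have [j _ Gt] : (\bigcup_j G j) t by rewrite -GT.
  exists (maxn i j) => //; split => /=.
    by move: Fx; apply/subsetPset/ndF; exact: leq_maxl.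
  by move: Gt; apply/subsetPset/ndG; exact: leq_maxr.
move=> i; have [mFi Fioo] := mF i; have [mGi Gioo] := mG i; split.
  by rewrite -[X in measurable X]setTI; apply: measurable_uncons_pair => //;
    exact: measurableX.
rewrite /cons_measure /pushforward -comp_preimage.
rewrite (_ : _ \o _ = id); last by apply/funext => p /=; rewrite cons_pairK.
by rewrite preimage_id product_measure1E// lte_mul_pinfty// ge0_fin_numE.
Qed.

HB.instance Definition _ :=
  Measure_isSigmaFinite.Build _ _ _ cons_measure cons_measure_sigma_finite.

End cons_measure.

(* The product measure on `n.-tuple T`, transported from `T * n.-1.-tuple T`;
   `tuple_measure_box` characterises it. *)
Section tuple_measure.
Context {d} {T : measurableType d} {R : realType}.
Variable m : {sigma_finite_measure set T -> \bar R}.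

Fixpoint tuple_measure (n : nat) :
    {sigma_finite_measure set (n.-tuple T) -> \bar R} :=
  match n with
  | 0 => \d_([tuple] : 0.-tuple T)
  | n.+1 => cons_measure m (tuple_measure n)
  end.

Lemma tuple_measure_box n (A : 'I_n -> set T) : (forall i, measurable (A i)) ->
  tuple_measure n [set t | forall i, A i (tnth t i)] =
  (\prod_(i < n) m (A i))%E.
Proof.
elim: n A => [|n IHn] A mA.
  by rewrite big_ord0 /= diracE mem_set//= => -[].
rewrite big_ord_recl -IHn// -product_measure1E//; last first.
  rewrite (_ : mkset _ =
      \bigcap_(i in setT) (@tnth n T ^~ i) @^-1` A (lift ord0 i)).
    apply: fin_bigcap_measurable => // i _.
    by rewrite -[X in measurable X]setTI; exact: measurable_tnth.
  by apply/seteqP; split => t /= h i; [move=> _|]; exact: h.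
congr ((m \x _)%E _); apply/seteqP; split => -[x t] /=.
  move=> h; split => [|i]; first by have := h ord0.
  by have := h (lift ord0 i); rewrite tnthS.
move=> [h1 h2] i; case: (unliftP ord0 i) => [j ->|->//].
by rewrite tnthS; exact: h2.
Qed.

End tuple_measure.

Section mpt_tuple.
Context {d} {T : measurableType d} {R : realType}.
Context {m : {sigma_finite_measure set T -> \bar R}}.

Definition tuple_map n (f : 'I_n -> T -> T) (t : n.-tuple T) : n.-tuple T :=
  [tuple f i (tnth t i) | i < n].

Lemma tuple_mapK n (f g : 'I_n -> T -> T) :
  (forall i, cancel (f i) (g i)) -> cancel (tuple_map f) (tuple_map g).
Proof. by move=> fK t; apply: eq_from_tnth => i; rewrite !tnth_mktuple fK. Qed.

Lemma measurable_tuple_map n (f : 'I_n -> T -> T) :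
  (forall i, measurable_fun setT (f i)) -> measurable_fun setT (tuple_map f).
Proof.
move=> mf; apply/measurable_fun_tnthP => i.
rewrite (_ : _ \o _ = f i \o (@tnth n T ^~ i)).
  by apply: measurableT_comp => //; exact: measurable_tnth.
by apply/funext => t /=; rewrite tnth_mktuple.
Qed.

Lemma tuple_map_preserving n (S : 'I_n -> mpt m) A : measurable A ->
  tuple_measure m n (tuple_map S @^-1` A) = tuple_measure m n A.
Proof.
elim: n S A => [|n IHn] S A mA.
  by congr (tuple_measure m 0 _); apply/seteqP; split => t /=;
    rewrite [tuple_map _ _]tuple0 [t]tuple0.
pose S' i := S (lift ord0 i).
pose g (p : T * n.-tuple T) := (S ord0 p.1, tuple_map S' p.2).
have mg : measurable_fun setT g.
  apply: measurable_fun_pair.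
    by apply: measurableT_comp => //; exact: measurable_mpt_fun.
  apply: measurableT_comp => //; apply: measurable_tuple_map => i.
  exact: measurable_mpt_fun.
have consg : tuple_map S \o cons_pair = cons_pair \o g.
  apply/funext => -[x t] /=; apply: eq_from_tnth => i.
  rewrite tnth_mktuple; case: (unliftP ord0 i) => [j ->|->//].
  by rewrite !tnthS tnth_mktuple.
rewrite /= /cons_measure /pushforward -comp_preimage consg comp_preimage.
have mcA : measurable (cons_pair @^-1` A).
  by rewrite -[X in measurable X]setTI; exact: measurable_cons_pair.
have [mu muE] : exists mu : {measure set (T * n.-tuple T) -> \bar R},
    forall B, mu B = (m \x tuple_measure m n)%E (g @^-1` B).
  by exists (measure_function_pushforward__canonical__measure_function_Measure
    (m \x tuple_measure m n)%E mg).
rewrite -muE -(@product_measure_unique _ _ _ _ _ m (tuple_measure m n) mu)//.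
move=> B C mB mC; rewrite muE.
rewrite (_ : g @^-1` _ = (S ord0 @^-1` B) `*` (tuple_map S' @^-1` C))//.
rewrite product_measure1E ?mpt_preserving ?IHn//.
  exact: measurable_mpt_preimage.
rewrite -[X in measurable X]setTI; apply: measurable_tuple_map => // i.
exact: measurable_mpt_fun.
Qed.

Definition mpt_tuple n (S : 'I_n -> mpt m) : mpt (tuple_measure m n) :=
  Mpt (tuple_mapK (fun i => mpt_funK (S i)))
    (tuple_mapK (fun i => mpt_invK (S i)))
    (measurable_tuple_map (fun i => measurable_mpt_fun (S i)))
    (measurable_tuple_map (fun i => measurable_mpt_inv (S i)))
    (tuple_map_preserving S).

Definition mpt_multipower (S : mpt m) n (kappa : n.-tuple int) :
    mpt (tuple_measure m n) :=
  mpt_tuple (fun i => mpt_pow S (tnth kappa i)).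

Definition power_subsequence_rationally_weakly_mixing (S : mpt m) :=
  forall (n : nat) (kappa : n.-tuple int), (1 <= n)%N ->
    (forall i, tnth kappa i != 0) ->
    subsequence_rationally_weakly_mixing (mpt_multipower S kappa).

End mpt_tuple.

Section weak_topology.
Context {d} {T : measurableType d} {R : realType}.
Context (m : {measure set T -> \bar R}).
Implicit Types S : mpt m.

HB.instance Definition _ := gen_eqMixin (mpt m).
HB.instance Definition _ := gen_choiceMixin (mpt m).
HB.instance Definition _ := isPointed.Build (mpt m) mpt_id.

Definition weak_gap (A : set T) S S' : \bar R :=
  (m (S @` A `+` S' @` A) + m (S @^-1` A `+` S' @^-1` A))%E.

(* By `weak_gap_triangle` the finite intersections of the subbasic sets around
   `S` form a neighbourhood base at `S`; `mpt_class_cvgP` describes the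
   convergent sequences. *)
Definition weak_index : set (mpt m * set T * R) :=
  [set i | [/\ measurable i.1.2, (m i.1.2 < +oo)%E & 0 < i.2]].

Definition weak_subbase (i : mpt m * set T * R) : set (mpt m) :=
  [set S | (weak_gap i.1.2 i.1.1 S < i.2%:E)%E].

HB.instance Definition _ :=
  isSubBaseTopological.Build (mpt m) weak_index weak_subbase.

Definition mpt_ae_eq S S' := `[< S = S' %[ae m] >].

Lemma mpt_ae_eq_refl : reflexive mpt_ae_eq.
Proof. by move=> S; apply/asboolP; exact: (ae_eq_refl m setT S). Qed.

Lemma mpt_ae_eq_sym : symmetric mpt_ae_eq.
Proof.
by move=> S S'; apply/idP/idP => /asboolP h; apply/asboolP; exact/ae_eq_sym.
Qed.

Lemma mpt_ae_eq_trans : transitive mpt_ae_eq.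
Proof.
move=> S S' S'' /asboolP h /asboolP h'; apply/asboolP.
exact: (@ae_eq_trans _ _ _ m setT _ S' S S'').
Qed.

Canonical mpt_ae_eq_equiv :=
  EquivRel mpt_ae_eq mpt_ae_eq_refl mpt_ae_eq_sym mpt_ae_eq_trans.

Definition MPT : Type := quotient_topology {eq_quot mpt_ae_eq}%qT.

HB.instance Definition _ := Topological.on MPT.
HB.instance Definition _ := Quotient.on MPT.

(* For a.e. equal `S` and `S'`, `S @^-1` A` and `S' @^-1` A` differ by a null
   set, so the open sets of `mpt m` are saturated. *)
Definition mpt_class S : MPT := (\pi_MPT S)%qT.

Lemma mpt_classP S S' : mpt_class S = mpt_class S' <-> S = S' %[ae m].
Proof.
have SS'P := eqmodP mpt_ae_eq_equiv S S'.
by split => [SS'|SS']; [exact/asboolP/(introT SS'P)|exact/(elimT SS'P)/asboolP].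
Qed.

Lemma measurable_image S A : measurable A -> measurable (S @` A).
Proof.
move=> mA; rewrite (_ : S @` A = mpt_inverse S @^-1` A).
  exact: measurable_mpt_preimage.
apply/seteqP; split => [_ [x Ax <-]|x Ax] /=; first by rewrite mpt_funK.
by exists (mpt_inv S x) => //; rewrite mpt_invK.
Qed.

Lemma measurable_symdiff (A B : set T) : measurable A -> measurable B ->
  measurable (A `+` B).
Proof. by move=> mA mB; apply: measurableU; exact: measurableD. Qed.

Lemma measure_symdiff_triangle (A B C : set T) : measurable A -> measurable B ->
  measurable C -> (m (A `+` C) <= m (A `+` B) + m (B `+` C))%E.
Proof.
move=> mA mB mC; apply: (@le_trans _ _ (m ((A `+` B) `|` (B `+` C)))).
  apply: le_measure; rewrite ?inE//;
    try by do ?[exact: measurable_symdiff|apply: measurableU].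
  by move=> x [[Ax nCx]|[Cx nAx]]; have [Bx|nBx] := pselect (B x);
    [right; left|left; left|left; right|right; right].
by apply: measureU2; exact: measurable_symdiff.
Qed.

Lemma weak_gap_triangle A S S' S'' : measurable A ->
  (weak_gap A S S'' <= weak_gap A S S' + weak_gap A S' S'')%E.
Proof.
move=> mA; rewrite /weak_gap addeACA; apply: leeD;
  by apply: measure_symdiff_triangle;
    (exact: measurable_image || exact: measurable_mpt_preimage).
Qed.

Lemma weak_gap_ae_eq A S S' : measurable A -> S = S' %[ae m] ->
  weak_gap A S S' = 0%E.
Proof.
move=> mA [N [mN N0 SS'N]]; rewrite /weak_gap.
have SE x : ~ N x -> S x = S' x.
  by move=> nNx; apply: contrapT => neq; apply/nNx/SS'N => /= /(_ I).
rewrite (@measure_negligible _ _ _ m (S @` A `+` _)); last first.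
- exists (mpt_inverse S @^-1` N); split.
  + exact: measurable_mpt_preimage.
  + by rewrite -[RHS]N0; exact: (mpt_preserving (mpt_inverse S)).
  + move=> y /= h; apply: contrapT => nN.
    have yE : S' (mpt_inv S y) = y by rewrite -SE// mpt_invK.
    have yE' : mpt_inv S' y = mpt_inv S y by rewrite -{1}yE mpt_funK.
    case: h => -[[x Ax xy] []].
      by exists (mpt_inv S y) => //; rewrite -xy mpt_funK.
    exists x => //; rewrite -xy; apply: SE.
    by rewrite (_ : x = mpt_inv S y)// -yE' -xy mpt_funK.
- by apply: measurable_symdiff; exact: measurable_image.
rewrite add0e (@measure_negligible _ _ _ m (S @^-1` A `+` _))//.
  by apply: measurable_symdiff; exact: measurable_mpt_preimage.
exists N; split => // x h; apply: contrapT => /SE xE.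
by case: h => -[] /=; rewrite xE.
Qed.

Lemma mpt_class_cvgP (S_ : (mpt m)^nat) S :
  mpt_class (S_ n) @[n --> \oo] --> mpt_class S <->
  forall A, measurable A -> (m A < +oo)%E ->
    weak_gap A S (S_ n) @[n --> \oo] --> 0%E.
Proof.
pose V A S0 (e : R) := weak_subbase (S0, A, e).
have openV A S0 (e : R) : measurable A -> (m A < +oo)%E -> 0 < e ->
    open (V A S0 e).
  move=> mA Aoo e0; exists [set V A S0 e]; last by rewrite bigcup_set1.
  move=> _ ->; have : weak_index (S0, A, e) by [].
  exact: (@finI_from1 _ _ weak_index weak_subbase).
have nonneg A S0 S' : (0 <= weak_gap A S0 S')%E by rewrite adde_ge0.
split => [cvgS A mA Aoo|cvgS].
  have near_small (e : R) : 0 < e ->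
      \forall n \near \oo, (weak_gap A S (S_ n) < e%:E)%E.
    move=> e0.
    have VE : mpt_class @^-1` (mpt_class @` V A S e) = V A S e.
      apply/seteqP; split => [S'' [S' VS' /mpt_classP SS']|S' VS'];
        last by exists S'.
      apply: le_lt_trans (weak_gap_triangle S S' S'' mA) _.
      by rewrite (weak_gap_ae_eq mA SS') adde0.
    have : nbhs (mpt_class S) (mpt_class @` V A S e).
      apply: open_nbhs_nbhs; split.
        by rewrite /open /= /quotient_open VE; exact: openV.
      exists S => //; rewrite /V /weak_subbase /=.
      rewrite (weak_gap_ae_eq mA) ?lte_fin//.
      exact: (ae_eq_refl m setT S).
    move=> /cvgS; rewrite (_ : nbhs _ _ =
      nbhs \oo (fun n => (mpt_class @^-1` (mpt_class @` V A S e)) (S_ n)))//.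
    by rewrite VE.
  move=> B [e /= e0 eB].
  suff : \forall n \near \oo, B (weak_gap A S (S_ n)) by [].
  apply: filterS (near_small _ e0) => n.
  move: (nonneg A S (S_ n)); case: (weak_gap _ _ _) => [r| |]//=.
  rewrite lee_fin lte_fin => r0 re; apply: eB => /=.
  by rewrite sub0r normrN ger0_norm.
have cvgS' : S_ n @[n --> \oo] --> S.
  move=> W; rewrite nbhsE => -[U [[D sD <-] [B DB BS]] sUW].
  have [F sF FB] : finI_from weak_index weak_subbase B := sD _ DB.
  have BW : B `<=` W by move=> S' BS'; apply: sUW; exists B.
  suff : \forall n \near \oo, B (S_ n) by apply: filterS => n; exact: BW.
  rewrite -FB; apply: filter_bigI => -[[S0 A] e] iF.
  have [/= mA Aoo e0] : weak_index (S0, A, e) by exact/set_mem/sF.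
  have : (weak_gap A S0 S < e%:E)%E by move: BS; rewrite -FB => /(_ _ iF).
  have := nonneg A S0 S; case E : (weak_gap A S0 S) => [r| |]//=.
  rewrite lee_fin lte_fin => r0 re.
  have er0 : 0 < e - r by rewrite subr_gt0.
  have : nbhs (0%E : \bar R) [set x | (x < (e - r)%:E)%E].
    apply: open_nbhs_nbhs; split; last by rewrite /= lte_fin.
    exact: open_ereal_lt_ereal.
  move=> /(cvgS _ mA Aoo) near_er.
  have {near_er} : \forall n \near \oo, (weak_gap A S (S_ n) < (e - r)%:E)%E.
    exact: near_er.
  apply: filterS => n gapn.
  rewrite /weak_subbase /=.
  apply: le_lt_trans (weak_gap_triangle S0 S (S_ n) mA) _.
  by rewrite E -(subrKC r e) EFinD lteD2lE.
exact: (cvg_comp _ _ cvgS' (@pi_continuous _ {eq_quot mpt_ae_eq}%qT S)).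
Qed.

End weak_topology.
Arguments mpt_class {d T R m} S.

Definition RWM {d} {T : measurableType d} {R : realType}
    (m : {measure set T -> \bar R}) : set (MPT m) :=
  mpt_class @` [set S | rationally_weakly_mixing S].
Arguments RWM {d T R} m.

Definition PSRWM {d} {T : measurableType d} {R : realType}
    (m : {sigma_finite_measure set T -> \bar R}) : set (MPT m) :=
  mpt_class @` [set S | power_subsequence_rationally_weakly_mixing S].
Arguments PSRWM {d T R} m.

(* Main.v *)
(* Both parts follow one scheme.  A transformation is approximated, in the weak
   topology, by one that permutes finitely many disjoint sets ("pieces") of equal
   measure; the permutation is refined on subdivided pieces, changing the
   transformation only on a small set; and every transformation that is close
   enough to the refined permutation keeps its finite-time statistics.  So each
   finite-time property obtained in this way contains a dense open set.

   For (ii) the refinement is a random walk on the pieces: at each time it follows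
   the given permutation with probability [1 - 1/M] and otherwise jumps uniformly.
   The correlations of the pieces then converge exponentially fast to their product
   values.  In powers and products the errors stay small, and a second moment
   argument passes from unions of pieces to all subsets of a fixed set [F], which
   also gives conservativity and ergodicity.

   For (i) a small fraction of each piece is left to the periodic permutation,
   while the rest, [D], is led on a long excursion into new space.  Up to a suitable
   time, a set [F] returns to itself along its periodic fraction much more often
   than [D] visits [F].  Intersecting these sets [D] over rapidly improving stages
   yields a subset of [F] of at least half its measure whose visits to [F] are too
   rare for rational weak mixing with witness [F]. *)
Require Import Defs.
From mathcomp Require Import all_boot all_order all_algebra fingroup perm.
From mathcomp Require Import all_classical all_reals all_analysis.
From mathcomp Require Import measurable_realfun ring lra zify.

Set Implicit Arguments.
Unset Strict Implicit.
Unset Printing Implicit Defensive.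

Import Order.TTheory GRing.Theory Num.Theory.
Import numFieldNormedType.Exports.

Local Open Scope classical_set_scope.
Local Open Scope ring_scope.

(** Both refinements must stay within a prescribed weak distance of the given permutation, so that
    each step departs from it only slightly; what remains free is the time at which the statistics
    are read, chosen after that distance. This is why mixing is obtained along a subsequence only,
    and why mixing and slow returns can both be generic: they are seen at different times.
    Randomness has to be realised by a bijection: each piece is subdivided by a clock and a word of
    letters, and the jumps are read off the word. Mixing holds relative to the union of the pieces
    of a stage, of mass [#|Q| * e]; the factor [(#|Q| * e)^-1] depends on the stage but cancels
    against the return sequence. A stage controls finitely many sets, so a countable test family
    must determine all sets of finite measure. Coding points by reals yields that family, and also
    the exchange of two sets of equal measure by monotone rearrangement, the move from which all
    permutations of pieces are built. *)

(** * Sets of finite measure and their finite unions *)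

Section finite_measure_sets.
Context {d} {T : measurableType d} {R : realType}.
Variable m : {measure set T -> \bar R}.
Implicit Types A B C D : set T.

Definition fmset A := measurable A /\ (m A < +oo)%E.
Definition rmeasure A : R := fine (m A).
Local Notation mr := rmeasure.

Lemma fmset_meas A : fmset A -> measurable A. Proof. by case. Qed.

Lemma mrE A : fmset A -> m A = (mr A)%:E.
Proof. by case=> mA Aoo; rewrite /mr fineK// ge0_fin_numE. Qed.

Lemma mr_ge0 A : 0 <= mr A.
Proof. exact: fine_ge0. Qed.

Lemma fmset0 : fmset set0.
Proof. by split=> //; rewrite measure0. Qed.

Lemma mr0 : mr set0 = 0.
Proof. by rewrite /mr measure0. Qed.

Lemma fmset_sub A B : measurable A -> fmset B -> A `<=` B -> fmset A.
Proof.
move=> mA [mB Boo] AB; split=> //.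
by apply: le_lt_trans Boo; apply: le_measure => //; rewrite inE.
Qed.

Lemma mr_le A B : measurable A -> fmset B -> A `<=` B -> mr A <= mr B.
Proof.
move=> mA fB AB; have fA := fmset_sub mA fB AB.
rewrite -lee_fin -!mrE//; apply: le_measure => //; rewrite inE//.
exact: fmset_meas.
Qed.

Lemma fmsetU A B : fmset A -> fmset B -> fmset (A `|` B).
Proof.
move=> [mA Aoo] [mB Boo]; split; first exact: measurableU.
by apply: le_lt_trans (measureU2 _ mA mB) _; rewrite lte_add_pinfty.
Qed.

Lemma fmsetIl A B : fmset A -> measurable B -> fmset (A `&` B).
Proof.
move=> fA mB; apply: (fmset_sub _ fA); last exact: subIsetl.
by apply: measurableI => //; case: fA.
Qed.

Lemma fmsetIr A B : measurable A -> fmset B -> fmset (A `&` B).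
Proof. by move=> mA fB; rewrite setIC; apply: fmsetIl. Qed.

Lemma fmsetD A B : fmset A -> measurable B -> fmset (A `\` B).
Proof.
by move=> fA mB; rewrite setDE; apply: fmsetIl => //; exact: measurableC.
Qed.

Lemma fmsetY A B : fmset A -> fmset B -> fmset (A `+` B).
Proof.
by move=> fA fB; apply: fmsetU; apply: fmsetD => //; apply: fmset_meas.
Qed.

Lemma mrU A B : fmset A -> fmset B -> A `&` B = set0 ->
  mr (A `|` B) = mr A + mr B.
Proof.
move=> fA fB AB; have fAB := fmsetU fA fB.
by apply: EFin_inj; rewrite EFinD -!mrE// measureU//; case: fA; case: fB.
Qed.

Lemma mrID A B : fmset A -> measurable B -> mr A = mr (A `&` B) + mr (A `\` B).
Proof.
move=> fA mB; rewrite -mrU ?setUIDK//.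
- exact: fmsetIl.
- exact: fmsetD.
- by apply/seteqP; split=> x //= [[]] ? ? [].
Qed.

Lemma mrD A B : fmset A -> measurable B -> B `<=` A ->
  mr (A `\` B) = mr A - mr B.
Proof.
move=> fA mB BA; rewrite (mrID fA mB) setIC.
by rewrite (_ : B `&` A = B); [lra|exact/setIidPl].
Qed.

Lemma mr_leU A B : fmset A -> fmset B -> mr (A `|` B) <= mr A + mr B.
Proof.
move=> fA fB; have fAB := fmsetU fA fB.
rewrite -lee_fin EFinD -!mrE//; apply: measureU2; exact: fmset_meas.
Qed.

Lemma mr_null_sub A B : measurable A -> fmset B -> A `<=` B -> mr B = 0 ->
  mr A = 0.
Proof.
by move=> mA fB AB B0; apply/eqP; rewrite eq_le mr_ge0 andbT -B0; exact: mr_le.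
Qed.

Lemma mr_nullU A B : fmset A -> fmset B -> mr A = 0 -> mr B = 0 ->
  mr (A `|` B) = 0.
Proof.
move=> fA fB A0 B0; apply/eqP; rewrite eq_le mr_ge0 andbT.
by apply: le_trans (mr_leU fA fB) _; rewrite A0 B0 addr0.
Qed.

Lemma mrYC A B : mr (A `+` B) = mr (B `+` A).
Proof. by rewrite setYC. Qed.

Lemma mrYE A B : fmset A -> fmset B ->
  mr (A `+` B) = mr (A `\` B) + mr (B `\` A).
Proof.
move=> fA fB; rewrite -mrU//.
- by apply: fmsetD => //; apply: fmset_meas.
- by apply: fmsetD => //; apply: fmset_meas.
- by apply/seteqP; split=> x //= [[]] ? ? [].
Qed.

Lemma mrY_tri A B C : fmset A -> fmset B -> fmset C ->
  mr (A `+` C) <= mr (A `+` B) + mr (B `+` C).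
Proof.
move=> fA fB fC; rewrite -lee_fin EFinD -!mrE; try exact: fmsetY.
by apply: measure_symdiff_triangle; apply: fmset_meas.
Qed.

Lemma mr_dist A B : fmset A -> fmset B -> `|mr A - mr B| <= mr (A `+` B).
Proof.
move=> fA fB; rewrite mrYE//.
rewrite (mrID fA (fmset_meas fB)) (mrID fB (fmset_meas fA)) setIC.
have := mr_ge0 (A `\` B); have := mr_ge0 (B `\` A).
rewrite ler_norml; lra.
Qed.

Lemma mr_setID A B C : fmset A -> fmset B -> measurable C ->
  `|mr (A `&` C) - mr (B `&` C)| <= mr ((A `+` B) `&` C).
Proof.
move=> fA fB mC.
have -> : (A `+` B) `&` C = (A `&` C) `+` (B `&` C).
  by apply/seteqP; split=> x; rewrite /setY/setU/setD/setI/mkset/=;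
  case: (pselect (C x)); tauto.
by apply: mr_dist; apply: fmsetIl.
Qed.


Definition punion (I : Type) (F : I -> set T) (P : pred I) : set T :=
  [set x | exists2 i, P i & F i x].

Definition disjoint_family (I : Type) (F : I -> set T) :=
  forall i j x, F i x -> F j x -> i = j.

Section finite_unions.
Variables (I : finType) (F : I -> set T).
Hypothesis fF : forall i, fmset (F i).
Implicit Types P Q : pred I.

Lemma punion_big P : punion F P = \big[setU/set0]_(i | P i) F i.
Proof.
rewrite -bigcup_pred; apply/seteqP; split=> x [i Pi Fx]; exists i => //.
Qed.

Lemma fmset_punion P : fmset (punion F P).
Proof.
rewrite punion_big; elim/big_ind: _ => //; first exact: fmset0.
by move=> *; exact: fmsetU.
Qed.

Lemma mr_punion_le P : mr (punion F P) <= \sum_(i | P i) mr (F i).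
Proof.
rewrite punion_big.
suff [] : fmset (\big[setU/set0]_(i | P i) F i) /\
    mr (\big[setU/set0]_(i | P i) F i) <= \sum_(i | P i) mr (F i) by [].
elim/big_ind2: _ => //; first by rewrite mr0; split=> //; exact: fmset0.
move=> A a B b [fA Aa] [fB Bb]; split; first exact: fmsetU.
by apply: le_trans (mr_leU fA fB) _; exact: lerD.
Qed.

Lemma mr_punion P : disjoint_family F ->
  mr (punion F P) = \sum_(i | P i) mr (F i).
Proof.
move=> dF; rewrite punion_big -big_filter -[RHS]big_filter.
have := filter_uniq P (index_enum_uniq I).
elim: [seq i <- _ | P i] => [|i s IHs] /=; first by rewrite !big_nil mr0.
move=> /andP[si us]; rewrite !big_cons.
have fs : fmset (\big[setU/set0]_(j <- s) F j).
  elim/big_ind: _ => //; first exact: fmset0.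
  by move=> *; exact: fmsetU.
rewrite mrU// ?IHs// -bigcup_seq; apply/seteqP; split=> x //= -[Fx [j js Fj]].
by move/negP: si; apply; rewrite (dF _ _ _ Fx Fj).
Qed.

Lemma punionD P Q : disjoint_family F ->
  punion F P `\` punion F Q = punion F [pred i | P i && ~~ Q i].
Proof.
move=> dF; apply/seteqP; split=> x /=.
  move=> [[i Pi Fi] nQ]; exists i => //=; rewrite Pi /=.
  by apply/negP => Qi; apply: nQ; exists i.
move=> [i /andP[Pi Qi] Fi]; split; first by exists i.
by move=> [j Qj Fj]; rewrite (dF _ _ _ Fi Fj) Qj in Qi.
Qed.

Lemma punionU P Q : punion F P `|` punion F Q = punion F [pred i | P i || Q i].
Proof.
apply/seteqP; split=> x /=.
  by move=> [[i Pi Fi]|[i Pi Fi]]; exists i => //=; rewrite Pi ?orbT.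
by move=> [i /orP[Pi|Pi] Fi]; [left|right]; exists i.
Qed.

Lemma sub_punion P Q : subpred P Q -> punion F P `<=` punion F Q.
Proof. by move=> PQ x [i /PQ Pi Fi]; exists i. Qed.

End finite_unions.

Lemma punionY_le (I : finType) (F G : I -> set T) (P : pred I) :
  (forall i, fmset (F i)) -> (forall i, fmset (G i)) ->
  mr (punion F P `+` punion G P) <= \sum_(i | P i) mr (F i `+` G i).
Proof.
move=> fF fG; have fFG i : fmset (F i `+` G i) by exact: fmsetY.
apply: le_trans (mr_punion_le fFG P); apply: mr_le.
- by apply/fmset_meas/fmsetY; exact: fmset_punion.
- exact: fmset_punion.
- move=> x [[[i Pi Fx] nG]|[[i Pi Gx] nF]]; exists i => //.
    by left; split=> // Gx; apply: nG; exists i.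
  by right; split=> // Fx; apply: nF; exists i.
Qed.

End finite_measure_sets.
Arguments punion {d T I} F P.

(** * Iterates of measure preserving maps *)

Section measure_preserving_iterates.
Context {d} {T : measurableType d} {R : realType}.
Variable m : {measure set T -> \bar R}.
Implicit Types (A B : set T) (S : mpt m).

Lemma fmset_preimage S A : fmset m A -> fmset m (S @^-1` A).
Proof.
by move=> [mA Aoo]; split; rewrite ?mpt_preserving//; exact: measurable_mpt_preimage.
Qed.

Lemma mr_preimage S A : measurable A -> rmeasure m (S @^-1` A) = rmeasure m A.
Proof. by move=> mA; rewrite /rmeasure mpt_preserving. Qed.

Lemma iter_preimageS (f : T -> T) k A :
  iter k.+1 f @^-1` A = f @^-1` (iter k f @^-1` A).
Proof. by apply/seteqP; split=> x /=; rewrite -iterS iterSr. Qed.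

Lemma iter_preimageD (f : T -> T) k l A :
  iter (k + l) f @^-1` A = iter l f @^-1` (iter k f @^-1` A).
Proof. by apply/seteqP; split=> x /=; rewrite iterD. Qed.

Lemma measurable_iter S k A : measurable A -> measurable (iter k S @^-1` A).
Proof.
move=> mA; elim: k => // k IHk; rewrite iter_preimageS.
exact: measurable_mpt_preimage.
Qed.

Lemma fmset_iter S k A : fmset m A -> fmset m (iter k S @^-1` A).
Proof.
move=> fA; elim: k => // k IHk; rewrite iter_preimageS.
exact: fmset_preimage.
Qed.

Lemma mr_iter S k A : measurable A -> rmeasure m (iter k S @^-1` A) = rmeasure m A.
Proof.
move=> mA; elim: k => // k IHk; rewrite iter_preimageS mr_preimage//.
exact: measurable_iter.
Qed.

Lemma preimage_symdiff (f : T -> T) A B :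
  f @^-1` (A `+` B) = (f @^-1` A) `+` (f @^-1` B).
Proof. by []. Qed.

Lemma image_mpt S A : S @` A = mpt_inverse S @^-1` A.
Proof.
apply/seteqP; split => [_ [x Ax <-]|x Ax] /=; first by rewrite mpt_funK.
by exists (mpt_inv S x) => //; rewrite mpt_invK.
Qed.

Lemma mr_image_symdiff S A B : measurable A -> measurable B ->
  rmeasure m (S @` A `+` B) = rmeasure m (A `+` S @^-1` B).
Proof.
move=> mA mB; rewrite image_mpt -(mr_preimage S).
  rewrite preimage_symdiff (_ : S @^-1` (_ @^-1` A) = A)//.
  by apply/seteqP; split=> x /=; rewrite mpt_funK.
by apply: measurable_symdiff => //; exact: measurable_mpt_preimage.
Qed.

Lemma iter_mpt_inverseK S k : cancel (iter k S) (iter k (mpt_inverse S)).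
Proof.
by elim: k => // k IHk x; rewrite iterSr [iter k.+1 S x]iterS /= mpt_funK IHk.
Qed.

Lemma mr_iter_inverse S k A B : measurable A -> measurable B ->
  rmeasure m (A `&` iter k (mpt_inverse S) @^-1` B) =
  rmeasure m (B `&` iter k S @^-1` A).
Proof.
move=> mA mB; rewrite -(mr_iter S k).
  congr (rmeasure m _); apply/seteqP; split=> x /=; rewrite iter_mpt_inverseK;
  by case.
by apply: measurableI => //; exact: measurable_iter.
Qed.

(** The error grows only linearly in time: pulling back by [S] preserves the measure of the error
    already made, and each step adds at most [e]. *)
Lemma mr_iter_pieces (Q : finType) (I : Q -> set T) (sigma : {perm Q}) S
    (e : R) (k : nat) (x : Q) : (forall x, fmset m (I x)) ->
  (forall x, rmeasure m (S @^-1` I (sigma x) `+` I x) <= e) ->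
  rmeasure m (iter k S @^-1` I (iter k sigma x) `+` I x) <= e *+ k.
Proof.
move=> fI hS; elim: k x => [|k IHk] x /=.
  by rewrite setYK mr0.
rewrite iter_preimageS -iterS iterSr mulrS addrC.
apply: le_trans (mrY_tri (fmset_preimage S (fmset_iter S k (fI _)))
  (fmset_preimage S (fI (sigma x))) (fI x)) _.
apply: lerD => //; rewrite -preimage_symdiff mr_preimage//.
by apply/fmset_meas/fmsetY => //; exact: fmset_iter.
Qed.

End measure_preserving_iterates.

Section atoms.
Context {d} {X : measurableType d} {R : realType}.
Variable m : {measure set X -> \bar R}.

Lemma atoms (L : finType) (B : L -> set X) : (forall i, fmset m (B i)) ->
  exists D : {ffun L -> bool} -> set X,
    [/\ forall a, fmset m (D a), disjoint_family D &
      forall i, B i = punion D (fun a => a i)].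
Proof.
move=> fB; pose code x : {ffun L -> bool} := [ffun i => `[< B i x >]].
(* The all-false code describes the complement of every [B i], which may have infinite measure;
   requiring [exists i, a i] replaces that cell by the empty set. *)
pose D (a : {ffun L -> bool}) := [set x | code x = a /\ exists i, a i].
have mD a : measurable (D a).
  have [ai|nai] := pselect (exists i, a i); last first.
    by rewrite (_ : D a = set0) //; apply/seteqP; split=> // x [].
  rewrite (_ : D a = \bigcap_(i in setT) (if a i then B i else ~` B i)).
    apply: fin_bigcap_measurable => [|i _]; first exact: finite_finset.
    by case: (a i); [|apply: measurableC]; exact: fmset_meas (fB i).
  apply/seteqP; split=> x /=.
    by move=> [<- _] i _; rewrite ffunE; case: asboolP.
  move=> h; split=> //; apply/ffunP => i; rewrite ffunE; have := h i I.
  by case: (a i) => hi; [rewrite asboolT|rewrite asboolF].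
exists D; split.
- move=> a; have [[i ai]|nai] := pselect (exists i, a i).
    apply: (fmset_sub (mD a) (fB i)) => x [cx _].
    by move: ai; rewrite -cx ffunE => /asboolP.
  rewrite (_ : D a = set0); first exact: fmset0.
  by apply/seteqP; split=> // x [].
- by move=> a b x [<- _] [<- _].
- move=> i; apply/seteqP; split=> x.
    move=> Bx; exists (code x); first by rewrite ffunE asboolT.
    by split=> //; exists i; rewrite ffunE asboolT.
  by move=> [a ai [cx _]]; move: ai; rewrite -cx ffunE => /asboolP.
Qed.

End atoms.

(** * Coding a standard Borel space by real numbers *)

Section cantor_coding.
Context {R : realType}.
Implicit Types c : nat -> bool.

Let indic_mkset (U : Type) (b : U -> bool) x : \1_[set y | b y] x = (b x)%:R :> R.
Proof.
rewrite indicE; congr (nat_of_bool _)%:R.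
by apply/idP/idP; [rewrite inE|move=> bx; rewrite inE].
Qed.

Let csum c (n : nat) : R := \sum_(0 <= k < n) ((c k)%:R * 2 / 3 ^+ k.+1).

Definition cantor_code c : R := limn (csum c).

(** The shift of the Cantor set: codes starting with 0 lie in [0, 1/3] and codes starting with 1 in
    [2/3, 1], so comparing with 1/2 reads the first digit and the affine map deletes it. Being
    defined on all of [R], it decodes every real number measurably. *)
Let step (y : R) : R := 3 * y - (2^-1 <= y)%R%:R * 2.

Definition cantor_digit (y : R) (k : nat) : bool := 2^-1 <= iter k step y.

Let csum_recl c n :
  csum c n.+1 = ((c 0)%:R * 2 + csum (fun k => c k.+1) n) / 3.
Proof.
rewrite /csum big_nat_recl//= mulrDl expr1; congr (_ + _).
rewrite mulr_suml; apply: eq_bigr => k _.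
by rewrite [3 ^+ k.+2]exprS invfM; ring.
Qed.

Let csum_ge0 c n : 0 <= csum c n.
Proof.
apply: sumr_ge0 => k _; apply: divr_ge0; last exact: exprn_ge0.
by rewrite mulr_ge0.
Qed.

Let csum_le1 c n : csum c n <= 1.
Proof.
elim: n c => [|n IHn] c; first by rewrite /csum big_geq.
rewrite csum_recl; have := IHn (fun k => c k.+1).
have : (c 0)%:R <= 1 :> R by case: (c 0).
lra.
Qed.

Let csum_cvg c : csum c @ \oo --> cantor_code c.
Proof.
apply: nondecreasing_is_cvgn.
  apply/nondecreasing_seqP => n; rewrite /csum big_nat_recr//= lerDl.
  by apply: divr_ge0; [rewrite mulr_ge0|exact: exprn_ge0].
by exists 1 => _ [n _ <-]; exact: csum_le1.
Qed.

Let cantor_codeS c :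
  cantor_code c = ((c 0)%:R * 2 + cantor_code (fun k => c k.+1)) / 3.
Proof.
have h : csum c n.+1 @[n --> \oo] --> cantor_code c.
  by have := @csum_cvg c; rewrite -(cvg_shiftS (csum c)).
apply: (cvg_unique _ h) => //.
rewrite (_ : (fun n => _) =
    (fun n => ((c 0)%:R * 2 + csum (fun k => c k.+1) n) / 3)); last first.
  by apply/funext => n; exact: csum_recl.
by apply: cvgMl; apply: cvgD; [exact: cvg_cst|exact: csum_cvg].
Qed.

Let cantor_code01 c : 0 <= cantor_code c <= 1.
Proof.
have h := @csum_cvg c; have hc : cvgn (csum c) by apply/cvg_ex; exists (cantor_code c).
apply/andP; split.
  by apply: limr_ge => //; near=> n; exact: csum_ge0.
by apply: limr_le => //; near=> n; exact: csum_le1.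
Unshelve. all: by end_near.
Qed.

Lemma cantor_codeK c k : cantor_digit (cantor_code c) k = c k.
Proof.
suff h : iter k step (cantor_code c) =
    cantor_code (fun i => c (k + i)%N).
  rewrite /cantor_digit h cantor_codeS addn0.
  have := cantor_code01 (fun i => c (k + i.+1)%N).
  by case: (c k) => /= ?; [apply/idP; lra|apply/negbTE; rewrite -ltNge; lra].
elim: k c => [|k IHk] c //=.
rewrite IHk /step cantor_codeS addn0.
rewrite (_ : (fun i => c (k.+1 + i)%N) = (fun i => c (k + i.+1)%N)); last first.
  by apply/funext => i; rewrite addSnnS.
have h : (2^-1 <= ((c k)%:R * 2 + cantor_code (fun i => c (k + i.+1)%N)) / 3 :> R) = c k.
  have := cantor_code01 (fun i => c (k + i.+1)%N).
  by case: (c k) => /= ?; [apply/idP; lra|apply/negbTE; rewrite -ltNge; lra].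
by rewrite h; field.
Qed.

Lemma measurable_cantor_digit k : measurable [set y : R | cantor_digit y k].
Proof.
have mhalf : measurable [set y : R | 2^-1 <= y].
  rewrite (_ : mkset _ = `[2^-1, +oo[%classic) //.
  by apply/seteqP; split=> y /=; rewrite in_itv/= andbT.
have ms : measurable_fun setT step.
  apply: measurable_funB; first exact: measurable_funM.
  apply: measurable_funM => //.
  rewrite (_ : (fun y => _) = \1_[set y : R | 2^-1 <= y]).
    exact: measurable_indic.
  by apply/funext => y; rewrite indic_mkset.
have mi : measurable_fun setT (iter k step).
  by elim: k => [|k IHk] /=; [exact: measurable_id|exact: measurableT_comp].
by rewrite -[X in measurable X]setTI; exact: (mi measurableT _ mhalf).
Qed.

Lemma measurable_cantor_code d (T : measurableType d) (b : T -> nat -> bool) :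
  (forall k, measurable [set x | b x k]) ->
  measurable_fun setT (cantor_code \o b).
Proof.
move=> mb.
apply: (@measurable_fun_cvg _ _ _ _ (fun n x => csum (b x) n)).
  move=> n; apply: measurable_sum => k.
  do 2 apply: measurable_funM => //.
  rewrite (_ : (fun x => _) = \1_[set x : T | b x k]).
    exact: measurable_indic.
  by apply/funext => y; rewrite indic_mkset.
by move=> x _; exact: csum_cvg.
Qed.

End cantor_coding.
Section polish_coding.
Context {R : realType} {P : completePseudoMetricType R}.
Variable a : nat -> P.
Hypothesis hausP : hausdorff_space P.
Hypothesis dense_a : forall x (e : R), 0 < e -> exists i, ball x e (a i).

Let r (n : nat) : R := 2^-1 ^+ n.

Let r_gt0 n : 0 < r n. Proof. by rewrite exprn_gt0. Qed.

Let rS n : r n = 2 * r n.+1.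
Proof. by rewrite /r exprS; field. Qed.

Let small_r (e : R) : 0 < e -> exists N, forall n, (N <= n)%N -> r n < e.
Proof.
move=> e0; have : (2^-1 : R) ^+ n @[n --> \oo] --> 0.
  by apply: cvg_expr; rewrite ger0_norm ?invr_ge0// invf_lt1// ltr1n.
move=> /cvgrPdist_lt /(_ _ e0) [N _ h]; exists N => n Nn.
by have := h n Nn; rewrite sub0r normrN ger0_norm// ltW.
Qed.

(** Interiors are taken because a ball of a pseudometric structure need not be open; each bit thus
    tests membership in an open set. The pair [k] consists of a scale and the index of a centre. *)
Definition polish_bit (x : P) (k : nat * nat) : bool :=
  `[< interior (ball (a k.2) (r k.1)) x >].

Let lead (b : nat * nat -> bool) n i :=
  b (n, i) /\ forall j, (j < i)%N -> ~~ b (n, j).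

Let first_inj b n i j : lead b n i -> lead b n j -> i = j.
Proof.
move=> [bi hi] [bj hj]; have [ij|ji|//] := ltngtP i j.
  by have := hj _ ij; rewrite bi.
by have := hi _ ji; rewrite bj.
Qed.

(** The code of a point satisfies this, since two leading balls that share the point have centres
    closer than [r n + r n.+1]. The condition involves countably many bits and already forces the
    leading centres to converge. *)
Let good (b : nat * nat -> bool) :=
  (forall n, exists i, lead b n i) /\
  forall n i j, lead b n i -> lead b n.+1 j -> ball (a i) (2 * r n) (a j).

Let near_all (b : nat * nat -> bool) (x : P) :=
  forall n i, lead b n i -> ball (a i) (6 * r n) x.

(** Decoding has to be total, since it is applied to the digits of arbitrary real numbers: bad codes
    go to the default [point]. *)
Definition polish_point b : P :=
  if `[< good b >] then get (near_all b) else point.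

(** The leading centres form a Cauchy sequence, because the steps [2 * r n] are summable;
    completeness gives the limit. *)
Let good_near b : good b -> exists x, near_all b x.
Proof.
move=> [ex cl]; have [s sP] := choice ex.
(* The radius telescopes, since [2 * r j = 4 * r j - 4 * r j.+1]. It starts at [r n] and not at 0,
   because a ball contains its centre only for a positive radius. *)
have step n k : ball (a (s n)) (5 * r n - 4 * r (n + k)%N) (a (s (n + k)%N)).
  elim: k => [|k IHk].
    by rewrite addn0; apply: ballxx; have := r_gt0 n; lra.
  have := ball_triangle IHk (cl _ _ _ (sP (n + k)%N) (sP (n + k).+1)).
  rewrite addnS; apply: le_ball.
  by rewrite (rS (n + k)); have := r_gt0 (n + k).+1; lra.
have step' n k : ball (a (s n)) (5 * r n) (a (s (n + k)%N)).
  by apply: le_ball (step n k); have := r_gt0 (n + k); lra.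
have cvs : cvg (a \o s @ \oo).
  apply: cauchy_cvg; apply: cauchy_exP => e e0.
  have e6 : 0 < e / 6 by lra.
  have [N hN] := small_r e6.
  exists (a (s N)); exists N => // n /= Nn.
  rewrite -(subnKC Nn); apply: le_ball (step' N (n - N)%N).
  by have := hN N (leqnn _); lra.
exists (lim (a \o s @ \oo)) => n i fi.
rewrite (first_inj fi (sP n)).
have /cvg_ballP/(_ _ (r_gt0 n)) [N _ hN] := cvs.
have h1 := hN (n + N)%N (leq_addl _ _).
have := ball_triangle (step' n N) (ball_sym h1).
by apply: le_ball; lra.
Qed.

Let near_uniq b x y : good b -> near_all b x -> near_all b y -> x = y.
Proof.
move=> [ex _] nx ny; apply: contrapT => /eqP xy.
have := hausP; rewrite ball_hausdorff => /(_ x y xy)[[e1 e2] /= /eqP h0].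
have e13 : 0 < e1%:num / 13 by have : 0 < e1%:num by []; lra.
have [N1 h1] := small_r e13.
have [i fi] := ex N1.
have : ball x e1%:num y.
  apply: le_ball (ball_triangle (ball_sym (nx _ _ fi)) (ny _ _ fi)).
  by have := h1 _ (leqnn _); lra.
move=> xy1; suff : set0 y by [].
by rewrite -h0; split => //; exact: ballxx.
Qed.

Lemma polish_bitK x : polish_point (polish_bit x) = x.
Proof.
have nx : near_all (polish_bit x) x.
  move=> n i [/asboolP /interior_subset h _].
  by apply: le_ball h; have := r_gt0 n; lra.
have gx : good (polish_bit x).
  split=> [n|n i j [/asboolP/interior_subset hi _] [/asboolP/interior_subset hj _]].
    have [i hi] : exists i, polish_bit x (n, i).
      have [i hi] := dense_a x (r_gt0 n.+1); exists i; apply/asboolP.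
      apply/nbhs_ballP; exists (r n.+1) => //= y xy.
      have := ball_triangle (ball_sym hi) xy.
      by apply: le_ball; rewrite (rS n); lra.
    have h : exists j, polish_bit x (n, j) by exists i.
    exists (ex_minn h); case: ex_minnP => k bk kmin; split => // j jk.
    by apply/negP => /kmin; rewrite leqNgt jk.
  apply: le_ball (ball_triangle hi (ball_sym hj)).
  by rewrite /= (rS n); have := r_gt0 n.+1; lra.
rewrite /polish_point asboolT//.
by apply: (near_uniq gx) => //; apply: getPex; exists x.
Qed.

Lemma open_polish_bit k : open [set x | polish_bit x k].
Proof.
rewrite (_ : mkset _ = (ball (a k.2) (r k.1))^°); first exact: open_interior.
by apply/seteqP; split=> x /=; [move/asboolP|move=> ?; apply/asboolP].
Qed.

(** For a good code the point lies in the open set [U] iff, at some scale, the ball of radius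
    [6 * r n] around the leading centre is contained in [U]; these are countably many conditions on
    bits. Bad codes contribute only the constant condition on [point]. *)
Lemma measurable_polish_point d (T : measurableType d)
    (b : T -> nat * nat -> bool) U :
  (forall k, measurable [set x | b x k]) -> open U ->
  measurable [set x | U (polish_point (b x))].
Proof.
move=> mb oU.
have mfirst n i : measurable [set x | lead (b x) n i].
  rewrite (_ : mkset _ = [set x | b x (n, i)] `&`
      \bigcap_(j in [set j | (j < i)%N]) ~` [set x | b x (n, j)]).
    apply: measurableI => //; apply: bigcap_measurableType => j _.
    exact: measurableC.
  by apply/seteqP; split=> x /= -[bx h]; split=> // j ji; apply/negP;
    apply: h.
have mgood : measurable [set x | good (b x)].
  rewrite (_ : mkset _ = (\bigcap_n \bigcup_i [set x | lead (b x) n i]) `&`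
      \bigcap_n \bigcap_i \bigcap_j
        ((~` [set x | lead (b x) n i]) `|` (~` [set x | lead (b x) n.+1 j]) `|`
         [set _ | ball (a i) (2 * r n) (a j)])).
    apply: measurableI.
      by apply: bigcap_measurableType => n _; exact: bigcup_measurable.
    apply: bigcap_measurableType => n _; apply: bigcap_measurableType => i _.
    apply: bigcap_measurableType => j _.
    apply: measurableU; first by apply: measurableU; exact: measurableC.
    have [h|h] := pselect (ball (a i) (2 * r n) (a j)).
      by rewrite (_ : mkset _ = setT) //; apply/seteqP; split.
    by rewrite (_ : mkset _ = set0) //; apply/seteqP; split.
  apply/seteqP; split=> x /= [h1 h2]; split.
  - by move=> n _; have [i fi] := h1 n; exists i.
  - move=> n _ i _ j _; have [fi|] := pselect (lead (b x) n i); last by left; left.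
    have [fj|] := pselect (lead (b x) n.+1 j); last by left; right.
    by right; exact: h2.
  - by move=> n; have [i _ fi] := h1 n I; exists i.
  - by move=> n i j fi fj; have [[//|//]|//] := h2 n I i I j I.
rewrite (_ : mkset _ = ([set x | good (b x)] `&`
    \bigcup_n \bigcup_i ([set x | lead (b x) n i] `&`
       [set _ | ball (a i) (6 * r n) `<=` U])) `|`
    (~` [set x | good (b x)] `&` [set _ | U point])).
  have mc (Q : Prop) : measurable [set _ : T | Q].
    have [h|h] := pselect Q.
      by rewrite (_ : mkset _ = setT) //; apply/seteqP; split.
    by rewrite (_ : mkset _ = set0) //; apply/seteqP; split.
  apply: measurableU; last by apply: measurableI => //; exact: measurableC.
  apply: measurableI => //; apply: bigcup_measurable => n _; apply: bigcup_measurable => i _.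
  exact: measurableI.
apply/seteqP; split=> x /=.
  rewrite /polish_point; case: asboolP => gb Ux; last by right.
  left; split=> //; have /getPex ng := good_near gb.
  move: oU; rewrite openE => /(_ _ Ux)/nbhs_ballP[e /= e0 eU].
  have e13 : 0 < e / 13 by lra.
  have [N hN] := small_r e13.
  have [i fi] := gb.1 N; exists N => //; exists i => //; split=> // z hz.
  apply: eU; apply: le_ball (ball_triangle (ball_sym (ng _ _ fi)) hz).
  by have := hN _ (leqnn _); lra.
rewrite /polish_point; case: asboolP => gb; last by case=> -[].
move=> [[_ [n _ [i _ [fi]]]]|[]//]; apply.
by have /getPex := good_near gb; apply.
Qed.

End polish_coding.
Lemma countable_dense_seq {R : realType} (P : completePseudoMetricType R)
    (D : set P) : countable D -> dense D ->
  exists a : nat -> P, forall x (e : R), 0 < e -> exists i, ball x e (a i).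
Proof.
move=> /countable_injP[c injc] dD.
have /choice[a aP] : forall n, exists y,
    (exists2 x, D x & c x = n) -> D y /\ c y = n.
  move=> n; have [[x Dx cx]|no] := pselect (exists2 x, D x & c x = n).
    by exists x.
  by exists point => /no.
exists a => x e e0.
have [y [/interior_subset xy Dy]] : ((ball x e)^° `&` D) !=set0.
  apply: dD; last exact: open_interior.
  by exists x; apply/nbhs_ballP; exists e.
have [Da ca] := aP (c y) (ex_intro2 _ _ y Dy erefl).
by exists (c y); rewrite (injc _ _ _ _ ca) ?inE.
Qed.

(* A point is coded by the ternary digits recording which small balls contain it,
   and it is recovered from any code by a limit. *)
Lemma standard_borel_retract d (X : measurableType d) (R : realType) :
  standard_borel X R -> exists (f : X -> R) (g : R -> X),
    [/\ measurable_fun setT f, measurable_fun setT g & cancel f g].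
Proof.
move=> [P [phi [hausP [D cD dD] bij_phi mX]]].
have [a aP] := countable_dense_seq cD dD.
have [psi phiK psiK] := bij_phi.
pose bits (x : X) k :=
  if @unpickle (nat * nat)%type k is Some q then polish_bit a (phi x) q else false.
pose f : X -> R := cantor_code \o bits.
pose g (y : R) := psi (polish_point a (fun q => cantor_digit y (pickle q))).
exists f, g; split.
- apply: measurable_cantor_code => k; rewrite /bits.
  case: (unpickle k) => [q|]; last first.
    by rewrite (_ : mkset _ = set0) //; apply/seteqP; split.
  rewrite mX; exists [set y | polish_bit a y q] => //.
  by apply: sub_sigma_algebra; exact: open_polish_bit.
- move=> _ A mA; rewrite setTI.
  have [B sB <-] : [set phi @^-1` B | B in <<s @open P >>] A by rewrite -mX.
  have h U : open U ->
      measurable [set y : R | U (polish_point a (fun q => cantor_digit y (pickle q)))].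
    by move=> oU; apply: measurable_polish_point => // k; exact: measurable_cantor_digit.
  rewrite (_ : g @^-1` _ = [set y : R | B (polish_point a (fun q => cantor_digit y (pickle q)))]); last first.
    by apply/seteqP; split=> y /=; rewrite /g psiK.
  move: B sB; apply: smallest_sub => // ; split => [|B mB|F mF].
  + by rewrite (_ : mkset _ = set0) //; apply/seteqP; split.
  + rewrite (_ : mkset _ = ~` [set y : R | B (polish_point a (fun q => cantor_digit y (pickle q)))]).
      exact: measurableC.
    by apply/seteqP; split=> y /= => [[]|].
  + rewrite (_ : mkset _ = \bigcup_n [set y : R | F n (polish_point a (fun q => cantor_digit y (pickle q)))]).
      exact: bigcup_measurable.
    by apply/seteqP; split=> y [n _ h']; exists n.
- move=> x; rewrite /g /f /=.
  rewrite (_ : (fun q => _) = polish_bit a (phi x)).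
    by rewrite polish_bitK// phiK.
  by apply/funext => q; rewrite cantor_codeK /bits pickleK.
Qed.


(** * Swapping sets of equal measure *)

Section continuity_of_measure.
Context {d} {T : measurableType d} {R : realType}.
Variable m : {measure set T -> \bar R}.
Implicit Types (A B : set T) (F : (set T)^nat).

Lemma nondecreasing_sets F : (forall n, F n `<=` F n.+1) ->
  forall n k, (n <= k)%N -> F n `<=` F k.
Proof.
move=> ndF n k /subnKC <-; elim: (k - n)%N => [|i IHi]; first by rewrite addn0.
by rewrite addnS; apply: subset_trans (ndF _).
Qed.

Lemma mr_bigcup_lim F (e : R) : (forall n, measurable (F n)) ->
  (forall n, F n `<=` F n.+1) -> fmset m (\bigcup_n F n) -> 0 < e ->
  exists N, forall n, (N <= n)%N -> rmeasure m (\bigcup_n F n) - e < rmeasure m (F n).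
Proof.
move=> mF ndF fF e0.
have ffF n : fmset m (F n) by apply: (fmset_sub (mF n) fF) => x Fx; exists n.
have /= h : m (F n) @[n --> \oo] --> m (\bigcup_n F n).
  apply: nondecreasing_cvg_mu => //; first exact: fmset_meas fF.
  by move=> i k ik; apply/subsetPset; exact: nondecreasing_sets.
have : rmeasure m (F n) @[n --> \oo] --> rmeasure m (\bigcup_n F n).
  by rewrite (mrE fF) in h; exact: fine_cvg h.
move=> /cvgrPdist_lt /(_ _ e0)[N _ hN]; exists N => n /hN /=.
by rewrite ltr_norml => /andP[_]; lra.
Qed.

Lemma mr_bigcup_le F (c : R) : (forall n, measurable (F n)) ->
  (forall n, F n `<=` F n.+1) -> fmset m (\bigcup_n F n) ->
  (forall n, rmeasure m (F n) <= c) -> rmeasure m (\bigcup_n F n) <= c.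
Proof.
move=> mF ndF fF hc; rewrite leNgt; apply/negP => lt.
have [|N /(_ N (leqnn _))] := mr_bigcup_lim mF ndF fF (e := rmeasure m (\bigcup_n F n) - c).
  by rewrite subr_gt0.
by have := hc N; lra.
Qed.

Lemma mr_bigcap_ge F (c : R) : (forall n, fmset m (F n)) ->
  (forall n, F n.+1 `<=` F n) -> (forall n, c <= rmeasure m (F n)) ->
  c <= rmeasure m (\bigcap_n F n).
Proof.
move=> fF niF hc; have mF n := fmset_meas (fF n).
have mI : measurable (\bigcap_n F n) by exact: bigcap_measurableType.
have IF0 : \bigcap_n F n `<=` F 0 by move=> x; apply.
have E : F 0 `\` \bigcap_n F n = \bigcup_n (F 0 `\` F n).
  by rewrite setDE setC_bigcap setI_bigcupr.
suff : rmeasure m (F 0 `\` \bigcap_n F n) <= rmeasure m (F 0) - c.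
  by rewrite mrD//; lra.
have niF0 n : F n `<=` F 0 by elim: n => // n; exact: subset_trans (niF n).
have mD n : measurable (F 0 `\` F n) by apply: measurableD.
rewrite E; apply: mr_bigcup_le => //.
- by move=> n x [F0x nF]; split=> // /niF.
- rewrite -E; exact: fmsetD.
- by move=> n; rewrite mrD//; have := hc n; lra.
Qed.

End continuity_of_measure.

Section quantiles.
Context {d} {X : measurableType d} {R : realType}.
Variables (m : {measure set X -> \bar R}) (f : X -> R).
Hypothesis mf : measurable_fun setT f.
Hypothesis f_inj : injective f.
Hypothesis na : non_atomic m.
Implicit Types (A B : set X) (s t y : R).

Definition cdf_of A y : R := rmeasure m (A `&` [set x | f x <= y]).

Definition quantile A t : R := sup [set y | cdf_of A y < t].

Lemma measurable_ray y : measurable [set x | f x <= y].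
Proof.
rewrite (_ : mkset _ = setT `&` f @^-1` `]-oo, y]%classic); first exact: mf.
by apply/seteqP; split=> x /=; rewrite in_itv/= => // -[].
Qed.

Lemma measurable_ray_lt y : measurable [set x | f x < y].
Proof.
rewrite (_ : mkset _ = setT `&` f @^-1` `]-oo, y[%classic); first exact: mf.
by apply/seteqP; split=> x /=; rewrite in_itv/= => // -[].
Qed.

Lemma fmset_ray A y : fmset m A -> fmset m (A `&` [set x | f x <= y]).
Proof. by move=> fA; apply: fmsetIl => //; exact: measurable_ray. Qed.

Lemma cdf_le A y z : fmset m A -> y <= z -> cdf_of A y <= cdf_of A z.
Proof.
move=> fA yz; apply: mr_le _ (fmset_ray _ fA) _.
  exact: fmset_meas (fmset_ray _ fA).
by move=> x [Ax /= h]; split=> //=; exact: le_trans yz.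
Qed.

Lemma cdf_of_ge0 A y : 0 <= cdf_of A y. Proof. exact: mr_ge0. Qed.

Lemma cdf_le_mr A y : fmset m A -> cdf_of A y <= rmeasure m A.
Proof.
move=> fA; apply: mr_le => //.
exact: fmset_meas (fmset_ray _ fA).
Qed.

(** By injectivity of [f] the fiber has at most one point, so it has no nonempty proper subset that
    could witness non-atomicity. *)
Lemma mr_fiber0 A y : fmset m A -> rmeasure m (A `&` [set x | f x = y]) = 0.
Proof.
move=> fA.
have mZ : measurable (A `&` [set x | f x = y]).
  rewrite (_ : [set x | _] = [set x | f x <= y] `\` [set x | f x < y]).
    apply: measurableI; first exact: fmset_meas fA.
    by apply: measurableD; [exact: measurable_ray|exact: measurable_ray_lt].
  apply/seteqP; split=> x /=; first by move=> ->; split; [|rewrite ltxx].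
  by move=> [xy /negP]; rewrite -leNgt => yx; apply/eqP; rewrite eq_le xy.
have fZ : fmset m (A `&` [set x | f x = y]).
  by apply: (fmset_sub mZ fA) => x [].
apply/eqP/negPn/negP => n0.
have : (0 < m (A `&` [set x | f x = y]))%E.
  by rewrite (mrE fZ) lte_fin lt_neqAle eq_sym n0 mr_ge0.
move=> /(na mZ)[B [mB BZ B0 Blt]].
have [[x Bx]|B_0] := pselect (B !=set0); last first.
  by move: B0; rewrite (_ : B = set0) ?measure0 ?ltxx//; apply/seteqP; split=> // z Bz; apply: B_0; exists z.
suff BE : B = A `&` [set x | f x = y] by rewrite BE ltxx in Blt.
apply/seteqP; split=> // z [Az /= fz].
by have [_ /= fx] := BZ _ Bx; rewrite (f_inj (etrans fz (esym fx))).
Qed.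

Lemma cdf_small A e : fmset m A -> 0 < e -> exists y, cdf_of A y < e.
Proof.
move=> fA e0; apply: contrapT => h.
have : e <= rmeasure m (\bigcap_n (A `&` [set x | f x <= - n%:R])).
  apply: mr_bigcap_ge => n.
  - exact: fmset_ray.
  - move=> x [Ax /= fx]; split=> //=; apply: le_trans fx _.
    by rewrite lerN2 ler_nat.
  - by rewrite leNgt; apply/negP => h'; apply: h; exists (- n%:R).
rewrite (_ : \bigcap_n _ = set0) ?mr0; first by rewrite leNgt e0.
apply/seteqP; split=> // x /(_ (Num.trunc `|f x|).+1 I)[_ /=].
have := truncnS_gt `|f x|; have := ler_norm (- f x); rewrite normrN; lra.
Qed.

Lemma cdf_large A t : fmset m A -> t < rmeasure m A -> exists y, t < cdf_of A y.
Proof.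
move=> fA tA.
have UA : \bigcup_n (A `&` [set x | f x <= n%:R]) = A.
  apply/seteqP; split=> [x [n _ []]//|x Ax].
  exists (Num.trunc `|f x|).+1 => //; split=> //=.
  by have := truncnS_gt `|f x|; have := ler_norm (f x); lra.
have [||||N /(_ N (leqnn _))] := @mr_bigcup_lim _ _ _ m
    (fun n => A `&` [set x | f x <= n%:R]) (rmeasure m A - t).
- by move=> n; exact: fmset_meas (fmset_ray _ fA).
- by move=> n x [Ax /= fx]; split=> //=; apply: le_trans fx _; rewrite ler_nat.
- by rewrite UA.
- by rewrite subr_gt0.
- by rewrite UA => h; exists N%:R; rewrite /cdf_of; lra.
Qed.

Let quantile_has_sup A t : fmset m A -> 0 < t < rmeasure m A ->
  has_sup [set y | cdf_of A y < t].
Proof.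
move=> fA /andP[t0 tA]; split.
  by have [y hy] := cdf_small fA t0; exists y.
have [y hy] := cdf_large fA tA; exists y => z /= zt.
rewrite leNgt; apply/negP => yz; have := cdf_le fA (ltW yz); lra.
Qed.

(** The supremum gives [<= t] for the limit from the left and [>= t] for the limit from the right;
    fibers being null, the distribution function has no jump in between. *)
Lemma cdf_quantile A t : fmset m A -> 0 < t < rmeasure m A ->
  cdf_of A (quantile A t) = t.
Proof.
move=> fA tA; have hs := quantile_has_sup fA tA.
set q := quantile A t; apply/eqP; rewrite eq_le; apply/andP; split.
- pose F n := A `&` [set x | f x <= q - n.+1%:R^-1].
  have mF n : measurable (F n) by exact: fmset_meas (fmset_ray _ fA).
  have UF : \bigcup_n F n = A `&` [set x | f x < q].
    apply/seteqP; split=> x.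
      move=> [n _ [Ax /= h]]; split=> //=; apply: le_lt_trans h _.
      by rewrite ltrBlDr ltrDl.
    move=> [Ax /= h]; exists (Num.trunc (q - f x)^-1) => //; split=> //=.
    rewrite lerBrDr -lerBrDl invf_ple ?posrE ?subr_gt0//.
    exact/ltW/truncnS_gt.
  have fU : fmset m (\bigcup_n F n).
    by rewrite UF; apply: fmsetIl => //; exact: measurable_ray_lt.
  have : rmeasure m (\bigcup_n F n) <= t.
    apply: mr_bigcup_le => // n.
      move=> x [Ax /= h]; split=> //=; apply: le_trans h _.
      by rewrite lerD2l lerN2 lef_pV2 ?posrE// ler_nat.
    have : q - n.+1%:R^-1 < q by rewrite ltrBlDr ltrDl.
    move=> /(sup_gt hs.1) [y /= yt qy].
    exact: le_trans (cdf_le fA (ltW qy)) (ltW yt).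
  apply: le_trans.
  have -> : cdf_of A q = rmeasure m ((\bigcup_n F n) `|` (A `&` [set x | f x = q])).
    rewrite UF -setIUr; congr (rmeasure m (A `&` _)).
    by apply/seteqP; split=> x /=; rewrite le_eqVlt;
      [move=> /orP[/eqP|]; [right|left]|move=> [->|/eqP ->]; rewrite ?orbT].
  rewrite -[leRHS]addr0 -(mr_fiber0 q fA); apply: mr_leU => //.
  apply: (fmset_sub _ fA); last by move=> x [].
  rewrite (_ : [set x | _] = [set x | f x <= q] `\` [set x | f x < q]).
    apply: measurableI; first exact: fmset_meas fA.
    by apply: measurableD; [exact: measurable_ray|exact: measurable_ray_lt].
  apply/seteqP; split=> x /=; first by move=> ->; split; [|rewrite ltxx].
  by move=> [xy /negP]; rewrite -leNgt => yx; apply/eqP; rewrite eq_le xy.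
- have -> : cdf_of A q = rmeasure m (\bigcap_n (A `&` [set x | f x <= q + n.+1%:R^-1])).
    congr (rmeasure m _); apply/seteqP; split=> x.
      by move=> [Ax /= h] n _; split=> //=; rewrite (le_trans h)// lerDl.
    move=> h; have [Ax _] := h 0 I; split=> //=.
    rewrite leNgt; apply/negP => qx.
    have [_ /=] := h (Num.trunc (f x - q)^-1) I.
    apply/negP; rewrite -ltNge -ltrBrDl invf_plt ?posrE ?subr_gt0//.
    exact: truncnS_gt.
  apply: mr_bigcap_ge => n.
  - exact: fmset_ray.
  - move=> x [Ax /= h]; split=> //=; apply: le_trans h _.
    by rewrite lerD2l lef_pV2 ?posrE// ler_nat.
  - rewrite leNgt; apply/negP => h.
    have := sup_upper_bound hs h; rewrite -/(quantile A t) -/q.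
    by rewrite leNgt ltrDl invr_gt0 ltr0Sn.
Qed.

Lemma quantile_leE A t y : fmset m A -> 0 < t < rmeasure m A ->
  (quantile A t <= y) = (t <= cdf_of A y).
Proof.
move=> fA tA; have hs := quantile_has_sup fA tA; apply/idP/idP => h.
  by rewrite -(cdf_quantile fA tA); exact: cdf_le.
apply: ge_sup; first exact: hs.1.
move=> z /= zt; rewrite leNgt; apply/negP => yz.
by have := cdf_le fA (ltW yz); lra.
Qed.

Lemma exists_subset_mr A t : fmset m A -> 0 <= t <= rmeasure m A ->
  exists B, [/\ measurable B, B `<=` A & rmeasure m B = t].
Proof.
move=> fA /andP[t0 tA].
have [->|n0] := eqVneq t 0; first by exists set0; split; rewrite ?mr0.
have [->|nA] := eqVneq t (rmeasure m A); first by exists A; split=> //; case: fA.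
have ht : 0 < t < rmeasure m A by rewrite !lt_neqAle eq_sym n0 nA t0 tA.
exists (A `&` [set x | f x <= quantile A t]); split.
- exact: fmset_meas (fmset_ray _ fA).
- by move=> x [].
- exact: cdf_quantile.
Qed.

(** The probability integral transform: on [A] the function [cdf_of A \o f] is uniformly
    distributed, because quantiles turn its sublevel sets into rays. *)
Lemma cdf_distribution A s : fmset m A -> 0 <= s < rmeasure m A ->
  rmeasure m (A `&` [set x | cdf_of A (f x) <= s]) = s.
Proof.
move=> fA /andP[s0 sA].
have mcdf : measurable [set x | cdf_of A (f x) <= s].
  rewrite (_ : mkset _ = setT `&` (cdf_of A \o f) @^-1` `]-oo, s]%classic).
    apply: measurableT_comp => //; apply: nondecreasing_measurable => //.
    by move=> y z; exact: cdf_le.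
  by apply/seteqP; split=> x /=; rewrite in_itv/= => // -[].
have fL : fmset m (A `&` [set x | cdf_of A (f x) <= s]) by exact: fmsetIl.
apply/eqP; rewrite eq_le; apply/andP; split.
  apply/ler_addgt0Pl => e e0.
  (* A level slightly above [s] lies strictly between 0 and [rmeasure m A], as [cdf_quantile]
     requires, even for [s = 0]. *)
  pose s' := Num.min (s + e) ((s + rmeasure m A) / 2).
  have s'e : s' <= s + e by rewrite ge_min lexx.
  have ss' : s < s' by rewrite lt_min; apply/andP; split; lra.
  have s'A : s' <= (s + rmeasure m A) / 2 by rewrite ge_min lexx orbT.
  rewrite addrC; apply: le_trans s'e.
  have hs' : 0 < s' < rmeasure m A by apply/andP; split; lra.
  rewrite -[leRHS](cdf_quantile fA hs').
  apply: mr_le _ (fmset_ray _ fA) _; first exact: fmset_meas fL.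
  move=> x [Ax /= h]; split=> //=; rewrite leNgt; apply/negP => q.
  by have := cdf_le fA (ltW q); rewrite cdf_quantile//; lra.
have [->|n0] := eqVneq s 0; first exact: mr_ge0.
have hs : 0 < s < rmeasure m A by rewrite lt_neqAle eq_sym n0 s0.
rewrite -[leLHS](cdf_quantile fA hs); apply: mr_le _ fL _.
  exact: fmset_meas (fmset_ray _ fA).
move=> x [Ax /= h]; split=> //=; rewrite -[leRHS](cdf_quantile fA hs).
exact: cdf_le.
Qed.

End quantiles.

Section swap.
Context {d} {X : measurableType d} {R : realType}.
Variables (m : {measure set X -> \bar R}) (f : X -> R) (g : R -> X).
Hypothesis mf : measurable_fun setT f.
Hypothesis mg : measurable_fun setT g.
Hypothesis fK : cancel f g.
Hypothesis na : non_atomic m.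

Local Notation mr := (rmeasure m).
Local Notation cdf := (cdf_of m f).
Local Notation quantile := (quantile m f).

Let f_inj : injective f := can_inj fK.

(** The monotone rearrangement of [A] onto [B] in the coordinate [f]. Outside the indicated range of
    levels the quantile is no meaningful supremum; 0 stands in for it, on a part of [A] that
    [mr_offcore] shows to be null. *)
Let rearr (A B : set X) (x : X) : R :=
  if 0 < cdf A (f x) < mr A then quantile B (cdf A (f x)) else 0.

Section rearrangement.
Variables A B : set X.
Hypotheses (fA : fmset m A) (fB : fmset m B).
Hypotheses (AB : mr A = mr B).

Let mcdf : measurable_fun setT (cdf A \o f).
Proof.
apply: measurableT_comp => //; apply: nondecreasing_measurable => //.
by move=> y z; exact: cdf_le.
Qed.

Let measurable_cdf_le s : measurable [set x | cdf A (f x) <= s].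
Proof.
rewrite (_ : mkset _ = setT `&` (cdf A \o f) @^-1` `]-oo, s]%classic).
  exact: mcdf.
by apply/seteqP; split=> x /=; rewrite in_itv/= => // -[].
Qed.

Let core := [set x | 0 < cdf A (f x) < mr A].

Let measurable_core : measurable core.
Proof.
rewrite (_ : core = setT `&` (cdf A \o f) @^-1` `]0, mr A[%classic).
  exact: mcdf.
by apply/seteqP; split=> x /=; rewrite in_itv/= => // -[].
Qed.

(** Level 0 is null by [cdf_distribution], which does not reach the top level [mr A]; that one is
    approached by the levels [mr A - e]. *)
Lemma mr_offcore : mr (A `\` [set x | 0 < cdf A (f x) < mr A]) = 0.
Proof.
rewrite -/core.
have [a0|a0] := eqVneq (mr A) 0.
  apply/eqP; rewrite eq_le mr_ge0 andbT -[leRHS]a0; apply: mr_le => //.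
  exact: fmset_meas (fmsetD fA _).
have {a0}a0 : 0 < mr A by rewrite lt_neqAle eq_sym a0 mr_ge0.
apply/eqP; rewrite eq_le mr_ge0 andbT.
pose s e := Num.max 0 (mr A - e).
apply/ler_addgt0Pl => e e0; rewrite addr0.
have hs : 0 <= s e < mr A.
  by rewrite le_max lexx /= gt_max a0; lra.
have h0 : mr (A `&` [set x | cdf A (f x) <= 0]) = 0.
  by apply: cdf_distribution => //; rewrite lexx.
have h1 := cdf_distribution mf f_inj na fA hs.
have fL t : fmset m (A `&` [set x | cdf A (f x) <= t]) by exact: fmsetIl.
have : mr (A `\` core) <= mr ((A `&` [set x | cdf A (f x) <= 0]) `|`
    (A `\` (A `&` [set x | cdf A (f x) <= s e]))).
  apply: mr_le; first exact: fmset_meas (fmsetD fA _).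
    by apply: fmsetU => //; apply: fmsetD => //; exact: fmset_meas (fL _).
  move=> x [Ax /= /negP]; rewrite negb_and -!leNgt => /orP[h|h]; [left|right] => //.
  by split=> // -[_ /= hh]; move: hs => /andP[_]; lra.
move=> /le_trans; apply; apply: le_trans (mr_leU (fL _) _) _.
  by apply: fmsetD => //; exact: fmset_meas (fL _).
rewrite h0 mrD//; last exact: fmset_meas (fL _).
have : mr A - e <= s e by rewrite le_max lexx orbT.
by rewrite h1; lra.
Qed.

Lemma measurable_rearr : measurable_fun setT (rearr A B).
Proof.
apply: (measurability _ (RGenOInfty.measurableE R)) => //.
move=> _ [_ [y ->] <-]; rewrite setTI.
rewrite (_ : _ @^-1` _ = ~` (core `&` [set x | cdf A (f x) <= cdf B y] `|`
    ~` core `&` [set _ | 0 <= y])).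
  apply: measurableC; apply: measurableU.
    exact: measurableI.
  apply: measurableI; first exact: measurableC.
  have [y0|y0] := leP 0 y.
    by rewrite (_ : mkset _ = setT) //; apply/seteqP; split.
  by rewrite (_ : mkset _ = set0) //; apply/seteqP; split.
have E x : (rearr A B x <= y) <->
    ((core `&` [set x | cdf A (f x) <= cdf B y] `|` ~` core `&` [set _ | 0 <= y]) x).
  rewrite /rearr /core/=; case: ifPn => [h|/negP h]; last by split=> [|[[]|[]]]//; right.
  rewrite quantile_leE// -?AB//; split => [h1|[[]|[]]]//.
  by left.
apply/seteqP; split=> x /=; rewrite in_itv/= andbT.
  by move=> h /E; rewrite leNgt h.
by move=> h; rewrite ltNge; apply/negP => /E.
Qed.

(** Up to a null set, [rearr A B x <= y] means [cdf A (f x) <= cdf B y], and the uniform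
    distribution of [cdf A] turns this into the measure of a ray in [B]. The rays form a pi-system
    generating the Borel sets, so Dynkin's lemma does the rest. *)
Lemma rearr_pushforward (Z : set R) : measurable Z ->
  m (A `&` rearr A B @^-1` Z) = m (B `&` f @^-1` Z).
Proof.
have mphi W : measurable W -> measurable (rearr A B @^-1` W).
  by move=> mW; rewrite -[X in measurable X]setTI; exact: measurable_rearr.
have mfp W : measurable W -> measurable (f @^-1` W).
  by move=> mW; rewrite -[X in measurable X]setTI; exact: mf.
have mAB : m A = m B by rewrite (mrE fA) (mrE fB) AB.
move=> mZ; have : (RGenOInfty.G (R:=R)).-sigma.-measurable Z.
  by rewrite -RGenOInfty.measurableE.
rewrite -[X in X -> _]/(<<s RGenOInfty.G (R:=R) >> Z).
move: Z {mZ}; apply: (@dynkin_induction _ R (RGenOInfty.G (R:=R))).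
- exact: RGenOInfty.measurableE.
- move=> _ _ [x ->] [y ->]; exists (Num.max x y).
  by apply/seteqP; split=> z /=; rewrite !in_itv/= !andbT gt_max => /andP.
- by rewrite !preimage_setT !setIT.
- move=> _ [y ->].
  have fib z : fmset m (A `&` [set x | rearr A B x <= z]).
    apply: fmsetIl => //; rewrite (_ : mkset _ = rearr A B @^-1` `]-oo, z]%classic).
      exact: mphi.
    by apply/seteqP; split=> x /=; rewrite in_itv.
  have E1 : A `&` rearr A B @^-1` `]y, +oo[%classic =
      A `\` (A `&` [set x | rearr A B x <= y]).
    apply/seteqP; split=> x /= [Ax]; rewrite in_itv/= andbT.
      by move=> h; split=> // -[_]; rewrite leNgt h.
    by move=> h; split=> //; rewrite ltNge; apply/negP => h'; apply: h.
  have E2 : B `&` f @^-1` `]y, +oo[%classic = B `\` (B `&` [set x | f x <= y]).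
    apply/seteqP; split=> x /= [Ax]; rewrite in_itv/= andbT.
      by move=> h; split=> // -[_]; rewrite leNgt h.
    by move=> h; split=> //; rewrite ltNge; apply/negP => h'; apply: h.
  have fB' := fmset_ray mf y fB.
  have mA' := fmset_meas (fib y); have mB' := fmset_meas fB'.
  rewrite E1 E2 (mrE (fmsetD fA mA')) (mrE (fmsetD fB mB')).
  rewrite !mrD//; congr (_ - _)%:E => //.
  have fC : fmset m (A `&` [set x | cdf A (f x) <= cdf B y]) by exact: fmsetIl.
  have cB : mr (A `&` [set x | cdf A (f x) <= cdf B y]) = cdf B y.
    have := cdf_le_mr mf y fB; rewrite -AB le_eqVlt => /orP[/eqP cBa|cBa].
      rewrite cBa; congr mr; apply/seteqP; split=> [x []//|x Ax]; split=> //=.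
      exact: cdf_le_mr.
    by apply: cdf_distribution => //; rewrite cBa cdf_of_ge0.
  rewrite -[RHS]cB; apply/eqP; rewrite -subr_eq0 -normr_le0.
  rewrite -mr_offcore -/core; apply: le_trans (mr_dist (fib y) fC) _.
  apply: mr_le; first exact: fmset_meas (fmsetY (fib y) fC).
    exact: fmsetD.
  move=> x; have [cx|ncx] := pselect (core x); last by move=> [[[]]|[[]]].
  have E : (rearr A B x <= y) = (cdf A (f x) <= cdf B y).
    by rewrite /rearr; move: (cx) => /= ->; rewrite quantile_leE// -AB.
  by move=> [[[Ax /= h] nh]|[[Ax /= h] nh]]; exfalso; apply: nh; split=> //=;
    rewrite ?E// -E.
- move=> Z mZ hZ.
  have mZ' := mphi _ mZ; have mZf := mfp _ mZ.
  have E (C : set X) (h : X -> R) : C `&` h @^-1` (~` Z) = C `\` (C `&` h @^-1` Z).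
    apply/seteqP; split=> x /= [Cx h1]; split=> //; first by move=> [].
    by move=> h2; apply: h1.
  rewrite !E.
  have f1 : fmset m (A `&` rearr A B @^-1` Z) by exact: fmsetIl.
  have f2 : fmset m (B `&` f @^-1` Z) by exact: fmsetIl.
  rewrite (mrE (fmsetD fA (fmset_meas f1))) (mrE (fmsetD fB (fmset_meas f2))).
  rewrite (mrD fA (fmset_meas f1))// (mrD fB (fmset_meas f2))// AB.
  by rewrite [mr (A `&` _)]/rmeasure hZ.
- move=> F mF tF hF; rewrite !preimage_bigcup !setI_bigcupr.
  have tr (Y : set X) (h : X -> R) : trivIset setT (fun k => Y `&` h @^-1` F k).
    apply/trivIsetP => i j _ _ ij; apply/seteqP; split=> // x [[_ /= xi] [_ /= xj]].
    by move/trivIsetP : tF => /(_ i j I I ij) E; rewrite -[False]/(set0 (h x)) -E.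
  rewrite measure_bigcup//; last first.
    by move=> i _; apply: measurableI; [exact: fmset_meas fA|exact: mphi].
  rewrite measure_bigcup//; last first.
    by move=> i _; apply: measurableI; [exact: fmset_meas fB|exact: mfp].
  exact: eq_eseriesr.
Qed.

End rearrangement.

(** On this part of [A] the rearrangement is inverted by the reverse one, so it is an honest
    bijection onto the corresponding part of [B]. *)
Let core_swap (A B : set X) := A `&`
  [set x | B (g (rearr A B x)) /\ f (g (rearr B A (g (rearr A B x)))) = f x].

Let measurable_core_swap A B : fmset m A -> fmset m B -> mr A = mr B ->
  measurable (core_swap A B).
Proof.
move=> fA fB AB; apply: measurableI; first exact: fmset_meas fA.
have mphi : measurable_fun setT (g \o rearr A B).
  by apply: measurableT_comp => //; exact: measurable_rearr.
have mpsi : measurable_fun setT (g \o rearr B A).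
  by apply: measurableT_comp => //; exact: measurable_rearr.
have mh : measurable_fun setT (f \o (g \o rearr B A) \o (g \o rearr A B) \- f).
  apply: measurable_funB => //; apply: measurableT_comp => //.
  exact: measurableT_comp.
rewrite (_ : mkset _ = (setT `&` (g \o rearr A B) @^-1` B) `&`
   (setT `&` (f \o (g \o rearr B A) \o (g \o rearr A B) \- f) @^-1` [set 0])).
  apply: measurableI; first by apply: mphi => //; exact: fmset_meas fB.
  exact: mh.
apply/seteqP; split=> x /=.
  by move=> [h ->]; split; split=> //; rewrite subrr.
by move=> [[_ h] [_ /eqP]]; rewrite subr_eq0 => /eqP.
Qed.

(** An exceptional point falls into one of four null sets: its decoded image misses [B], its
    rearranged value is no value of [f], it is off the core, or the distribution function of [A] is
    flat just below it. *)
Let core_swap_null A B : fmset m A -> fmset m B -> mr A = mr B ->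
  mr (A `\` core_swap A B) = 0.
Proof.
move=> fA fB AB; have mA := fmset_meas fA; have mB := fmset_meas fB.
have BA := esym AB.
have mrear : measurable_fun setT (rearr A B) by exact: measurable_rearr.
have mpre Z : measurable Z -> measurable (rearr A B @^-1` Z).
  by move=> mZ; rewrite -[X in measurable X]setTI; exact: mrear.
have mgpre Z : measurable Z -> measurable (g @^-1` Z).
  by move=> mZ; rewrite -[X in measurable X]setTI; exact: mg.
pose q k : R := if @unpickle rat k is Some r then ratr r else 0.
pose N1 := A `&` rearr A B @^-1` (g @^-1` (~` B)).
pose Z := [set y : R | f (g y) <> y].
have mZ : measurable Z.
  rewrite (_ : Z = ~` (setT `&` ((f \o g) \- id) @^-1` [set 0])).
    apply: measurableC; apply: measurable_funB => //; exact: measurableT_comp.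
  apply/seteqP; split=> y /=; first by move=> h [_ /eqP]; rewrite subr_eq0 => /eqP.
  by move=> h fgy; apply: h; split=> //; rewrite fgy subrr.
pose N2 := A `&` rearr A B @^-1` Z.
pose N3 := A `\` [set x | 0 < cdf A (f x) < mr A].
(* If the quantile of the level of [x] falls short of [f x], a rational [q k] lies strictly between;
   then [x] is beyond [q k] without having a higher level. For each of the countably many [q k] such
   points form a null set. *)
pose N4 k := (A `&` [set x | cdf A (f x) <= cdf A (q k)]) `\`
  (A `&` [set x | f x <= q k]).
have mcdf : measurable_fun setT (cdf A \o f).
  apply: measurableT_comp => //; apply: nondecreasing_measurable => //.
  by move=> y z; exact: cdf_le.
have mcle s : measurable [set x | cdf A (f x) <= s].
  rewrite (_ : mkset _ = setT `&` (cdf A \o f) @^-1` `]-oo, s]%classic).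
    exact: mcdf.
  by apply/seteqP; split=> x /=; rewrite in_itv/= => // -[].
have neg : m.-negligible (N1 `|` N2 `|` N3 `|` \bigcup_k N4 k).
  have nmr C : fmset m C -> mr C = 0 -> m.-negligible C.
    move=> fC C0; exists C; split=> //; first exact: fmset_meas fC.
    by rewrite (mrE fC) C0.
  apply: negligibleU; first apply: negligibleU; first apply: negligibleU.
  - exists N1; split=> //.
      by apply: measurableI => //; apply: mpre; apply: mgpre; exact: measurableC.
    rewrite -[LHS]/(m N1); have -> : m N1 = m (B `&` f @^-1` (g @^-1` (~` B))).
      by apply: rearr_pushforward => //; apply: mgpre; exact: measurableC.
    rewrite (_ : _ `&` _ = set0) ?measure0//.
    by apply/seteqP; split=> x //= [Bx]; rewrite fK.
  - exists N2; split=> //; first by apply: measurableI => //; exact: mpre.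
    rewrite -[LHS]/(m N2); have -> : m N2 = m (B `&` f @^-1` Z) by exact: rearr_pushforward.
    rewrite (_ : _ `&` _ = set0) ?measure0//.
    by apply/seteqP; split=> x //= [Bx]; rewrite /Z/= fK.
  - apply: nmr; last exact: mr_offcore.
    apply: fmsetD => //; rewrite (_ : mkset _ = setT `&` (cdf A \o f) @^-1` `]0, mr A[%classic).
      exact: mcdf.
    by apply/seteqP; split=> x /=; rewrite in_itv/= => // -[].
  - apply: negligible_bigcup => k; apply: nmr.
      apply: fmsetD; first exact: fmsetIl.
      exact: fmset_meas (fmset_ray mf _ fA).
    have fL : fmset m (A `&` [set x | cdf A (f x) <= cdf A (q k)]) by exact: fmsetIl.
    rewrite mrD//; last 2 first.
      exact: fmset_meas (fmset_ray mf _ fA).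
      by move=> x [Ax /= h]; split=> //=; exact: cdf_le.
    apply/eqP; rewrite subr_eq0; apply/eqP; rewrite -[RHS]/(cdf A (q k)).
    have := cdf_le_mr mf (q k) fA; rewrite le_eqVlt => /orP[/eqP cBa|cBa].
      rewrite cBa; congr mr; apply/seteqP; split=> [x []//|x Ax]; split=> //=.
      exact: cdf_le_mr.
    by apply: cdf_distribution => //; rewrite cBa cdf_of_ge0.
suff : m.-negligible (A `\` core_swap A B).
  move=> /measure_negligible h; rewrite /rmeasure h//.
  by apply: measurableD => //; exact: measurable_core_swap.
apply: negligibleS neg => x [Ax]; apply: contra_notP => nN.
split=> //=.
have Bx : B (g (rearr A B x)).
  by apply: contrapT => nB; apply: nN; left; left; left.
split=> //.
have fgx : f (g (rearr A B x)) = rearr A B x.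
  by apply: contrapT => h; apply: nN; left; left; right.
have cx : 0 < cdf A (f x) < mr A.
  by apply: contrapT => h; apply: nN; left; right.
have rx : rearr A B x = quantile B (cdf A (f x)) by rewrite /rearr cx.
have hB : 0 < cdf A (f x) < mr B by rewrite -AB.
rewrite {1}/rearr fgx rx cdf_quantile// -AB cx.
set z := quantile A _.
have zx : z <= f x by rewrite /z quantile_leE.
suff -> : z = f x by rewrite fK.
apply/eqP; rewrite eq_le zx /= leNgt; apply/negP => zlt.
have [r] := rat_in_itvoo zlt; rewrite in_itv/= => /andP[zr rx'].
apply: nN; right; exists (pickle r) => //; rewrite /N4 /q pickleK; split.
  by split=> //=; rewrite -quantile_leE// ltW.
by move=> [_ /=]; rewrite leNgt rx'.
Qed.

(** The rearrangements in both directions, restricted to the conull parts [A0] and [B0] where they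
    invert each other and extended by the identity, form an everywhere defined involution; it is its
    own measurable inverse. *)
Lemma mpt_swap A B : fmset m A -> fmset m B -> mr A = mr B -> A `&` B = set0 ->
  exists S : mpt m, [/\ mr (S @^-1` B `+` A) = 0, mr (S @^-1` A `+` B) = 0 &
    forall x, ~ A x -> ~ B x -> S x = x].
Proof.
move=> fA fB AB dAB; have mA := fmset_meas fA; have mB := fmset_meas fB.
have BA := esym AB.
pose A0 := core_swap A B; pose B0 := core_swap B A.
have mA0 : measurable A0 by exact: measurable_core_swap.
have mB0 : measurable B0 by exact: measurable_core_swap.
pose phi := g \o rearr A B; pose psi := g \o rearr B A.
have A0B0 x : A0 x -> B0 (phi x) /\ psi (phi x) = x.
  move=> [Ax [Bx /(can_inj fK) E]]; split; last exact: E.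
  by split; [exact: Bx|split; rewrite /= /phi/= E].
have B0A0 x : B0 x -> A0 (psi x) /\ phi (psi x) = x.
  move=> [Ax [Bx /(can_inj fK) E]]; split; last exact: E.
  by split; [exact: Bx|split; rewrite /= /psi/= E].
have dA0 x : A0 x -> B0 x -> False.
  by move=> [Ax _] [Bx _]; have : (A `&` B) x by []; rewrite dAB.
pose s x := if `[< A0 x >] then phi x else if `[< B0 x >] then psi x else x.
have sA x : A0 x -> s x = phi x by move=> h; rewrite /s asboolT.
have sB x : B0 x -> s x = psi x.
  by move=> h; rewrite /s asboolF ?asboolT// => h'; exact: dA0 h' h.
have sN x : ~ A0 x -> ~ B0 x -> s x = x by move=> h h'; rewrite /s !asboolF.
have sK : cancel s s.
  move=> x; have [hA|hA] := pselect (A0 x).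
    by have [h1 h2] := A0B0 _ hA; rewrite (sA _ hA) (sB _ h1) h2.
  have [hB|hB] := pselect (B0 x); last by rewrite !sN.
  by have [h1 h2] := B0A0 _ hB; rewrite (sB _ hB) (sA _ h1) h2.
have preE E : s @^-1` E = (A0 `&` phi @^-1` E) `|` (B0 `&` psi @^-1` E) `|`
    (E `\` (A0 `|` B0)).
  apply/seteqP; split=> x /=.
    have [hA|hA] := pselect (A0 x); first by rewrite sA//; left; left.
    have [hB|hB] := pselect (B0 x); first by rewrite sB//; left; right.
    by rewrite sN//; right; split=> // -[].
  move=> [[[hA]|[hB]]|[Ex /not_orP[hA hB]]]; by [rewrite sA|rewrite sB|rewrite sN].
have mphi E : measurable E -> measurable (phi @^-1` E).
  move=> mE; rewrite -[X in measurable X]setTI.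
  by apply: (measurableT_comp mg (measurable_rearr fA fB AB)).
have mpsi E : measurable E -> measurable (psi @^-1` E).
  move=> mE; rewrite -[X in measurable X]setTI.
  by apply: (measurableT_comp mg (measurable_rearr fB fA BA)).
have ms : measurable_fun setT s.
  move=> _ E mE; rewrite setTI preE; apply: measurableU.
    by apply: measurableU; apply: measurableI => //; [exact: mphi|exact: mpsi].
  by apply: measurableD => //; exact: measurableU.
have null C C0 E : fmset m C -> C0 `<=` C -> measurable C0 -> mr (C `\` C0) = 0 ->
    measurable E -> m (C0 `&` E) = m (C `&` E).
  move=> fC CC mC0 n0 mE; have fC0 := fmset_sub mC0 fC CC.
  rewrite !mrE; [|exact: fmsetIl..].
  congr EFin; apply/eqP; rewrite -subr_eq0 -normr_le0 -n0.
  apply: le_trans (mr_setID fC0 fC mE) _; apply: mr_le.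
  - by apply: measurableI => //; exact: fmset_meas (fmsetY fC0 fC).
  - exact: fmsetD.
  - by move=> x [[[h1 h2]|//] _]; exfalso; exact/h2/CC.
have AA0 : A0 `<=` A by move=> x [].
have BB0 : B0 `<=` B by move=> x [].
have nA : mr (A `\` A0) = 0 by exact: core_swap_null.
have nB : mr (B `\` B0) = 0 by exact: core_swap_null.
have push C E (D : set X) : fmset m C -> fmset m D -> mr C = mr D -> measurable E ->
    m (C `&` (g \o rearr C D) @^-1` E) = m (D `&` E).
  move=> fC fD CD mE; rewrite comp_preimage (rearr_pushforward fC fD CD)//; last first.
    by rewrite -[X in measurable X]setTI; exact: mg.
  by congr (m (D `&` _)); apply/seteqP; split=> x /=; rewrite fK.
have preserve E : measurable E -> m (s @^-1` E) = m E.
  move=> mE; rewrite preE.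
  have m1 : measurable (A0 `&` phi @^-1` E) by apply: measurableI => //; exact: mphi.
  have m2 : measurable (B0 `&` psi @^-1` E) by apply: measurableI => //; exact: mpsi.
  have m3 : measurable (E `\` (A0 `|` B0)) by apply: measurableD => //; exact: measurableU.
  transitivity (m (A0 `&` phi @^-1` E) + m (B0 `&` psi @^-1` E) + m (E `\` (A0 `|` B0)))%E.
    rewrite measureU//; last 2 first.
      exact: measurableU.
      by apply/seteqP; split=> x //= [[[h _]|[h _]] [_ h']]; apply: h'; [left|right].
    rewrite measureU//; apply/seteqP; split=> x //= [[h _] [h' _]].
    exact: dA0 h h'.
  rewrite (null A A0 _ fA AA0 mA0 nA) ?(null B B0 _ fB BB0 mB0 nB); [|exact: mpsi|exact: mphi].
  rewrite /phi /psi push// push//.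
  rewrite -(null A A0 _ fA AA0 mA0 nA)// -(null B B0 _ fB BB0 mB0 nB)//.
  rewrite -(measureU m (measurableI _ _ mB0 mE) (measurableI _ _ mA0 mE)); last first.
    by apply/seteqP; split=> x //= [[h _] [h' _]]; exact: dA0 h' h.
  rewrite -setIUl setUC setIC addeC -measureDI//; exact: measurableU.
exists (Mpt sK sK ms ms preserve); split=> /=.
- have fS : fmset m (s @^-1` B).
    by split; [rewrite -[X in measurable X]setTI; exact: ms|rewrite preserve//; case: fB].
  have fN := fmset_preimage (Mpt sK sK ms ms preserve) (fmsetD fB mB0).
  apply: (@mr_null_sub _ _ _ _ _ (s @^-1` (B `\` B0) `|` (A `\` A0))).
  + exact: fmset_meas (fmsetY fS fA).
  + by apply: fmsetU => //; exact: fmsetD.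
  + move=> x [[Bs nA']|[Ax nB']].
      left; split=> // hB; apply: nA'; have [/AA0 h _] := B0A0 _ hB.
      by rewrite -(sB _ hB) sK in h.
    right; split=> // hA; apply: nB'; rewrite /= sA//.
    by have [/BB0] := A0B0 _ hA.
  + apply: mr_nullU => //; first exact: fmsetD.
    by rewrite (mr_preimage (Mpt sK sK ms ms preserve)) ?nB//; exact: measurableD.
- have fS : fmset m (s @^-1` A).
    by split; [rewrite -[X in measurable X]setTI; exact: ms|rewrite preserve//; case: fA].
  have fN := fmset_preimage (Mpt sK sK ms ms preserve) (fmsetD fA mA0).
  apply: (@mr_null_sub _ _ _ _ _ (s @^-1` (A `\` A0) `|` (B `\` B0))).
  + exact: fmset_meas (fmsetY fS fB).
  + by apply: fmsetU => //; exact: fmsetD.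
  + move=> x [[As nB']|[Bx nA']].
      left; split=> // hA; apply: nB'; have [/BB0 h _] := A0B0 _ hA.
      by rewrite -(sA _ hA) sK in h.
    right; split=> // hB; apply: nA'; rewrite /= sB//.
    by have [/AA0] := B0A0 _ hB.
  + apply: mr_nullU => //; first exact: fmsetD.
    by rewrite (mr_preimage (Mpt sK sK ms ms preserve)) ?nA//; exact: measurableD.
- by move=> x nAx nBx; rewrite sN// => [/AA0|/BB0].
Qed.

End swap.

(** * Approximation by permutations of pieces *)

Section pieces.
Context {d} {X : measurableType d} {R : realType}.
Variable m : {measure set X -> \bar R}.
Local Notation mr := (rmeasure m).

(** Together with [swappable], this is all that the constructions with pieces use of non-atomicity
    and of the standard structure. *)
Definition divisible := forall A (t : R), fmset m A -> 0 <= t <= mr A ->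
  exists B, [/\ measurable B, B `<=` A & mr B = t].

Definition swappable := forall A B, fmset m A -> fmset m B -> mr A = mr B ->
  A `&` B = set0 -> exists S : mpt m,
    [/\ mr (S @^-1` B `+` A) = 0, mr (S @^-1` A `+` B) = 0 &
      forall x, ~ A x -> ~ B x -> S x = x].

Lemma subdivide (K : finType) A (e : R) : divisible -> fmset m A -> 0 <= e ->
  e *+ #|K| <= mr A ->
  exists I : K -> set X, [/\ forall k, fmset m (I k), forall k, I k `<=` A,
    forall k, mr (I k) = e & disjoint_family I].
Proof.
move=> dv fA e0 eA.
suff [I [fI IA Ie dI _]] : exists I : K -> set X,
    [/\ forall k, fmset m (I k), forall k, I k `<=` A,
      forall k, k \in enum K -> mr (I k) = e, disjoint_family I &
      forall k, k \notin enum K -> I k = set0].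
  by exists I; split=> // k; apply: Ie; rewrite mem_enum.
have : e *+ size (enum K) <= mr A by rewrite -cardE.
have := enum_uniq K; elim: (enum K) A fA {eA} => [|k s IHs] A fA /=.
  by move=> _ _; exists (fun=> set0); split=> [k|k x|k|i j x|k] //; exact: fmset0.
move=> /andP[ks us]; rewrite mulrS => eA.
have eA' : 0 <= e <= mr A.
  by rewrite e0 /=; apply: le_trans eA; rewrite lerDl mulrn_wge0.
have [B [mB BA Be]] := dv _ _ fA eA'.
have [|||I [fI IA Ie dI I0]] := IHs (A `\` B) => //; first exact: fmsetD.
  by rewrite mrD// Be; lra.
exists (fun j => if j == k then B else I j); split.
- by move=> j; case: eqP => // _; exact: (fmset_sub mB fA).
- by move=> j; case: eqP => // _ x /IA[].
- by move=> j; rewrite inE; case: eqP => //= _; exact: Ie.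
- move=> i j x; case: eqP => [->|_]; case: eqP => [->|_] //.
  + by move=> Bx /IA[].
  + by move=> /IA[].
  + exact: dI.
- by move=> j; rewrite inE negb_or; case: eqP => //= _; exact: I0.
Qed.

(** A permutation is a product of transpositions, and a swap of two pieces fixes every point of the
    others. *)
Lemma realize_perm (Q : finType) (I : Q -> set X) (e : R) (s : {perm Q}) :
  swappable -> (forall x, fmset m (I x)) -> (forall x, mr (I x) = e) ->
  disjoint_family I ->
  exists S : mpt m, forall x, mr (S @^-1` I (s x) `+` I x) = 0.
Proof.
move=> sw fI Ie dI; have [ts -> _] := prod_tpermP s.
elim: ts => [|[a b] ts [S IHs]].
  by rewrite big_nil; exists mpt_id => x; rewrite perm1 setYK mr0.
rewrite big_cons /=.
have [St StP] : exists St : mpt m, forall x, mr (St @^-1` I (tperm a b x) `+` I x) = 0.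
  have [->|ab] := eqVneq a b.
    by exists mpt_id => x; rewrite tperm1 perm1 setYK mr0.
  have [||||St [h1 h2 h3]] := sw (I a) (I b) => //; first by rewrite !Ie.
    by apply/seteqP; split=> x // [xa xb]; move/eqP: ab; apply; exact: dI xa xb.
  exists St => x; case: tpermP => [->//|->//|/eqP xa /eqP xb].
  have f1 := fmsetY (fmset_preimage St (fI b)) (fI a).
  have f2 := fmsetY (fmset_preimage St (fI a)) (fI b).
  apply: (mr_null_sub _ (fmsetU f1 f2)) => //; last exact: mr_nullU.
    by apply/fmset_meas/fmsetY => //; exact: fmset_preimage.
  move=> z [[/= Sz nz]|[xz nS]].
      have [az|naz] := pselect (I a z).
        by left; right; split=> //= bS; move/eqP: xb; apply; exact: dI Sz bS.
      have [bz|nbz] := pselect (I b z).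
        by right; right; split=> //= bS; move/eqP: xa; apply; exact: dI Sz bS.
      by rewrite h3// in Sz.
    exfalso; apply: nS; rewrite /= h3//.
    + by move=> az; move/eqP: xa; apply; exact: dI xz az.
    + by move=> az; move/eqP: xb; apply; exact: dI xz az.
exists (mpt_comp S St) => x; rewrite permM.
apply/eqP; rewrite eq_le mr_ge0 andbT.
pose J := I ((\prod_(t <- ts) tperm t.1 t.2)%g (tperm a b x)).
have fJ : fmset m J by exact: fI.
have -> : mpt_comp S St @^-1` J = St @^-1` (S @^-1` J) by [].
apply: le_trans (mrY_tri (fmset_preimage St (fmset_preimage S fJ))
  (fmset_preimage St (fI (tperm a b x))) (fI x)) _.
rewrite StP addr0 -preimage_symdiff mr_preimage ?IHs//.
by apply/fmset_meas/fmsetY => //; exact: fmset_preimage.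
Qed.

End pieces.

Lemma infinite_complement {d} {X : measurableType d} {R : realType}
    (m : {sigma_finite_measure set X -> \bar R}) Y (c : R) :
  m setT = +oo%E -> fmset m Y ->
  exists Z, [/\ fmset m Z, Z `&` Y = set0 & c <= rmeasure m Z].
Proof.
move=> mT fY; have /sigma_finiteP[F [FT ndF mF]] := sigma_finiteT m.
have [n hn] : exists n, ((c + rmeasure m Y)%:E < m (F n))%E.
  apply: contrapT => h.
  have : (m setT <= (c + rmeasure m Y)%:E)%E.
    rewrite FT; have cv : m (F n) @[n --> \oo] --> m (\bigcup_i F i).
      apply: nondecreasing_cvg_mu => //; first by move=> i; have [] := mF i.
      by apply: bigcup_measurable => i _; have [] := mF i.
    rewrite -(cvg_lim _ cv)//; apply: lime_le; first by apply/cvg_ex; eexists; exact: cv.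
    near=> n; rewrite leNgt; apply/negP => h'; apply: h.
    by exists n.
  by rewrite mT leNgt ltry.
have fF : fmset m (F n) by split; have [] := mF n.
exists (F n `\` Y); split.
- by apply: fmsetD => //; exact: fmset_meas fY.
- by apply/seteqP; split=> x // [[]].
- move: hn; rewrite (mrE fF) lte_fin (mrID fF (fmset_meas fY)).
  have : rmeasure m (F n `&` Y) <= rmeasure m Y.
    apply: mr_le => //; first by apply: measurableI; [case: fF|case: fY].
    lra.
Unshelve. all: by end_near.
Qed.

(** * Integer transport plans *)

Section transport.
Variables (A : finType) (N : A -> nat).
Local Notation Q := {a : A & 'I_(N a)}.

Let edges (s : {perm Q}) a b : nat :=
  (\sum_(x : Q) ((tag x == a) && (tag (s x) == b)))%N.

Let edges_row s a : (\sum_b edges s a b = N a)%N.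
Proof.
rewrite exchange_big /=.
rewrite (eq_bigr (fun x : Q => (tag x == a) : nat)); last first.
  move=> x _; rewrite (bigD1 (tag (s x)))//= eqxx andbT big1 ?addn0// => b.
  by rewrite eq_sym => /negbTE ->; rewrite andbF.
rewrite (eq_bigr (fun x : Q => if tag x == a then 1%N else 0%N)); last first.
  by move=> x _; case: eqP.
rewrite -big_mkcond sum1_card -[RHS]card_ord.
rewrite -(@card_imset _ _ (fun i : 'I_(N a) => Tagged (fun a => 'I_(N a)) i)); last first.
  by move=> i j /eqP; rewrite eq_Tagged => /eqP.
apply: eq_card => -[a' i]; apply/idP/imsetP; rewrite unfold_in /=.
  by move=> /eqP E; subst a'; exists i.
by move=> [j _ E]; apply/eqP; exact: (congr1 tag E).
Qed.

Let edges_col s b : (\sum_a edges s a b = N b)%N.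
Proof.
rewrite -(edges_row s^-1%g b); apply: eq_bigr => a _.
rewrite /edges (reindex_inj (@perm_inj _ s^-1%g)); apply: eq_bigr => x _.
by rewrite permKV andbC.
Qed.

Variable n : A -> A -> nat.
Hypothesis n_row : forall a, (\sum_b n a b <= N a)%N.
Hypothesis n_col : forall b, (\sum_a n a b <= N b)%N.

(** To be read with [n a b] as the number of pieces that must move from cell [a] to cell [b], the
    bounds saying that source and target have room for them. The proof is by induction on the total
    demand. *)
Lemma transport_perm : exists s : {perm Q}, forall a b,
  (n a b <= \sum_(x : Q) ((tag x == a) && (tag (s x) == b)))%N.
Proof.
suff H k : forall n' : A -> A -> nat, (\sum_a \sum_b n' a b = k)%N ->
    (forall a, (\sum_b n' a b <= N a)%N) -> (forall b, (\sum_a n' a b <= N b)%N) ->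
    exists s, forall a b, (n' a b <= edges s a b)%N.
  by have [s hs] := H _ n erefl n_row n_col; exists s.
elim: k => [|k IHk] n' nk row col.
  exists 1%g => a b; move/eqP: nk; rewrite sum_nat_eq0 => /forallP/(_ a).
  by rewrite sum_nat_eq0 => /forallP/(_ b)/eqP ->.
have [a0 [b0 n0]] : exists a b, (0 < n' a b)%N.
  apply: contrapT => h; suff : (\sum_a \sum_b n' a b = 0)%N by rewrite nk.
  rewrite big1// => a _; rewrite big1// => b _.
  by apply/eqP; rewrite -leqn0 leqNgt; apply/negP => h'; apply: h; exists a, b.
pose n1 a b := (n' a b - ((a == a0) && (b == b0)))%N.
have n1E a b : (n' a b = n1 a b + ((a == a0) && (b == b0)))%N.
  rewrite /n1; case: eqP => [->|_]; case: eqP => [->|_] /=; lia.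
have row1 a : (\sum_b n' a b = \sum_b n1 a b + (a == a0))%N.
  rewrite (eq_bigr _ (fun b _ => n1E a b)) big_split /=; congr addn.
  rewrite (bigD1 b0)//= eqxx andbT big1 ?addn0// => b /negbTE ->.
  by rewrite andbF.
have col1 b : (\sum_a n' a b = \sum_a n1 a b + (b == b0))%N.
  rewrite (eq_bigr _ (fun a _ => n1E a b)) big_split /=; congr addn.
  by rewrite (bigD1 a0)//= eqxx big1 ?addn0// => a /negbTE ->.
have [||| s hs] := IHk n1.
- move: nk; rewrite (eq_bigr _ (fun a _ => row1 a)) big_split /=.
  rewrite [X in (_ + X)%N](_ : _ = 1%N); first lia.
  by rewrite (bigD1 a0)//= eqxx big1 ?addn0// => a /negbTE ->.
- by move=> a; apply: leq_trans (row a); rewrite row1 leq_addr.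
- by move=> b; apply: leq_trans (col b); rewrite col1 leq_addr.
have [h|h] := leqP (n' a0 b0) (edges s a0 b0).
  exists s => a b; rewrite n1E; have := hs a b.
  case: eqP => [->|_]; last by rewrite addn0.
  by case: eqP => [-> _|_]; rewrite /= ?addn0//; have := n1E a0 b0; rewrite !eqxx /=; lia.
(* A surplus edge leaves [a0] and another one enters [b0]; exchanging their ends
   creates the missing edge from [a0] to [b0]. *)
have [b1 sb1] : exists b, (n1 a0 b < edges s a0 b)%N.
  apply: contrapT => hh; have := row a0; rewrite row1 eqxx -(edges_row s a0).
  rewrite addn1 ltnNge => /negP; apply; apply: leq_sum => b _.
  by rewrite leqNgt; apply/negP => h'; apply: hh; exists b.
have [a1 sa1] : exists a, (n1 a b0 < edges s a b0)%N.
  apply: contrapT => hh; have := col b0; rewrite col1 eqxx -(edges_col s b0).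
  rewrite addn1 ltnNge => /negP; apply; apply: leq_sum => b _.
  by rewrite leqNgt; apply/negP => h'; apply: hh; exists b.
have edge_ex a b : (0 < edges s a b)%N -> exists x : Q, tag x = a /\ tag (s x) = b.
  move=> h'; apply: contrapT => hh; move: h'; rewrite /edges big1// => x _.
  by case: eqP => //= xa; case: eqP => //= xb; exfalso; apply: hh; exists x.
have [x [xa xb]] : exists x : Q, tag x = a0 /\ tag (s x) = b1.
  by apply: edge_ex; lia.
have [y [ya yb]] : exists x : Q, tag x = a1 /\ tag (s x) = b0.
  by apply: edge_ex; lia.
have e00 : edges s a0 b0 = n1 a0 b0.
  by have := hs a0 b0; have := n1E a0 b0; rewrite !eqxx /=; lia.
have nb : b1 <> b0 by move=> E; rewrite E e00 ltnn in sb1.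
have na : a1 <> a0 by move=> E; rewrite E e00 ltnn in sa1.
have xy : y != x by apply/eqP => E; apply: na; rewrite -ya E.
exists (tperm x y * s)%g => a b; rewrite /edges (bigD1 x)//= (bigD1 y)//=.
rewrite !permM tpermL tpermR xa ya xb yb.
rewrite (eq_bigr (fun z : Q => ((tag z == a) && (tag (s z) == b)) : nat)); last first.
  by move=> z /andP[zx zy]; rewrite permM tpermD// eq_sym.
have E : (edges s a b = ((a0 == a) && (b1 == b)) + (((a1 == a) && (b0 == b)) +
    \sum_(z : Q | (z != x) && (z != y)) ((tag z == a) && (tag (s z) == b))))%N.
  by rewrite /edges (bigD1 x)//= (bigD1 y)//= xa ya xb yb.
have k1 : (a0 == a) && (b1 == b) -> (n1 a b < edges s a b)%N.
  by move=> /andP[/eqP <- /eqP <-].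
have k2 : (a1 == a) && (b0 == b) -> (n1 a b < edges s a b)%N.
  by move=> /andP[/eqP <- /eqP <-].
have k3 : ~~ ((a0 == a) && (a1 == a)).
  by apply/negP => /andP[/eqP <- /eqP].
have k4 : ~~ ((b0 == b) && (b1 == b)).
  by apply/negP => /andP[/eqP <- /eqP].
have := hs a b; rewrite n1E (eq_sym a) (eq_sym b); move: k1 k2 k3 k4.
rewrite E; move: (n1 a b) (\sum_(z | _) _)%N => u v.
case: (a0 == a); case: (a1 == a); case: (b0 == b); case: (b1 == b) => //=;
  move=> k1 k2 _ _; try (have := k1 isT); try (have := k2 isT); lia.
Qed.

End transport.

Section permutation_approximation.
Context {d} {X : measurableType d} {R : realType}.
Variable m : {measure set X -> \bar R}.
Local Notation mr := (rmeasure m).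

Let count_pairs (A Q : finType) (f g : Q -> A) (p q : pred A) :
  (\sum_(a | p a) \sum_(b | q b) \sum_x ((f x == a) && (g x == b)) =
   \sum_x (p (f x) && q (g x)))%N.
Proof.
under eq_bigr do rewrite exchange_big.
rewrite exchange_big; apply: eq_bigr => x _.
rewrite [LHS](_ : _ = (\sum_(a | p a) ((f x == a) && q (g x)))%N); last first.
  apply: eq_bigr => a _; rewrite big_mkcond (bigD1 (g x))//= eqxx andbT.
  rewrite big1 ?addn0; last first.
    by move=> b /negbTE gb; rewrite (eq_sym (g x)) gb andbF; case: ifP.
  by case: (q (g x)); rewrite ?andbT ?andbF.
rewrite big_mkcond (bigD1 (f x))//= eqxx big1 ?addn0; last first.
  by move=> b /negbTE fb; rewrite (eq_sym (f x)) fb; case: ifP.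
by case: (p (f x)).
Qed.

Let trunc_div_le (r e : R) : 0 <= r -> 0 < e -> (Num.trunc (r / e))%:R * e <= r.
Proof.
by move=> r0 e0; rewrite -ler_pdivlMr// truncn_le divr_ge0// ltW.
Qed.

Let trunc_div_gt (r e : R) : 0 < e -> r <= (Num.trunc (r / e))%:R * e + e.
Proof.
move=> e0; have := truncnS_gt (r / e); rewrite ltr_pdivrMr// -natr1 mulrDl mul1r.
exact: ltW.
Qed.

(** Every cell of the partition generated by the sets [A l] and their images is filled with pieces
    of one size [e], and [S] dictates how many of them must go from cell to cell. Rounding to whole
    pieces is the only loss, at most one piece per cell or pair of cells. *)
Lemma perm_approx (S : mpt m) (L : finType) (A : L -> set X) (eta : R) :
  divisible m -> (forall l, fmset m (A l)) -> 0 < eta ->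
  exists (Q : finType) (I : Q -> set X) (e : R) (s : {perm Q}),
    [/\ forall x, fmset m (I x), 0 < e, forall x, mr (I x) = e,
      disjoint_family I &
      forall l, exists P : pred Q, mr (A l `+` punion I P) < eta /\
        mr (S @` A l `+` punion I (fun y => P (s^-1%g y))) < eta].
Proof.
move=> dv fA eta0.
pose B (i : L * bool) : set X := if i.2 then S @` A i.1 else A i.1.
have fB i : fmset m (B i).
  by rewrite /B; case: i.2 => //; rewrite image_mpt; exact: fmset_preimage.
pose At := {ffun L * bool -> bool}.
have [D [fD dD BD]] := atoms fB.
have mD a : measurable (D a) := fmset_meas (fD a).
have DB a i x : D a x -> a i = `[< B i x >].
  move=> Da; apply/idP/asboolP => [ai|]; first by rewrite BD; exists a.
  by rewrite BD => -[b bi Db]; rewrite (dD _ _ _ Da Db).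
pose K := #|At|.
(* Rounding loses up to [K] pieces of [A l], and up to [2 * K ^ 2 + K] pieces in the comparison with
   the image; the additional 1 makes the final inequality strict. *)
pose e := eta / (2 * K%:R ^+ 2 + K%:R + 1).
have Kpos : 0 < 2 * K%:R ^+ 2 + K%:R + 1 :> R.
  by rewrite ltr_wpDl// addr_ge0// mulr_ge0// sqr_ge0.
have e0 : 0 < e by rewrite divr_gt0.
pose N a := Num.trunc (mr (D a) / e).
pose E a b := D a `&` S @^-1` D b.
have fE a b : fmset m (E a b).
  by apply: fmsetIl => //; exact: fmset_meas (fmset_preimage S (fD b)).
pose n a b := Num.trunc (mr (E a b) / e).
have n_row a : (\sum_b n a b <= N a)%N.
  rewrite /N truncn_ge_nat; last by rewrite divr_ge0 ?mr_ge0// ltW.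
  rewrite ler_pdivlMr// natr_sum mulr_suml.
  apply: (@le_trans _ _ (\sum_b mr (E a b))).
    by apply: ler_sum => b _; apply: trunc_div_le => //; exact: mr_ge0.
  rewrite -(mr_punion (fE a)); last first.
    by move=> b c x [_ xb] [_ xc]; exact: dD xb xc.
  apply: mr_le => //; first exact: fmset_meas (fmset_punion (fE a) _).
  by move=> x [b _ []].
have n_col b : (\sum_a n a b <= N b)%N.
  rewrite /N truncn_ge_nat; last by rewrite divr_ge0 ?mr_ge0// ltW.
  rewrite ler_pdivlMr// natr_sum mulr_suml.
  apply: (@le_trans _ _ (\sum_a mr (E a b))).
    by apply: ler_sum => a _; apply: trunc_div_le => //; exact: mr_ge0.
  rewrite -(mr_punion (fE^~ b)); last first.
    by move=> a c x [xa _] [xc _]; exact: dD xa xc.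
  rewrite -(mr_preimage S (mD b)); apply: mr_le.
  - exact: fmset_meas (fmset_punion (fE^~ b) _).
  - exact: fmset_preimage.
  - by move=> x [a _ []].
have [s hs] := transport_perm n_row n_col.
have pieces_of : forall a, exists I : 'I_(N a) -> set X,
    [/\ forall k, fmset m (I k), forall k, I k `<=` D a,
      forall k, mr (I k) = e & disjoint_family I].
  move=> a; apply: subdivide => //; first exact: ltW.
  by rewrite card_ord -mulr_natl; apply: trunc_div_le => //; exact: mr_ge0.
pose I0 a := projT1 (cid (pieces_of a)).
have I0P a := projT2 (cid (pieces_of a)).
pose Q := {a : At & 'I_(N a)}.
pose J (x : Q) := I0 (tag x) (tagged x).
have fJ x : fmset m (J x) by have [h _ _ _] := I0P (tag x); exact: h.
have JD x : J x `<=` D (tag x) by have [_ h _ _] := I0P (tag x); exact: h.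
have Je x : mr (J x) = e by have [_ _ h _] := I0P (tag x); exact: h.
have dJ : disjoint_family J.
  move=> [a i] [b j] x xi xj.
  have E' : a = b by exact: dD (JD _ _ xi) (JD _ _ xj).
  subst b; congr existT.
  by have [_ _ _ dI] := I0P a; exact: dI xi xj.
exists Q, J, e, s; split; [exact: fJ|exact: e0|exact: Je|exact: dJ|move=> l].
pose P : pred Q := fun x => tag x (l, false) : bool.
exists P.
have cardP (p : pred At) : \sum_(x : Q | p (tag x)) e = \sum_(a | p a) (N a)%:R * e.
  rewrite (eq_bigr (fun a => \sum_(i : 'I_(N a)) e)); last first.
    by move=> a _; rewrite sumr_const card_ord mulr_natl.
  by rewrite sig_big_dep; apply: eq_bigl => x; rewrite andbT.
have mrJ (p : pred Q) : mr (punion J p) = \sum_(x | p x) e.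
  by rewrite mr_punion//; apply: eq_bigr.
have mrB i : mr (B i) <= \sum_(a : At | a i) (N a)%:R * e + K%:R * e.
  rewrite BD mr_punion//.
  apply: (@le_trans _ _ (\sum_(a : At | a i) ((N a)%:R * e + e))).
    by apply: ler_sum => a _; exact: trunc_div_gt.
  by rewrite big_split lerD2l/= sumr_const -[e *+ _]mulr_natl ler_wpM2r ?ler_nat ?max_card// ltW.
have PA : punion J P `<=` A l.
  by move=> x [q Pq Jq]; move: Pq; rewrite /P (DB _ _ _ (JD _ _ Jq)) => /asboolP.
have mrP : mr (punion J P) = \sum_(a : At | a (l, false)) (N a)%:R * e.
  by rewrite mrJ -cardP.
have fP p := fmset_punion fJ p.
have hK : K%:R <= 1 + K%:R ^+ 2 :> R.
  have := sqr_ge0 (K%:R - 1 : R); rewrite sqrrB1; have := ler0n R K; nra.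
have small : K%:R * e + 2 * K%:R ^+ 2 * e < eta.
  have -> : eta = (2 * K%:R ^+ 2 + K%:R + 1) * e by rewrite /e mulrC divfK// gt_eqF.
  by rewrite !mulrDl mul1r; lra.
have KA : K%:R * e < eta.
  by apply: le_lt_trans small; rewrite lerDl !mulr_ge0// ?sqr_ge0// ltW.
split.
  rewrite mrYE// (_ : punion J P `\` A l = set0); last first.
    by apply/seteqP; split=> // x [/PA].
  rewrite mr0 addr0 mrD//; last exact: fmset_meas (fP P).
  by have := mrB (l, false); rewrite /B/= -mrP; lra.
set W := punion J _; pose SA := S @` A l.
have fW : fmset m W by exact: fP.
have fSA : fmset m SA by exact: (fB (l, true)).
have mrSA : mr SA = mr (A l).
  by rewrite /SA image_mpt (mr_preimage (mpt_inverse S)) //; exact: fmset_meas (fA l).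
have mrW : mr W = mr (punion J P).
  rewrite !mrJ (reindex_inj (@perm_inj _ s)); apply: eq_bigl => x.
  by rewrite permK.
have bad : mr (W `\` SA) <= K%:R ^+ 2 * e.
  (* These are the pieces inside [A l] that [s] sends to a cell outside the image. Each cell of
     [A l] has at most [K] pieces beyond those that [n] assigns to cells of the image, whence at
     most [K ^ 2] bad ones. *)
  pose bad : pred Q := fun x => P x && ~~ tag (s x) (l, true).
  have WS : W `\` SA `<=` punion J (fun y => bad (s^-1%g y)).
    move=> x [[q Pq Jq] nSA]; exists q => //; rewrite /bad Pq permKV /=.
    by apply/negP; rewrite (DB _ _ _ (JD _ _ Jq)) => /asboolP.
  apply: le_trans (mr_le _ (fP _) WS) _.
    exact: fmset_meas (fmsetD fW (fmset_meas fSA)).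
  have -> : mr (punion J (fun y => bad (s^-1%g y))) = (\sum_x bad x)%:R * e.
    rewrite mrJ (reindex_inj (@perm_inj _ s)) /= natr_sum mulr_suml.
    rewrite big_mkcond; apply: eq_bigr => x _; rewrite permK.
    by case: (bad x); rewrite ?mul1r ?mul0r.
  rewrite ler_pM2r// -natrX ler_nat.
  have cE : (\sum_x P x = \sum_x bad x + \sum_x (P x && tag (s x) (l, true)))%N.
    rewrite -big_split; apply: eq_bigr => x _; rewrite /bad.
    by case: (P x); case: (tag (s x) _).
  have good : (\sum_(a : At | a (l, false)) \sum_(b : At | b (l, true)) n a b <=
      \sum_x (P x && tag (s x) (l, true)))%N.
    rewrite -(count_pairs (fun x : Q => tag x) (fun x => tag (s x))
      (fun a : At => a (l, false)) (fun b : At => b (l, true))).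
    by apply: leq_sum => a _; apply: leq_sum => b _; exact: hs.
  have total : (\sum_x P x = \sum_(a : At | a (l, false)) N a)%N.
    rewrite (eq_bigr (fun x => if P x then 1%N else 0%N)); last first.
      by move=> x _; case: (P x).
    rewrite -big_mkcond (eq_bigr (fun a => \sum_(i : 'I_(N a)) 1)%N); last first.
      by move=> a _; rewrite sum1_card card_ord.
    by rewrite sig_big_dep; apply: eq_bigl => x; rewrite andbT.
  have Nle (a : At) : a (l, false) -> (N a <= \sum_(b : At | b (l, true)) n a b + K)%N.
    move=> al; rewrite -(ler_nat R) -(ler_pM2r e0).
    apply: (@le_trans _ _ (mr (D a))); first by apply: trunc_div_le => //; exact: mr_ge0.
    have -> : D a = punion (E a) (fun b : At => b (l, true)).
      apply/seteqP; split=> x; last by move=> [b _ []].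
      move=> Dx; have SAx : B (l, true) (S x).
        by exists x => //; move: al; rewrite (DB _ _ _ Dx) => /asboolP.
      by move: SAx; rewrite BD => -[b bl Db]; exists b.
    rewrite mr_punion//; last by move=> b c x [_ xb] [_ xc]; exact: dD xb xc.
    apply: (@le_trans _ _ (\sum_(b : At | b (l, true)) ((n a b)%:R * e + e))).
      by apply: ler_sum => b _; exact: trunc_div_gt.
    rewrite big_split natrD mulrDl natr_sum mulr_suml lerD2l/=.
    by rewrite sumr_const -[e *+ _]mulr_natl ler_wpM2r ?ler_nat ?max_card// ltW.
  have : (\sum_x P x <= \sum_x (P x && tag (s x) (l, true)) + K ^ 2)%N.
    rewrite total; apply: leq_trans (leq_add good (leqnn _)).
    apply: (@leq_trans (\sum_(a : At | a (l, false))
        (\sum_(b : At | b (l, true)) n a b + K))%N).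
      by apply: leq_sum => a; exact: Nle.
    by rewrite big_split leq_add2l/= sum_nat_const leq_mul2r max_card orbT.
  by move=> cnt; have := leq_trans (eq_leq (esym cE)) cnt; rewrite addnC leq_add2l.
rewrite mrYC mrYE//.
have h1 := mrID fSA (fmset_meas fW); have h2 := mrID fW (fmset_meas fSA).
rewrite setIC in h1.
have h3 := mrB (l, false); rewrite /B/= -mrP -mrW -mrSA in h3.
lra.
Qed.

End permutation_approximation.

(** * A criterion for subsequence rational weak mixing *)

Section second_moments.
Context {d} {X : measurableType d} {R : realType}.
Variable m : {measure set X -> \bar R}.
Local Notation mr := (rmeasure m).

(** The double sum is the integral of the square of a simple function; on the cells of the generated
    partition it becomes a weighted sum of squares. *)
Lemma gram_ge0 (s : seq (R * set X)) : (forall p, List.In p s -> fmset m p.2) ->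
  0 <= \sum_(p <- s) \sum_(q <- s) p.1 * q.1 * mr (p.2 `&` q.2).
Proof.
move=> fs; pose N := size s; pose p0 : R * set X := (0, set0).
pose B (i : 'I_N) := (nth p0 s i).2; pose a (i : 'I_N) := (nth p0 s i).1.
have fB i : fmset m (B i).
  apply: fs; rewrite /B; have := ltn_ord i; rewrite {2}/N.
  elim: (s) (nat_of_ord i) => [|q t IHt] [|j] //=; first by left.
  by rewrite ltnS => /IHt; right.
rewrite (big_nth p0) big_mkord.
under eq_bigr do rewrite (big_nth p0) big_mkord.
rewrite -/N.
have [D [fD dD BD]] := atoms fB.
rewrite (_ : \sum_(i < N) _ = \sum_u mr (D u) * (\sum_(i < N) a i * (u i)%:R) ^+ 2).
  by apply: sumr_ge0 => u _; rewrite mulr_ge0 ?mr_ge0 ?sqr_ge0.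
have E i j : mr (B i `&` B j) = \sum_u mr (D u) * ((u i)%:R * (u j)%:R).
  rewrite (_ : B i `&` B j = punion D (fun u => u i && u j)).
    rewrite mr_punion// big_mkcond; apply: eq_bigr => u _.
    by case: (u i); case: (u j); rewrite ?mulr1 ?mulr0 ?mul0r ?mulr0.
  rewrite BD [B j]BD; apply/seteqP; split=> x /=.
    by move=> [[u ui Du] [v vj Dv]]; exists u => //; rewrite ui (dD _ _ _ Du Dv).
  by move=> [u /andP[ui uj] Du]; split; exists u.
rewrite (eq_bigr (fun i => \sum_(j < N) \sum_u
    mr (D u) * (a i * (u i)%:R * (a j * (u j)%:R)))); last first.
  move=> i _; apply: eq_bigr => j _; rewrite -/(B i) -/(B j) E mulr_sumr.
  by apply: eq_bigr => u _; rewrite -/(a i) -/(a j); ring.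
under eq_bigr do rewrite exchange_big.
rewrite exchange_big /=; apply: eq_bigr => u _.
rewrite expr2 mulr_suml mulr_sumr; apply: eq_bigr => i _.
by rewrite mulr_sumr mulr_sumr; apply: eq_bigr.
Qed.

(** A given distance to [k] is attained by at most two indices [l]. *)
Let sum_dist_le (r : nat -> R) n k : (forall j, 0 <= r j) -> (k < n)%N ->
  \sum_(0 <= l < n) r (if (l <= k)%N then k - l else l - k)%N <=
  2 * \sum_(0 <= j < n) r j.
Proof.
move=> r0 kn; have part a : (a <= n)%N -> \sum_(0 <= j < a) r j <= \sum_(0 <= j < n) r j.
  by move=> an; rewrite (big_cat_nat (leq0n a) an)/= lerDl sumr_ge0.
rewrite (big_cat_nat (leq0n k) (ltnW kn))/= mulrDl mul1r; apply: lerD.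
  apply: le_trans (part k.+1 kn).
  rewrite big_nat_rev add0n big_nat_recl//= [leRHS]addrC.
  rewrite -[leLHS]addr0; apply: lerD => //.
  rewrite big_nat [leRHS]big_nat; apply: ler_sum => l /= lk.
  by rewrite (_ : (k - l.+1 <= k)%N); [rewrite subKn|lia].
apply: le_trans (part (n - k)%N _); last exact: leq_subr.
rewrite -{1}[k]add0n big_addn big_nat [leRHS]big_nat; apply: ler_sum => l _.
case: ifP => h; last by rewrite addnK.
by rewrite (_ : l = 0%N) ?add0n ?subnn//; lia.
Qed.

Lemma correlation_iter (V : mpt m) B k l : measurable B ->
  mr (iter k V @^-1` B `&` iter l V @^-1` B) =
  mr (B `&` iter (if (l <= k)%N then k - l else l - k)%N V @^-1` B).
Proof.
move=> mB; have H i j : (i <= j)%N -> mr (iter i V @^-1` B `&` iter j V @^-1` B) =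
    mr (B `&` iter (j - i)%N V @^-1` B).
  move=> ij; rewrite -{1}(subnK ij) iter_preimageD -preimage_setI mr_iter//.
  by apply: measurableI => //; exact: measurable_iter.
by case: leqP => h; [rewrite setIC H|rewrite H// ltnW].
Qed.

Let quadratic_cons2 (U : Type) (a b : U) (t : seq U) (q : U -> U -> R) :
  \sum_(x <- a :: b :: t) \sum_(y <- a :: b :: t) q x y =
  q a a + q a b + q b a + q b b + \sum_(y <- t) q a y + \sum_(y <- t) q b y +
  \sum_(x <- t) q x a + \sum_(x <- t) q x b + \sum_(x <- t) \sum_(y <- t) q x y.
Proof.
rewrite !big_cons; under [X in _ + (_ + X)]eq_bigr do rewrite !big_cons.
by rewrite !big_split/=; ring.
Qed.

(* The visit count [\sum_(k < n) 1_(V^-k B)] is within [n c] times a small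
   constant of [n c m(B) 1_Y] in L2; the pairing with [1_D] is then estimated by
   AM-GM, in the form [0 <= |N_B - n c m(B) 1_Y - n c 1_D|^2]. *)
Lemma visits_le (V : mpt m) (B Y D : set X) (n : nat) (c w delta : R) :
  fmset m B -> fmset m Y -> fmset m D -> B `<=` Y -> 0 < c -> c * mr Y = 1 ->
  (0 < n)%N -> 0 <= w -> 4 * w <= c ^+ 2 * delta ->
  \sum_(0 <= k < n) `|mr (B `&` iter k V @^-1` B) - c * mr B ^+ 2| <= n%:R * w ->
  \sum_(0 <= k < n) `|mr (Y `&` iter k V @^-1` B) - mr B| <= n%:R * w ->
  \sum_(0 <= k < n) mr (D `&` iter k V @^-1` B) <=
    n%:R * c * (mr B * mr D + (mr D + delta) / 2).
Proof.
move=> fB fY fD BY c0 cY n0 w0 wdelta hB hY.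
have mB := fmset_meas fB.
pose A k := iter k V @^-1` B; have fA k : fmset m (A k) by exact: fmset_iter.
set b := mr B; pose N : R := n%:R; have N0 : 0 < N by rewrite ltr0n.
pose lam := N * c * b; pose s := N * c; have s0 : 0 < s by rewrite mulr_gt0.
pose l := (- lam, Y) :: (- s, D) :: [seq (1 : R, A k) | k <- index_iota 0 n].
have fl p : List.In p l -> fmset m p.2.
  rewrite /l => -[<-|[<-|]]//; elim: (index_iota 0 n) => [//|k t IHt] /= [<-|/IHt//].
  exact: fA.
have := gram_ge0 fl; rewrite /l quadratic_cons2 !big_map /=.
rewrite !setIid.
pose SY := \sum_(0 <= k < n) mr (Y `&` A k).
pose SD := \sum_(0 <= k < n) mr (D `&` A k).
pose T := \sum_(0 <= k < n) \sum_(0 <= j < n) mr (A k `&` A j).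
have E (u : R) (Z : set X) :
    \sum_(0 <= k < n) u * 1 * mr (Z `&` A k) = u * \sum_(0 <= k < n) mr (Z `&` A k).
  by rewrite mulr_sumr; apply: eq_bigr => k _; rewrite mulr1.
have E' (u : R) (Z : set X) :
    \sum_(0 <= k < n) 1 * u * mr (A k `&` Z) = u * \sum_(0 <= k < n) mr (Z `&` A k).
  by rewrite mulr_sumr; apply: eq_bigr => k _; rewrite mul1r setIC.
rewrite !E !E' -/SY -/SD.
rewrite [X in _ + X](_ : _ = T); last first.
  by apply: eq_bigr => k _; rewrite big_map; apply: eq_bigr => j _; rewrite !mul1r.
move=> G.
have YD : mr (Y `&` D) <= mr D.
  apply: mr_le => //; exact: fmset_meas (fmsetIl fY (fmset_meas fD)).
have b0 : 0 <= b by exact: mr_ge0.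
have cb : c * b <= 1.
  by rewrite -cY ler_pM2l//; apply: mr_le => //; exact: fmset_meas fY.
have SYge : N * b - N * w <= SY.
  rewrite lerBlDl -lerBlDr; apply: le_trans hY.
  have -> : N * b - SY = \sum_(0 <= k < n) (b - mr (Y `&` A k)).
    by rewrite big_split/= sumr_const_nat subn0 sumrN -mulr_natl.
  by apply: ler_sum => k _; rewrite distrC; exact: ler_norm.
have Tle : T <= N * (N * (c * b ^+ 2)) + N * (2 * (N * w)).
  pose r j := `|mr (B `&` iter j V @^-1` B) - c * b ^+ 2|.
  apply: (@le_trans _ _ (\sum_(0 <= k < n) (N * (c * b ^+ 2) + 2 * (N * w)))); last first.
    by rewrite sumr_const_nat subn0 -[leLHS]mulr_natl -mulrDr.
  rewrite /T big_nat [leRHS]big_nat; apply: ler_sum => k /andP[_ kn].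
  have -> : N * (c * b ^+ 2) = \sum_(0 <= j < n) (c * b ^+ 2).
    by rewrite sumr_const_nat subn0 -mulr_natl.
  rewrite addrC -lerBlDr -sumrB.
  apply: (@le_trans _ _ (2 * \sum_(0 <= j < n) r j)); last by rewrite ler_pM2l.
  apply: le_trans (sum_dist_le (r := r) _ kn); last by move=> j; exact: normr_ge0.
  apply: ler_sum => j _; rewrite /r.
  by rewrite correlation_iter//; exact: ler_norm.
have lam0 : 0 <= lam by rewrite !mulr_ge0// ltW.
have key : 2 * s * SD <= s * (s * mr D) + 2 * lam * s * mr D + 4 * N ^+ 2 * w.
  have h1 : lam ^+ 2 * mr Y = N ^+ 2 * c * b ^+ 2.
    by rewrite /lam -[RHS]mulr1 -cY; ring.
  have h2 : lam * (N * b - N * w) <= lam * SY by exact: ler_wpM2l.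
  have h3 : lam * s * mr (Y `&` D) <= lam * s * mr D.
    by apply: ler_wpM2l => //; rewrite mulr_ge0// ltW.
  have h4 : lam * (N * w) <= N ^+ 2 * w.
    have -> : lam * (N * w) = N ^+ 2 * w * (c * b) by rewrite /lam; ring.
    by rewrite ler_piMr// mulr_ge0// sqr_ge0.
  rewrite (setIC D Y) in G.
  have E1 : lam * (N * b) = N ^+ 2 * c * b ^+ 2 by rewrite /lam; ring.
  nra.
rewrite -/SD -(@ler_pM2l _ (2 * s)) ?mulr_gt0//; apply: le_trans key _.
have -> : 2 * s * (N * c * (b * mr D + (mr D + delta) / 2)) =
  s * (s * mr D) + 2 * lam * s * mr D + N ^+ 2 * (c ^+ 2 * delta).
  by rewrite /s /lam; field.
by rewrite lerD2l -mulrA mulrCA ler_pM2l ?exprn_gt0.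
Qed.

End second_moments.

Section stage_estimate.
Context {d} {X : measurableType d} {R : realType}.
Variable m : {measure set X -> \bar R}.
Local Notation mr := (rmeasure m).
Variables (V : mpt m) (Q : finType) (I : Q -> set X) (e : R) (n : nat) (w : R).
Hypotheses (fI : forall x, fmset m (I x)) (Ie : forall x, mr (I x) = e).
Hypotheses (dI : disjoint_family I) (e0 : 0 < e) (Q0 : (0 < #|Q|)%N).
Hypotheses (n0 : (0 < n)%N) (w0 : 0 <= w).
Hypothesis corr : forall i j,
  \sum_(0 <= k < n) `|mr (I i `&` iter k V @^-1` I j) - e / #|Q|%:R| <= n%:R * w.

Let q : R := #|Q|%:R.
Let q0 : 0 < q. Proof. by rewrite ltr0n. Qed.
(** The reciprocal of the total mass of the pieces: [c * mr A * mr B] is the measure of the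
    intersection of two sets that are independent relative to the union of the pieces. *)
Let c := (q * e)^-1.
Let c0 : 0 < c. Proof. by rewrite invr_gt0 mulr_gt0. Qed.
Let W := q ^+ 2 * w.
Let W0 : 0 <= W. Proof. by rewrite mulr_ge0 ?sqr_ge0. Qed.

Let punion_corr (P1 P2 : pred Q) :
  \sum_(0 <= k < n) `|mr (punion I P1 `&` iter k V @^-1` punion I P2) -
    c * mr (punion I P1) * mr (punion I P2)| <= n%:R * W.
Proof.
apply: (@le_trans _ _ (\sum_(0 <= k < n) \sum_(i | P1 i) \sum_(j | P2 j)
    `|mr (I i `&` iter k V @^-1` I j) - e / q|)).
  apply: ler_sum => k _.
  have fV j : fmset m (iter k V @^-1` I j) by exact: fmset_iter.
  have -> : punion I P1 `&` iter k V @^-1` punion I P2 =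
      punion (fun p : Q * Q => I p.1 `&` iter k V @^-1` I p.2)
        (fun p => P1 p.1 && P2 p.2).
    apply/seteqP; split=> x /=.
      by move=> [[i Pi Ii] [j Pj Ij]]; exists (i, j) => //=; rewrite Pi Pj.
    by move=> [[i j] /= /andP[Pi Pj] [Ii Ij]]; split; [exists i|exists j].
  rewrite [mr (punion (fun p : Q * Q => _) _)]mr_punion; last 2 first.
  - by move=> p; apply: fmsetIl => //; exact: fmset_meas (fV _).
  - move=> [i j] [i' j'] x [/= xi xj] [xi' xj'].
    by rewrite (dI xi xi') (dI xj xj').
  rewrite -(pair_big P1 P2 (fun i j => mr (I i `&` iter k V @^-1` I j))) /=.
  have mrc P : mr (punion I P) = \sum_(i | P i) e by rewrite mr_punion//; apply: eq_bigr.
  rewrite !mrc.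
  have -> : c * (\sum_(i | P1 i) e) * (\sum_(j | P2 j) e) =
      \sum_(i | P1 i) \sum_(j | P2 j) (e / q).
    rewrite -mulrA big_distrlr mulr_sumr; apply: eq_bigr => i _.
    rewrite mulr_sumr; apply: eq_bigr => j _; rewrite /c.
    by rewrite /=; field; rewrite !gt_eqF.
  rewrite -sumrB; apply: le_trans (ler_norm_sum _ _ _) _; apply: ler_sum => i _.
  by rewrite -sumrB; exact: ler_norm_sum.
rewrite exchange_big /=; under eq_bigr do rewrite exchange_big /=.
apply: (@le_trans _ _ (\sum_(i : Q) \sum_(j : Q) (n%:R * w))); last first.
  by rewrite !sumr_const -mulrnA -[leLHS]mulr_natl natrM /W expr2 mulrCA.
have nw0 : 0 <= n%:R * w by rewrite mulr_ge0.
rewrite big_mkcond; apply: ler_sum => i _; case: (P1 i); last by rewrite sumr_ge0.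
rewrite big_mkcond; by apply: ler_sum => j _; case: (P2 j).
Qed.

Let Y := punion I predT.

Let mrY : c * mr Y = 1.
Proof.
rewrite mr_punion// (eq_bigr (fun=> e))// sumr_const -mulr_natl /c mulVf//.
by rewrite gt_eqF ?mulr_gt0.
Qed.

Variable delta : R.
Hypotheses (w1 : 4 * (#|Q|%:R ^+ 2 * w) <= (#|Q|%:R * e)^-1 ^+ 2 * delta).
Hypotheses (w2 : #|Q|%:R ^+ 2 * w <= (#|Q|%:R * e)^-1 * delta).

(** Replacing [A] and [B] by unions of pieces costs visits between a small arbitrary set and a union
    of pieces, the situation of [visits_le]. This is why [B] has to lie in a union [G'], and why the
    inverse of [V] is used for the second replacement. *)
Lemma stage_estimate A B (PG PA PB : pred Q) :
  measurable A -> measurable B -> A `<=` punion I PG -> B `<=` punion I PG ->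
  \sum_(0 <= k < n) `|mr (A `&` iter k V @^-1` B) - (#|Q|%:R * e)^-1 * mr A * mr B| <=
  n%:R * (#|Q|%:R * e)^-1 *
   (2 * mr (punion I PG) * mr (A `+` punion I PA) +
    2 * mr (punion I PA) * mr (B `+` punion I PB) +
    (mr (A `+` punion I PA) + mr (B `+` punion I PB)) / 2 + 2 * delta).
Proof.
move=> mA mB AG BG; rewrite -/q -/c.
have fP P := fmset_punion fI P.
have fA := fmset_sub mA (fP PG) AG; have fB := fmset_sub mB (fP PG) BG.
set G' := punion I PG; set A' := punion I PA; set B' := punion I PB.
have fG : fmset m G' by exact: fP.
have fA' : fmset m A' by exact: fP.
have fB' : fmset m B' by exact: fP.
set al := mr (A `+` A'); set be := mr (B `+` B').
have fal : fmset m (A `+` A') by exact: fmsetY.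
have fbe : fmset m (B `+` B') by exact: fmsetY.
have subY P : punion I P `<=` Y by apply: sub_punion.
have fY : fmset m Y by exact: fP.
have V1 : \sum_(0 <= k < n) mr ((A `+` A') `&` iter k V @^-1` G') <=
    n%:R * c * (mr G' * al + (al + delta) / 2).
  apply: (visits_le (Y := Y) (w := W)) => //; first exact: subY.
    by under eq_bigr do rewrite expr2 mulrA; exact: punion_corr.
  by under eq_bigr do rewrite -[mr (punion I PG)]mul1r -mrY; exact: punion_corr.
have V2 : \sum_(0 <= k < n) mr (A' `&` iter k V @^-1` (B `+` B')) <=
    n%:R * c * (mr A' * be + (be + delta) / 2).
  have mA' := fmset_meas fA'; have mbe := fmset_meas fbe.
  have mY := fmset_meas fY.
  under eq_bigr do rewrite -mr_iter_inverse//.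
  apply: (visits_le (V := mpt_inverse V) (Y := Y) (w := W)) => //.
  - exact: subY.
  - under eq_bigr do rewrite mr_iter_inverse//.
    by under eq_bigr do rewrite expr2 mulrA; exact: punion_corr.
  - under eq_bigr do rewrite mr_iter_inverse//.
    by under eq_bigr do rewrite -[mr (punion I PA)]mul1r -mrY mulrAC; exact: punion_corr.
have V3 := punion_corr PA PB.
have V4 : `|c * mr A' * mr B' - c * mr A * mr B| <= c * (mr A' * be + mr G' * al).
  have hA := mr_dist fA fA'; have hB := mr_dist fB fB'.
  have hBG : mr B <= mr G' by exact: mr_le.
  have -> : c * mr A' * mr B' - c * mr A * mr B =
    c * (mr A' * (mr B' - mr B) + mr B * (mr A' - mr A)) by ring.
  rewrite normrM gtr0_norm// ler_pM2l//; apply: le_trans (ler_normD _ _) _.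
  rewrite !normrM !(ger0_norm (mr_ge0 _ _)) (distrC (mr B')) (distrC (mr A')).
  apply: lerD; first by rewrite ler_wpM2l ?mr_ge0.
  by apply: ler_pM; rewrite ?mr_ge0.
apply: (@le_trans _ _ (\sum_(0 <= k < n)
   (mr ((A `+` A') `&` iter k V @^-1` G') + mr (A' `&` iter k V @^-1` (B `+` B')) +
    `|mr (A' `&` iter k V @^-1` B') - c * mr A' * mr B'| +
    `|c * mr A' * mr B' - c * mr A * mr B|))).
  apply: ler_sum => k _.
  have fk Z : fmset m Z -> fmset m (iter k V @^-1` Z) by exact: fmset_iter.
  have h1 := mr_setID fA fA' (fmset_meas (fk _ fB)).
  have h2 := mr_setID (fk _ fB) (fk _ fB') (fmset_meas fA').
  rewrite ![_ `&` A']setIC in h2.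
  have h3 : mr ((A `+` A') `&` iter k V @^-1` B) <= mr ((A `+` A') `&` iter k V @^-1` G').
    apply: mr_le; last by apply: setIS => x /=; exact: BG.
      exact: fmset_meas (fmsetIl fal (fmset_meas (fk _ fB))).
    exact: fmsetIl fal (fmset_meas (fk _ fG)).
  have := ler_normD (mr (A `&` iter k V @^-1` B) - mr (A' `&` iter k V @^-1` B))
    (mr (A' `&` iter k V @^-1` B) - mr (A' `&` iter k V @^-1` B')).
  have := ler_normD (mr (A `&` iter k V @^-1` B) - mr (A' `&` iter k V @^-1` B'))
    (mr (A' `&` iter k V @^-1` B') - c * mr A' * mr B').
  have := ler_normD (mr (A `&` iter k V @^-1` B) - c * mr A' * mr B')
    (c * mr A' * mr B' - c * mr A * mr B).
  rewrite !subrKA; lra.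
rewrite !big_split /= sumr_const_nat subn0 -[X in _ + X]mulr_natl.
have nn : 0 < n%:R :> R by rewrite ltr0n.
have V5 : n%:R * `|c * mr A' * mr B' - c * mr A * mr B| <=
    n%:R * (c * (mr A' * be + mr G' * al)) by rewrite ler_pM2l.
have V6 : n%:R * W <= n%:R * (c * delta) by rewrite ler_pM2l.
have -> : n%:R * c * (2 * mr G' * al + 2 * mr A' * be + (al + be) / 2 + 2 * delta) =
  n%:R * c * (mr G' * al + (al + delta) / 2) +
  n%:R * c * (mr A' * be + (be + delta) / 2) + n%:R * (c * delta) +
  n%:R * (c * (mr A' * be + mr G' * al)) by field.
lra.
Qed.

End stage_estimate.

Section exhaustion.
Context {d} {X : measurableType d} {R : realType}.
Variable m : {sigma_finite_measure set X -> \bar R}.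
Local Notation mr := (rmeasure m).

Lemma exhaustion : exists F : (set X)^nat, [/\ forall k, fmset m (F k),
  forall k, F k `<=` F k.+1, \bigcup_k F k = setT &
  forall A, measurable A -> m A != 0%E -> exists N, forall k, (N <= k)%N ->
    0 < mr (A `&` F k)].
Proof.
have /sigma_finiteP[F [FT ndF mF]] := sigma_finiteT m.
have ndF' j k : (j <= k)%N -> F j `<=` F k by move=> jk; apply/subsetPset/ndF.
exists F; split=> //; first by move=> k; exact: ndF'.
move=> A mA A0; apply: contrapT => h.
have Fk0 k : m (A `&` F k) = 0%E.
  have fAk : fmset m (A `&` F k) by exact: fmsetIr.
  rewrite (mrE fAk); congr EFin; apply/eqP; rewrite eq_le mr_ge0 andbT leNgt.
  apply/negP => pk; apply: h; exists k => j kj; apply: lt_le_trans pk _.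
  apply: mr_le; first exact: fmset_meas fAk.
    exact: fmsetIr.
  by apply: setIS; exact: ndF'.
move/eqP: A0; apply; rewrite -[A]setIT FT setI_bigcupr.
apply: (@measure_negligible _ _ _ m).
  by apply: bigcup_measurable => k _; apply: measurableI => //; case: (mF k).
apply: negligible_bigcup => k; exists (A `&` F k).
by split; [apply: measurableI => //; case: (mF k)|exact: Fk0|].
Qed.

End exhaustion.

Section srwm_criterion.
Context {d} {X : measurableType d} {R : realType}.
Variable m : {sigma_finite_measure set X -> \bar R}.
Local Notation mr := (rmeasure m).
Variable V : mpt m.
Variables (Q : nat -> finType) (I : forall j, Q j -> set X).
Variables (e w : nat -> R) (n : nat -> nat).
Hypotheses (fI : forall j x, fmset m (@I j x)) (Ie : forall j x, mr (@I j x) = e j).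
Hypotheses (dI : forall j, disjoint_family (@I j)) (e0 : forall j, 0 < e j).
Hypotheses (Q0 : forall j, (0 < #|Q j|)%N) (w0 : forall j, 0 <= w j).
Hypothesis n_ge : forall j, (j < n j)%N.
Hypothesis corr : forall j x y, \sum_(0 <= k < n j)
  `|mr (@I j x `&` iter k V @^-1` @I j y) - e j / #|Q j|%:R| <= (n j)%:R * w j.
Hypotheses (w1 : forall j, 4 * (#|Q j|%:R ^+ 2 * w j) <=
  (#|Q j|%:R * e j)^-1 ^+ 2 * j.+1%:R^-1).
Hypotheses (w2 : forall j, #|Q j|%:R ^+ 2 * w j <=
  (#|Q j|%:R * e j)^-1 * j.+1%:R^-1).
Hypothesis approx : forall A (eta : R), fmset m A -> 0 < eta -> exists J, forall j,
  (J <= j)%N -> exists P : pred (Q j), mr (A `+` punion (@I j) P) < eta.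

Let c j : R := (#|Q j|%:R * e j)^-1.

Let c0 j : 0 < c j.
Proof. by rewrite invr_gt0 mulr_gt0 ?ltr0n. Qed.

Let close A B j (eta : R) :=
  \sum_(0 <= k < n j) `|mr (A `&` iter k V @^-1` B) - c j * mr A * mr B| <=
  eta * ((n j)%:R * c j).

(* Along a subsequence [F] agrees with a union of pieces up to [2^-i]; the
   points covered by all but the first [N] of these unions form [G]. *)
Let good_part F (eta0 : R) : fmset m F -> 0 < eta0 ->
  exists (phi : nat -> nat) G, [/\ forall i, (i <= phi i)%N, measurable G, G `<=` F,
    mr (F `\` G) < eta0 &
    forall A B, measurable A -> measurable B -> A `<=` G -> B `<=` G ->
    forall eta : R, 0 < eta -> exists i0, forall i, (i0 <= i)%N -> close A B (phi i) eta].
Proof.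
move=> fF eta00.
have p0 i : 0 < 2^-1 ^+ i :> R by rewrite exprn_gt0 ?invr_gt0.
have ex i : exists p : {j : nat & pred (Q j)},
    (i <= tag p)%N /\ mr (F `+` punion (@I (tag p)) (tagged p)) < 2^-1 ^+ i.
  have [J hJ] := approx fF (p0 i).
  have [P hP] := hJ (maxn i J) (leq_maxr _ _).
  by exists (existT _ (maxn i J) P); split=> //=; rewrite leq_maxl.
pose p i := projT1 (cid (ex i)).
pose phi i := tag (p i); pose P i : pred (Q (phi i)) := tagged (p i).
have phi_ge i : (i <= phi i)%N by have [] := projT2 (cid (ex i)).
pose U i := punion (@I (phi i)) (P i).
have Ulim i : mr (F `+` U i) < 2^-1 ^+ i by have [] := projT2 (cid (ex i)).
have fU i : fmset m (U i) by exact: fmset_punion.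
have [N hN] : exists N, 2 * 2^-1 ^+ N < eta0.
  have : (2^-1 : R) ^+ k @[k --> \oo] --> 0.
    by apply: cvg_expr; rewrite ger0_norm ?invr_ge0// invf_lt1// ltr1n.
  move=> /cvgrPdist_lt /(_ (eta0 / 2)) [|N _ h]; first by rewrite divr_gt0.
  exists N; have := h N (leqnn _); rewrite /= sub0r normrN ger0_norm ?exprn_ge0 ?invr_ge0//.
  by lra.
pose G := F `&` \bigcap_i U (N + i)%N.
have mG : measurable G.
  apply: measurableI; first exact: fmset_meas fF.
  by apply: bigcap_measurableType => i _; exact: fmset_meas (fU _).
have GF : G `<=` F by move=> x [].
have fG := fmset_sub mG fF GF.
exists phi, G; split=> //.
  have -> : F `\` G = \bigcup_k (F `\` \bigcap_(i in [set i | (i <= k)%N]) U (N + i)%N).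
    apply/seteqP; split=> x.
      move=> [Fx nG]; apply: contrapT => h; apply: nG; split=> // i _.
      apply: contrapT => nU; apply: h; exists i => //; split=> // /(_ i (leqnn _)).
      exact: nU.
    by move=> [k _ [Fx nU]]; split=> // -[_ h]; apply: nU => i _; exact: h.
  have mk k : measurable (F `\` \bigcap_(i in [set i | (i <= k)%N]) U (N + i)%N).
    apply: measurableD; first exact: fmset_meas fF.
    by apply: bigcap_measurableType => i _; exact: fmset_meas (fU _).
  apply: le_lt_trans hN; apply: mr_bigcup_le => //.
  - move=> k x [Fx nU]; split=> // h; apply: nU => i ik; apply: h.
    exact: leqW.
  - apply: (fmset_sub _ fF); first exact: bigcup_measurable.
    by move=> x [k _ []].
  - move=> k.
    (* Subtracting the tail of the geometric series makes the bound provable by induction on [k]. *)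
    suff : mr (F `\` \bigcap_(i in [set i | (i <= k)%N]) U (N + i)%N) <=
        2 * (2^-1 ^+ N - 2^-1 ^+ (N + k.+1)).
      by have := p0 (N + k.+1)%N; lra.
    have FU i : mr (F `\` U i) <= 2^-1 ^+ i.
      apply: le_trans (ltW (Ulim i)); apply: mr_le.
      + exact: fmset_meas (fmsetD fF (fmset_meas (fU _))).
      + exact: fmsetY.
      + by move=> x ?; left.
    elim: k => [|k IHk].
      apply: le_trans (_ : mr (F `\` U N) <= _).
        apply: mr_le => //; first exact: fmsetD fF (fmset_meas (fU _)).
        move=> x [Fx nU]; split=> // h; apply: nU => i; rewrite /= leqn0 => /eqP ->.
        by rewrite addn0.
      apply: le_trans (FU N) _; rewrite addn1 exprS.
      by have := p0 N; lra.
    apply: (@le_trans _ _ (mr ((F `\` \bigcap_(i in [set i | (i <= k)%N]) U (N + i)%N)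
        `|` (F `\` U (N + k.+1)%N)))).
      apply: mr_le => //.
        apply: fmsetU; last exact: fmsetD fF (fmset_meas (fU _)).
        by apply: (fmset_sub (mk k) fF) => x [].
      move=> x [Fx nU]; have [Uk|nUk] := pselect (U (N + k.+1)%N x); last by right.
      left; split=> // h; apply: nU => i /=.
      by rewrite leq_eqVlt => /orP[/eqP ->|ik]//; exact: h.
    apply: le_trans (mr_leU _ _) _.
    + by apply: (fmset_sub (mk k) fF) => x [].
    + exact: fmsetD fF (fmset_meas (fU _)).
    apply: le_trans (lerD IHk (FU _)) _.
    by rewrite [(N + k.+2)%N]addnS [2^-1 ^+ (_).+1]exprS; lra.
move=> A B mA mB AG BG eta eta1.
have fA := fmset_sub mA fG AG; have fB := fmset_sub mB fG BG.
(* [C] adds up the coefficients of the three errors in [stage_estimate], each of which will be below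
   [th <= 1]; the summands 1 allow for the measures of the approximants. *)
pose C : R := 2 * (mr F + 1) + 2 * (mr A + 1) + 3.
have C0 : 0 < C by rewrite /C; have := mr_ge0 m F; have := mr_ge0 m A; lra.
pose th := Num.min 1 (eta / C).
have th0 : 0 < th by rewrite lt_min ltr01 divr_gt0.
have [JA hA] := approx fA th0; have [JB hB] := approx fB th0.
have [J hJ] : exists J, forall j, (J <= j)%N -> (j.+1%:R)^-1 < th :> R.
  exists (Num.trunc (th^-1)) => j hj; rewrite invf_plt ?posrE//.
  by apply: lt_le_trans (truncnS_gt _) _; rewrite ler_nat ltnS.
exists (maxn N (maxn JA (maxn JB J))) => i.
rewrite !geq_max => /andP[Ni /andP[JAi /andP[JBi Ji]]].
have [PA hPA] := hA _ (leq_trans JAi (phi_ge i)).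
have [PB hPB] := hB _ (leq_trans JBi (phi_ge i)).
have hd := hJ _ (leq_trans Ji (phi_ge i)).
have GU : G `<=` U i.
  by move=> x [_ /(_ (i - N)%N Logic.I)]; rewrite subnKC.
apply: le_trans (@stage_estimate _ _ _ m V (Q (phi i)) (@I (phi i)) (e (phi i))
  (n (phi i)) (w (phi i)) _ _ _ _ _ _ _ _ (phi i).+1%:R^-1 _ _ A B (P i) PA PB
  mA mB _ _) _ => //.
- exact: leq_ltn_trans (n_ge (phi i)).
- exact: subset_trans GU.
- exact: subset_trans GU.
have nc0 : 0 < (n (phi i))%:R * c (phi i).
  by apply: mulr_gt0; [rewrite ltr0n; exact: leq_ltn_trans (n_ge (phi i))|exact: c0].
rewrite mulrC ler_pM2r//.
have fPA : fmset m (punion (@I (phi i)) PA) by exact: fmset_punion.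
have hU : mr (U i) <= mr F + 1.
  have := mr_dist fF (fU i); have := Ulim i.
  have : 2^-1 ^+ i <= 1 :> R by rewrite exprn_ile1 ?invr_ge0 ?invf_le1 ?ler1n.
  rewrite ler_norml; lra.
have th1 : th <= 1 by rewrite ge_min lexx.
have hA1 : mr (punion (@I (phi i)) PA) <= mr A + 1.
  by have := mr_dist fA fPA; rewrite ler_norml; lra.
have thC : th * C <= eta by rewrite -ler_pdivlMr// ge_min lexx orbT.
set a1 := mr (A `+` _) in hPA *; set b1 := mr (B `+` _) in hPB *.
have a10 : 0 <= a1 by exact: mr_ge0.
have b10 : 0 <= b1 by exact: mr_ge0.
apply: le_trans thC; rewrite /C.
have := mr_ge0 m (U i); have := mr_ge0 m (punion (@I (phi i)) PA).
rewrite -/(U i); set u := mr (U i) in hU *; set v := mr (punion _ PA) in hA1 *.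
move=> v0 u0.
have k1 : u * a1 <= (mr F + 1) * th by apply: ler_pM => //; exact: ltW.
have k2 : v * b1 <= (mr A + 1) * th by apply: ler_pM => //; exact: ltW.
move: hd; set r := _^-1 => hd; lra.
Qed.

Let mr_part A F G : measurable A -> fmset m F -> measurable G -> G `<=` F ->
  mr (F `\` G) < mr (A `&` F) -> 0 < mr (A `&` G).
Proof.
move=> mA fF mG GF h.
have fAF : fmset m (A `&` F) by exact: fmsetIr.
have := mrID fAF mG; rewrite -setIA (_ : F `&` G = G); last first.
  by apply/setIidPr.
have : mr (A `&` F `\` G) <= mr (F `\` G).
  apply: mr_le; first exact: fmset_meas (fmsetD fAF mG).
    exact: fmsetD.
  by move=> x [[_ Fx] nG].
lra.
Qed.

Let n_gt1 j : (0 < j)%N -> (1 < n j)%N.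
Proof. by move=> j0; exact: leq_ltn_trans (n_ge j). Qed.

(** A wandering set of positive measure would meet some good part [G] in positive measure; this
    intersection has no returns at positive times, whereas [close] demands about [n j * c j] times
    the square of its measure. *)
Let conservativeV : conservative V.
Proof.
move=> A mA; set W := A `\` _.
have mW : measurable W.
  apply: measurableD => //; apply: bigcup_measurable => k _.
  exact: measurable_iter.
apply/eqP/negPn/negP => W0.
have [F [fF _ _ hF]] := exhaustion m.
have [N hN] := hF _ mW W0; have WF := hN N (leqnn N).
have [phi [G [phi_ge mG GF hG hclose]]] := good_part (fF N) WF.
have W'0 := mr_part mW (fF N) mG GF hG.
set W' := W `&` G in W'0.
have mW' : measurable W' by exact: measurableI.
have fW' : fmset m W' by apply: fmset_sub (fF N) _ => // x [_ /GF].
have wand k : (0 < k)%N -> mr (W' `&` iter k V @^-1` W') = 0.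
  move=> k0; rewrite (_ : _ `&` _ = set0) ?mr0//; apply/seteqP; split=> // x.
  move=> [[[Ax nW] _] [[AVx _] _]]; apply: nW; exists k => //.
(* As [n j >= 2], the [n j - 1] positive times make up at least half of all times, more than the
   fraction 1/4 allowed here. *)
have eta0 : 0 < mr W' ^+ 2 / 4 by rewrite divr_gt0 ?exprn_gt0.
have W'G : W' `<=` G by move=> x [].
have [i0 hi0] := hclose W' W' mW' mW' W'G W'G _ eta0.
pose j := phi (maxn i0 1).
have j0 : (0 < j)%N by apply: leq_trans (phi_ge _); rewrite leq_max orbT.
have := hi0 (maxn i0 1) (leq_maxl _ _); rewrite /close -/j.
have n1 := n_gt1 j0.
rewrite (big_cat_nat (n := 1))//; last exact: ltnW.
have -> : \sum_(1 <= k < n j) `|mr (W' `&` iter k V @^-1` W') - c j * mr W' * mr W'| =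
    (n j).-1%:R * (c j * mr W' ^+ 2).
  rewrite -subn1 mulr_natl -sumr_const_nat big_nat [RHS]big_nat; apply: eq_bigr => k /andP[k1 _].
  rewrite wand// sub0r normrN -mulrA -expr2 ger0_norm// mulr_ge0 ?sqr_ge0//.
  exact/ltW/c0.
have : 0 <= \sum_(0 <= k < 1) `|mr (W' `&` iter k V @^-1` W') - c j * mr W' * mr W'|.
  by apply: sumr_ge0 => k _.
have cw : 0 < c j * mr W' ^+ 2 by rewrite mulr_gt0 ?exprn_gt0 ?c0.
have nn : (n j)%:R = (n j).-1%:R + 1 :> R by rewrite natr1 prednK// ltnW.
have n2 : 1 <= (n j).-1%:R :> R by rewrite ler1n -ltnS prednK// ltnW.
have -> : mr W' ^+ 2 / 4 * ((n j)%:R * c j) =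
  ((n j).-1%:R + 1) * (c j * mr W' ^+ 2) / 4 by rewrite nn; field.
have := ler_wpM2r (ltW cw) n2; rewrite mul1r.
set s := \sum_(0 <= k < 1) _; set u := c j * _; set a := (n j).-1%:R.
rewrite (_ : (a + 1) * u = a * u + u); last by ring.
by move: cw; rewrite -/u /= => cw; lra.
Qed.

(** If an invariant set and its complement both had positive measure, they would meet a common good
    part in sets between which almost no orbit passes, while [close] makes their correlations
    positive on average. *)
Let ergodicV : ergodic V.
Proof.
move=> A mA VA0; have [A0|A0] := eqVneq (m A) 0%E; first by left; exact: A0.
right; apply/eqP/negPn/negP => A'0.
have mA' : measurable (~` A) by exact: measurableC.
have [F [fF _ _ hF]] := exhaustion m.
have [N1 hN1] := hF _ mA A0; have [N2 hN2] := hF _ mA' A'0.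
pose N := maxn N1 N2; have AF := hN1 N (leq_maxl _ _).
have A'F := hN2 N (leq_maxr _ _).
have eta0 : 0 < Num.min (mr (A `&` F N)) (mr (~` A `&` F N)) by rewrite lt_min AF.
have [phi [G [phi_ge mG GF hG hclose]]] := good_part (fF N) eta0.
move: hG; rewrite lt_min => /andP[hG1 hG2].
have B0 := mr_part mA (fF N) mG GF hG1.
have B'0 := mr_part mA' (fF N) mG GF hG2.
set B := A `&` G in B0; set B' := ~` A `&` G in B'0.
have mB : measurable B by exact: measurableI.
have mB' : measurable B' by exact: measurableI.
have fB' : fmset m B' by apply: fmset_sub (fF N) _ => // x [_ /GF].
have fB : fmset m B by apply: fmset_sub (fF N) _ => // x [_ /GF].
have inv k : m (iter k V @^-1` A `+` A) = 0%E.
  elim: k => [|k IHk]; first by rewrite setYK measure0.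
  rewrite iter_preimageS; apply/eqP; rewrite eq_le measure_ge0 andbT.
  have mk := measurable_iter V k mA.
  apply: le_trans (measure_symdiff_triangle m (measurable_mpt_preimage V mk)
    (measurable_mpt_preimage V mA) mA) _.
  rewrite VA0 adde0 -preimage_symdiff mpt_preserving; last exact: measurable_symdiff.
  by rewrite le_eqVlt; apply/orP; left; apply/eqP; exact: IHk.
have sep k : mr (B `&` iter k V @^-1` B') = 0.
  have fBk : fmset m (B `&` iter k V @^-1` B').
    by apply: fmsetIl => //; exact: measurable_iter.
  apply: EFin_inj; rewrite -mrE//; apply/eqP; rewrite eq_le measure_ge0 andbT.
  apply: (@le_trans _ _ (m (iter k V @^-1` A `+` A))); last first.
    by rewrite le_eqVlt; apply/orP; left; apply/eqP; exact: inv.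
  apply: le_measure; rewrite ?inE.
  - exact: fmset_meas fBk.
  - by apply: measurable_symdiff => //; exact: measurable_iter.
  - by move=> x [[Ax _] [nA _]]; right.
have eta1 : 0 < mr B * mr B' / 2 by rewrite divr_gt0 ?mulr_gt0.
have BG : B `<=` G by move=> x [].
have B'G : B' `<=` G by move=> x [].
have [i0 hi0] := hclose B B' mB mB' BG B'G _ eta1.
have := hi0 i0 (leqnn _); rewrite /close; set j := phi i0.
under eq_bigr do rewrite sep sub0r normrN.
rewrite sumr_const_nat subn0 -[leLHS]mulr_natl ger0_norm; last first.
  by rewrite !mulr_ge0 ?mr_ge0// ltW// c0.
have n0 : 0 < (n j)%:R :> R by rewrite ltr0n (leq_ltn_trans _ (n_ge j)).
have u0 : 0 < (n j)%:R * (c j * mr B * mr B') by rewrite !mulr_gt0 ?c0.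
have -> : mr B * mr B' / 2 * ((n j)%:R * c j) = (n j)%:R * (c j * mr B * mr B') / 2.
  by field.
lra.
Qed.

(** Applied to the pair [G], [G], [close] compares the stage constant [c j] with the return rates of
    [G]; this eliminates [c j] from the estimate for [A] and [B]. *)
Lemma srwm_criterion : m setT != 0%E -> subsequence_rationally_weakly_mixing V.
Proof.
move=> mT0; have [F [fF _ _ hF]] := exhaustion m.
have [N hN] := hF _ measurableT mT0; have := hN N (leqnn N); rewrite setTI => FN.
have F2 : 0 < mr (F N) / 2 by rewrite divr_gt0.
have [phi [G [phi_ge mG GF hG hclose]]] := good_part (fF N) F2.
have fG := fmset_sub mG (fF N) GF.
have G0 : 0 < mr G by have := mrD (fF N) mG GF; lra.
pose K := range (n \o phi).
have Kge i0 : exists M, forall k, K k -> (M < k)%N ->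
    exists2 i, (i0 <= i)%N & k = n (phi i).
  exists (\max_(i < i0) n (phi i)) => k [i _ <-] /= h; exists i => //.
  rewrite leqNgt; apply/negP => ii0; move: h; rewrite ltnNge => /negP; apply.
  exact: (leq_bigmax (Ordinal ii0)).
exists K.
  move=> /finite_seqP[s Es].
  pose M := (\max_(x <- s) x)%N.
  have : K (n (phi M)) by exists M.
  rewrite Es /= => hs; have := @leq_bigmax_seq _ s predT id _ hs isT; apply/negP.
  by rewrite -ltnNge; exact: leq_ltn_trans (phi_ge M) (n_ge _).
split; [exact: conservativeV|exact: ergodicV|].
exists G; split.
- exact: mG.
- by rewrite (mrE fG) lte_fin.
- by case: fG.
move=> A B mA mB AG BG.
have fA := fmset_sub mA fG AG; have fB := fmset_sub mB fG BG.
apply/cvgrPdist_le => eps eps0.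
pose g2 := mr G ^+ 2; have g20 : 0 < g2 by rewrite exprn_gt0.
pose ab := mr A * mr B.
have ab0 : 0 <= ab by rewrite mulr_ge0 ?mr_ge0.
(* The first bound keeps the return sequence above [N1 / 2], the second makes the numerator at most
   [eps * (N1 / 2)]. *)
pose eta := Num.min (g2 / 2) (eps / (2 * (1 + ab / g2))).
have abg : 0 < 1 + ab / g2 by rewrite ltr_wpDr// divr_ge0// ltW.
have eta0 : 0 < eta.
  by rewrite lt_min; apply/andP; split; rewrite divr_gt0// mulr_gt0.
have [i1 hi1] := hclose A B mA mB AG BG _ eta0.
have [i2 hi2] := hclose G G mG mG (@subset_refl _ _) (@subset_refl _ _) _ eta0.
have [M hM] := Kge (maxn i1 i2).
exists M.+1 => // k /= Mk Kk.
have [i] := hM _ Kk Mk; rewrite geq_max => /andP[ii1 ii2] ->.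
have := hi1 i ii1; have := hi2 i ii2; rewrite /close; set j := phi i.
rewrite /return_sequence /return_rate -/(rmeasure m G) -/g2 sub0r normrN.
set N1 := (n j)%:R * c j => hGG hAB.
have n0 : 0 < (n j)%:R :> R by rewrite ltr0n (leq_ltn_trans _ (n_ge j)).
have N0 : 0 < N1 by rewrite mulr_gt0 ?c0.
pose u k := mr (G `&` iter k V @^-1` G) / g2.
have hu : \sum_(0 <= k < n j) `|u k - c j| <= eta / g2 * N1.
  rewrite mulrAC ler_pdivlMr// mulr_suml; apply: le_trans hGG.
  rewrite le_eqVlt; apply/orP; left; apply/eqP; apply: eq_bigr => l _.
  rewrite -(gtr0_norm g20) -normrM /u mulrBl divfK ?gt_eqF//.
  by rewrite /g2 expr2 mulrA.
have sumu : N1 / 2 <= \sum_(0 <= k < n j) u k.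
  have : \sum_(0 <= k < n j) (c j - u k) <= eta / g2 * N1.
    apply: le_trans hu; apply: ler_sum => l _; rewrite distrC; exact: ler_norm.
  rewrite big_split/= sumr_const_nat subn0 sumrN -[c j *+ _]mulr_natl -/N1.
  have : eta / g2 <= 1 / 2.
    by rewrite ler_pdivrMr// mulrC mulrA mulr1 ge_min lexx.
  move=> /(ler_wpM2r (ltW N0)); lra.
have num : \sum_(0 <= k < n j) `|mr (A `&` iter k V @^-1` B) - mr A * mr B * u k| <=
    eta * (1 + ab / g2) * N1.
  apply: (@le_trans _ _ (\sum_(0 <= k < n j)
      (`|mr (A `&` iter k V @^-1` B) - c j * mr A * mr B| + ab * `|u k - c j|))).
    apply: ler_sum => l _.
    rewrite -[ab in leRHS](ger0_norm ab0) -normrM -[`|ab * _|]normrN.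
    apply: le_trans (ler_normD _ _); rewrite le_eqVlt; apply/orP; left; apply/eqP.
    by congr `|_|; rewrite /ab; ring.
  rewrite big_split/= -mulr_sumr mulrDr mulr1 mulrDl; apply: lerD => //.
  have -> : eta * (ab / g2) * N1 = ab * (eta / g2 * N1) by ring.
  exact: ler_wpM2l.
have su0 : 0 < \sum_(0 <= k < n j) u k by apply: lt_le_trans sumu; rewrite divr_gt0.
rewrite normrM normfV (gtr0_norm su0) ger0_norm ?sumr_ge0//.
rewrite ler_pdivrMr//; apply: le_trans num _.
apply: (@le_trans _ _ (eps * (N1 / 2))); last by rewrite ler_pM2l.
have : eta * (1 + ab / g2) <= eps / 2.
  rewrite -ler_pdivlMr// -mulrA -invfM ge_min [X in _ || X]lexx orbT//.
move=> /(ler_wpM2r (ltW N0)); lra.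
Qed.

End srwm_criterion.

(** * Sets that are limits of unions of pieces *)

Section approximability.
Context {d} {X : measurableType d} {R : realType}.
Variable m : {measure set X -> \bar R}.
Local Notation mr := (rmeasure m).
Variables (Q : nat -> finType) (I : forall j, Q j -> set X).
Hypotheses (fI : forall j x, fmset m (@I j x)) (dI : forall j, disjoint_family (@I j)).

Definition approximable (A : set X) := forall eta : R, 0 < eta ->
  exists J, forall j, (J <= j)%N -> exists P : pred (Q j),
    mr (A `+` punion (@I j) P) < eta.

Let fP j P : fmset m (punion (@I j) P). Proof. exact: fmset_punion. Qed.

Lemma approximable0 : approximable set0.
Proof.
move=> eta eta0; exists 0 => j _; exists xpred0.
rewrite (_ : punion _ _ = set0); first by rewrite setYK mr0.
by apply/seteqP; split=> x // [].
Qed.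

Lemma approximableD A B : fmset m A -> fmset m B ->
  approximable A -> approximable B -> approximable (A `\` B).
Proof.
move=> fA fB aA aB eta eta0; have eta2 : 0 < eta / 2 by rewrite divr_gt0.
have [JA hA] := aA _ eta2; have [JB hB] := aB _ eta2.
exists (maxn JA JB) => j; rewrite geq_max => /andP[/hA[PA hPA] /hB[PB hPB]].
exists [pred i | PA i && ~~ PB i]; rewrite -punionD//.
have fYA := fmsetY fA (fP PA); have fYB := fmsetY fB (fP PB).
apply: (@le_lt_trans _ _ (mr ((A `+` punion (@I j) PA) `|` (B `+` punion (@I j) PB)))).
  apply: mr_le; last 2 first.
  - exact: fmsetU.
  - move=> x; rewrite /setY/setU/setD/mkset/=.
    by case: (pselect (B x)); case: (pselect (punion (@I j) PB x));
      case: (pselect (A x)); case: (pselect (punion (@I j) PA x)); tauto.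
  have fAB := fmsetD fA (fmset_meas fB).
  exact: fmset_meas (fmsetY fAB (fmsetD (fP PA) (fmset_meas (fP PB)))).
by apply: le_lt_trans (mr_leU fYA fYB) _; lra.
Qed.

Lemma approximableU A B : fmset m A -> fmset m B ->
  approximable A -> approximable B -> approximable (A `|` B).
Proof.
move=> fA fB aA aB eta eta0; have eta2 : 0 < eta / 2 by rewrite divr_gt0.
have [JA hA] := aA _ eta2; have [JB hB] := aB _ eta2.
exists (maxn JA JB) => j; rewrite geq_max => /andP[/hA[PA hPA] /hB[PB hPB]].
exists [pred i | PA i || PB i]; rewrite -punionU//.
have fYA := fmsetY fA (fP PA); have fYB := fmsetY fB (fP PB).
apply: (@le_lt_trans _ _ (mr ((A `+` punion (@I j) PA) `|` (B `+` punion (@I j) PB)))).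
  apply: mr_le; last 2 first.
  - exact: fmsetU.
  - by move=> x; rewrite /setY/setU/setD/mkset/=; tauto.
  exact: fmset_meas (fmsetY (fmsetU fA fB) (fmsetU (fP PA) (fP PB))).
by apply: le_lt_trans (mr_leU fYA fYB) _; lra.
Qed.

Lemma approximable_bigcup_nd (F : (set X)^nat) : (forall k, fmset m (F k)) ->
  (forall k, F k `<=` F k.+1) -> fmset m (\bigcup_k F k) ->
  (forall k, approximable (F k)) -> approximable (\bigcup_k F k).
Proof.
move=> fF ndF fU aF eta eta0; have eta2 : 0 < eta / 2 by rewrite divr_gt0.
have [N /(_ N (leqnn N)) hN] :=
  mr_bigcup_lim (fun k => fmset_meas (fF k)) ndF fU eta2.
have [J hJ] := aF N _ eta2; exists J => j /hJ[P hP]; exists P.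
apply: le_lt_trans (mrY_tri fU (fF N) (fP P)) _.
have -> : (\bigcup_k F k) `+` F N = (\bigcup_k F k) `\` F N.
  apply/seteqP; split=> x; last by left.
  by move=> [//|[FN nU]]; exfalso; apply: nU; exists N.
rewrite mrD//; first lra.
  exact: fmset_meas (fF N).
by move=> x Fx; exists N.
Qed.

Lemma approximable_bigcup (F : (set X)^nat) : (forall k, fmset m (F k)) ->
  fmset m (\bigcup_k F k) -> (forall k, approximable (F k)) ->
  approximable (\bigcup_k F k).
Proof.
move=> fF fU aF.
pose U k := \big[setU/set0]_(i < k) F i.
have fUk k : fmset m (U k).
  by apply: big_ind => //; [exact: fmset0|move=> A B; exact: fmsetU].
have aU k : approximable (U k).
  elim: k => [|k IHk]; rewrite /U ?big_ord0 ?big_ord_recr/=.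
    exact: approximable0.
  exact: (approximableU (fUk k) (fF k) IHk (aF k)).
have E : \bigcup_k F k = \bigcup_k U k.
  apply/seteqP; split=> x [k _ Fx].
    by exists k.+1 => //; rewrite /U big_ord_recr/=; right.
  move: Fx; rewrite /U; elim: k => [|k IHk]; first by rewrite big_ord0.
  by rewrite big_ord_recr/= => -[/IHk|Fk]//; exists k.
rewrite E in fU *; apply: approximable_bigcup_nd => // k.
by rewrite {2}/U big_ord_recr/= => x; left.
Qed.

Lemma approximable_dynkin d' (Y : measurableType d') (G : set (set Y))
    (h : X -> Y) (F : set X) : measurable_fun setT h ->
  @measurable _ Y = <<s G >> -> setI_closed G -> fmset m F -> approximable F ->
  (forall Z, G Z -> approximable (F `&` h @^-1` Z)) ->
  forall Z, measurable Z -> approximable (F `&` h @^-1` Z).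
Proof.
move=> mh GE GI fF aF aG Z mZ.
have mhZ W : measurable W -> measurable (h @^-1` W).
  by move=> mW; rewrite -[X in measurable X]setTI; exact: mh.
have : <<s G >> Z by rewrite -GE.
apply: (dynkin_induction (P := fun Z => approximable (F `&` h @^-1` Z)) GE GI).
- by rewrite preimage_setT setIT.
- exact: aG.
- move=> W mW aW; rewrite (_ : _ `&` _ = F `\` (F `&` h @^-1` W)).
    by apply: approximableD => //; apply: fmsetIl => //; exact: mhZ.
  apply/seteqP; split=> x /= [Fx h1]; split=> //; first by move=> [].
  by move=> h2; apply: h1.
- move=> W mW _ aW; rewrite preimage_bigcup setI_bigcupr.
  apply: approximable_bigcup => //.
    by move=> k; apply: fmsetIl => //; exact: mhZ.
  rewrite -setI_bigcupr; apply: fmsetIl => //.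
  by apply: bigcup_measurable => k _; exact: mhZ.
Qed.

End approximability.

(** A countable intersection of generic properties can prescribe the approximation of countably many
    sets only; this says that they suffice, for every sequence of systems of pieces. *)
Definition test_family {d} {X : measurableType d} {R : realType}
    (m : {measure set X -> \bar R}) (C : (set X)^nat) :=
  forall (Q : nat -> finType) (I : forall j, Q j -> set X),
    (forall j x, fmset m (@I j x)) -> (forall j, disjoint_family (@I j)) ->
    (forall l, approximable m I (C l)) ->
    forall A, fmset m A -> approximable m I A.

Section approximable_real.
Context {d} {X : measurableType d} {R : realType}.
Variable m : {sigma_finite_measure set X -> \bar R}.
Variables (f : X -> R) (g : R -> X).
Hypothesis mf : measurable_fun setT f.
Hypothesis mg : measurable_fun setT g.
Hypothesis fK : cancel f g.

(** The exhausting sets and their intersections with rational rays of [f] serve: real rays are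
    countable unions of rational ones, Dynkin's lemma reaches all Borel sets, and every measurable
    set is the preimage under [f] of a Borel set because [g] is a measurable left inverse. *)
Lemma countable_test_family : exists C : (set X)^nat,
  (forall l, fmset m (C l)) /\ test_family m C.
Proof.
have [F [fF ndF FT _]] := exhaustion m.
have mray y : measurable [set x | y < f x].
  rewrite (_ : mkset _ = setT `&` f @^-1` `]y, +oo[%classic); first exact: mf.
  by apply/seteqP; split=> x /=; rewrite in_itv/= andbT => // -[].
pose C l := match @unpickle (nat * option rat)%type l with
  | Some (k, Some r) => F k `&` [set x | ratr r < f x]
  | Some (k, None) => F k | None => set0 end.
exists C; split.
  move=> l; rewrite /C; case: (unpickle l) => [[k [r|]]|] //; last exact: fmset0.
  exact: fmsetIl.
move=> Q I fI dI aC A fA.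
have aF k : approximable m I (F k).
  by have := aC (pickle (k, @None rat)); rewrite /C pickleK.
have aFZ k Z : measurable Z -> approximable m I (F k `&` f @^-1` Z).
  apply: (approximable_dynkin fI dI mf (RGenOInfty.measurableE R) _ (fF k) (aF k)).
    move=> _ _ [x ->] [y ->]; exists (Num.max x y).
    by apply/seteqP; split=> z /=; rewrite !in_itv/= !andbT gt_max => /andP.
  move=> _ [y ->].
  have -> : F k `&` f @^-1` `]y, +oo[%classic =
      \bigcup_i (if @unpickle rat i is Some r then
        (if y < ratr r then F k `&` [set x | ratr r < f x] else set0) else set0).
    apply/seteqP; split=> x.
      move=> [Fx /=]; rewrite in_itv/= andbT => yx.
      have [r] := rat_in_itvoo yx; rewrite in_itv/= => /andP[yr rx].
      by exists (pickle r); [exact: Logic.I|rewrite pickleK yr; split].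
    move=> [i _]; case: (unpickle i) => // r; case: ifP => // yr [Fx /= rx].
    by split=> //=; rewrite in_itv/= andbT; exact: lt_trans rx.
  apply: approximable_bigcup => //.
  - move=> i; case: (unpickle i) => [r|]; last exact: fmset0.
    by case: ifP => _; [exact: fmsetIl|exact: fmset0].
  - apply: (fmset_sub _ (fF k)).
      apply: bigcup_measurable => i _; case: (unpickle i) => // r.
      by case: ifP => // _; apply: measurableI => //; exact: fmset_meas (fF k).
    by move=> x [i _]; case: (unpickle i) => // r; case: ifP => // _ [].
  - move=> i; case: (unpickle i) => [r|]; last exact: approximable0.
    case: ifP => _; last exact: approximable0.
    by have := aC (pickle (k, Some r)); rewrite /C pickleK.
have AE : A = f @^-1` (g @^-1` A) by apply/seteqP; split=> x /=; rewrite fK.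
have mgA : measurable (g @^-1` A).
  by rewrite -[X in measurable X]setTI; apply: mg => //; exact: fmset_meas fA.
have E : A = \bigcup_k (F k `&` A) by rewrite -setI_bigcupl FT setTI.
rewrite E; apply: approximable_bigcup => //.
- by move=> k; apply: fmsetIl => //; exact: fmset_meas fA.
- by rewrite -E.
- by move=> k; rewrite AE; exact: aFZ.
Qed.

End approximable_real.

(** * Products of powers *)

Section boxes.
Context {d} {X : measurableType d} {R : realType}.
Variable m : {sigma_finite_measure set X -> \bar R}.
Variable D : nat.
Local Notation mr := (rmeasure m).
Local Notation mD := (tuple_measure m D).
Implicit Types A B : 'I_D -> set X.

Definition box A : set (D.-tuple X) := [set t | forall i, A i (tnth t i)].

Lemma measurable_box A : (forall i, measurable (A i)) -> measurable (box A).
Proof.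
move=> mA; rewrite (_ : box A =
    \bigcap_(i in setT) (@tnth D X ^~ i) @^-1` (A i)).
  apply: fin_bigcap_measurable => [|i _]; first exact: finite_finset.
  by rewrite -[X in measurable X]setTI; exact: measurable_tnth.
by apply/seteqP; split => t /= h i; [move=> _|]; exact: h.
Qed.

Lemma box_measure A : (forall i, fmset m (A i)) ->
  mD (box A) = (\prod_(i < D) mr (A i))%:E.
Proof.
move=> fA; rewrite tuple_measure_box; last by move=> i; exact: fmset_meas (fA i).
by rewrite -prodEFin; apply: eq_bigr => i _; exact: mrE.
Qed.

Lemma fmset_box A : (forall i, fmset m (A i)) -> fmset mD (box A).
Proof.
move=> fA; split; first by apply: measurable_box => i; exact: fmset_meas (fA i).
apply: le_lt_trans (ltry (\prod_(i < D) mr (A i))).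
by rewrite le_eqVlt; apply/orP; left; apply/eqP; exact: box_measure.
Qed.

Lemma mr_box A : (forall i, fmset m (A i)) ->
  rmeasure mD (box A) = \prod_(i < D) mr (A i).
Proof.
by move=> fA; apply: EFin_inj; rewrite -mrE; [exact: box_measure|exact: fmset_box].
Qed.

Lemma boxI A B : box A `&` box B = box (fun i => A i `&` B i).
Proof.
apply/seteqP; split=> t /=; first by move=> [h1 h2] i; split.
by move=> h; split=> i; have [] := h i.
Qed.

Lemma measurable_tuple_boxes : @measurable _ (D.-tuple X) =
  <<s [set box A | A in [set A | forall i, measurable (A i)]] >>.
Proof.
apply/seteqP; split; last first.
  apply: smallest_sub; first exact: sigma_algebra_measurable.
  by move=> _ [A mA <-]; exact: measurable_box.
apply: smallest_sub; first exact: smallest_sigma_algebra.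
move=> Z; elim/big_rec: _ => [[]|i W _ IHW]; case; last exact: IHW.
move=> [A mA <-]; rewrite setTI; apply: sub_sigma_algebra.
exists (fun k => if k == i then A else setT).
  by move=> k /=; case: eqP.
apply/seteqP; split=> t /=.
  by move=> /(_ i); rewrite /box/= eqxx.
by move=> h k; case: eqP => // ->.
Qed.

Lemma boxes_setI_closed :
  setI_closed [set box A | A in [set A | forall i, measurable (A i)]].
Proof.
move=> _ _ [A mA <-] [B mB <-]; rewrite boxI; exists (fun i => A i `&` B i) => //.
by move=> i; apply: measurableI; [exact: mA|exact: mB].
Qed.

End boxes.

(** The factors are exchanged one at a time while the others are bounded by [M]. *)
Lemma prod_dist {R : realType} n (a b : 'I_n -> R) (M : R) :
  (forall i, 0 <= a i <= M) -> (forall i, 0 <= b i <= M) ->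
  `|\prod_(i < n) a i - \prod_(i < n) b i| <= M ^+ n.-1 * \sum_(i < n) `|a i - b i|.
Proof.
elim: n a b => [|n IHn] a b ha hb; first by rewrite !big_ord0 subrr normr0 mulr0.
rewrite !big_ord_recl /=.
set P := \prod_(i < n) a _; set P' := \prod_(i < n) b _.
have -> : a ord0 * P - b ord0 * P' = (a ord0 - b ord0) * P + b ord0 * (P - P').
  by ring.
apply: le_trans (ler_normD _ _) _; rewrite !normrM mulrDr; apply: lerD.
  rewrite mulrC; apply: ler_wpM2r => //.
  have P0 : 0 <= P by apply: prodr_ge0 => i _; have /andP[] := ha (lift ord0 i).
  rewrite ger0_norm// (_ : M ^+ n = \prod_(i < n) M); last by rewrite prodr_const card_ord.
  by apply: ler_prod => i _; exact: ha.
have /andP[b0 bM] := hb ord0; rewrite (ger0_norm b0).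
have := IHn (a \o lift ord0) (b \o lift ord0) (fun i => ha _) (fun i => hb _).
rewrite /= -/P -/P' => h; have M0 := le_trans b0 bM.
apply: le_trans (ler_pM b0 (normr_ge0 _) bM h) _.
(* When no factor is left, [M * M ^+ n.-1] differs from [M ^+ n], but the sum is empty. *)
case: n IHn a b ha hb P P' b0 bM h => [|n] *; first by rewrite !big_ord0 !mulr0.
by rewrite mulrA -exprS.
Qed.

Section multipower.
Context {d} {X : measurableType d} {R : realType}.
Variable m : {sigma_finite_measure set X -> \bar R}.
Variable D : nat.
Hypothesis D0 : (0 < D)%N.
Local Notation mr := (rmeasure m).
Local Notation mD := (tuple_measure m D).
Variables (T : mpt m) (kappa : D.-tuple int).
Variables (Q : nat -> finType) (I : forall j, Q j -> set X).
Variables (e w : nat -> R) (n : nat -> nat).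
Hypotheses (fI : forall j x, fmset m (@I j x)) (Ie : forall j x, mr (@I j x) = e j).
Hypotheses (dI : forall j, disjoint_family (@I j)) (e0 : forall j, 0 < e j).
Hypotheses (Q0 : forall j, (0 < #|Q j|)%N) (w0 : forall j, 0 <= w j).
Hypothesis n_ge : forall j, (j < n j)%N.
Hypothesis corr : forall (i : 'I_D) j x y, \sum_(0 <= k < n j)
  `|mr (@I j x `&` iter k (mpt_pow T (tnth kappa i)) @^-1` @I j y) -
    e j / #|Q j|%:R| <= (n j)%:R * w j.
Hypothesis mT0 : m setT != 0%E.
(** The error of a product of [D] correlations, each at most [e j], as [prod_dist] gives it. *)
Let w' j : R := D%:R * e j ^+ D.-1 * w j.
Hypotheses (w1 : forall j, 4 * ((#|Q j|%:R ^+ D) ^+ 2 * w' j) <=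
  (#|Q j|%:R ^+ D * e j ^+ D)^-1 ^+ 2 * j.+1%:R^-1).
Hypotheses (w2 : forall j, (#|Q j|%:R ^+ D) ^+ 2 * w' j <=
  (#|Q j|%:R ^+ D * e j ^+ D)^-1 * j.+1%:R^-1).
Hypothesis approx : forall A, fmset m A -> approximable m I A.

Let QD j : finType := {ffun 'I_D -> Q j}.
Let ID j (f : QD j) : set (D.-tuple X) := box (fun i => @I j (f i)).

Let fID j f : fmset mD (@ID j f). Proof. exact: fmset_box. Qed.

Let dID j : disjoint_family (@ID j).
Proof. by move=> f f' t tf tf'; apply/ffunP => i; exact: dI (tf i) (tf' i). Qed.

(** Each half of the symmetric difference is a difference of two products, since boxes intersect
    coordinatewise. *)
Let mr_boxY A B (M : R) : (forall i, fmset m (A i)) -> (forall i, fmset m (B i)) ->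
  (forall i, mr (A i) <= M) -> (forall i, mr (B i) <= M) ->
  rmeasure mD (box (D := D) A `+` box B) <= 2 * (M ^+ D.-1 * \sum_(i < D) mr (A i `+` B i)).
Proof.
move=> fA fB AM BM.
have fAB i : fmset m (A i `&` B i) by apply: fmsetIl => //; exact: fmset_meas (fB i).
have bA := fmset_box fA; have bB := fmset_box fB.
rewrite mrYE//.
have h1 := mrID bA (fmset_meas bB); have h2 := mrID bB (fmset_meas bA).
rewrite setIC in h2; rewrite boxI !mr_box// in h1 h2.
have leI i : mr (A i `&` B i) <= mr (A i).
  by apply: mr_le => //; exact: fmset_meas (fAB i).
have leI' i : mr (A i `&` B i) <= mr (B i).
  by apply: mr_le => //; exact: fmset_meas (fAB i).
have k1 := @prod_dist R D (fun i => mr (A i)) (fun i => mr (A i `&` B i)) M.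
have k2 := @prod_dist R D (fun i => mr (B i)) (fun i => mr (A i `&` B i)) M.
have M0 : 0 <= M by have := AM (Ordinal D0); exact: le_trans (mr_ge0 _ _).
have {}k1 : \prod_(i < D) mr (A i) - \prod_(i < D) mr (A i `&` B i) <=
    M ^+ D.-1 * \sum_(i < D) mr (A i `+` B i).
  apply: le_trans (ler_norm _) _; apply: le_trans (k1 _ _) _.
  - by move=> i; rewrite mr_ge0/=.
  - by move=> i; rewrite mr_ge0/=; exact: le_trans (leI i) _.
  apply: ler_wpM2l; first exact: exprn_ge0.
  apply: ler_sum => i _; rewrite ger0_norm ?subr_ge0//.
  have := mrYE (fA i) (fB i); have := mrID (fA i) (fmset_meas (fB i)).
  by have := mr_ge0 m (B i `\` A i); lra.
have {}k2 : \prod_(i < D) mr (B i) - \prod_(i < D) mr (A i `&` B i) <=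
    M ^+ D.-1 * \sum_(i < D) mr (A i `+` B i).
  apply: le_trans (ler_norm _) _; apply: le_trans (k2 _ _) _.
  - by move=> i; rewrite mr_ge0/=.
  - by move=> i; rewrite mr_ge0/=; exact: le_trans (leI' i) _.
  apply: ler_wpM2l; first exact: exprn_ge0.
  apply: ler_sum => i _; rewrite ger0_norm ?subr_ge0//.
  have := mrYE (fA i) (fB i); have := mrID (fB i) (fmset_meas (fA i)).
  by rewrite (setIC (B i)); have := mr_ge0 m (A i `\` B i); lra.
rewrite mulrDl mul1r; lra.
Qed.

Let approximable_box A : (forall i, fmset m (A i)) -> approximable mD ID (box A).
Proof.
move=> fA eta eta0.
pose M := 1 + \sum_(i < D) mr (A i).
have M1 : 1 <= M by rewrite lerDl sumr_ge0// => i _; exact: mr_ge0.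
have M0 : 0 < M by exact: lt_le_trans M1.
pose th := Num.min 1 (eta / (2 * (M ^+ D.-1 * D%:R) + 1)).
have c0 : 0 < 2 * (M ^+ D.-1 * D%:R) + 1.
  by rewrite ltr_wpDl// !mulr_ge0// exprn_ge0// ltW.
have th0 : 0 < th by rewrite lt_min ltr01 divr_gt0.
have /choice[J0 hJ0] : forall i, exists J, forall j, (J <= j)%N ->
    exists P : pred (Q j), mr (A i `+` punion (@I j) P) < th.
  by move=> i; exact: approx.
exists (\max_(i < D) J0 i) => j hj.
have /choice[P hP] : forall i : 'I_D, exists P : pred (Q j),
    mr (A i `+` punion (@I j) P) < th.
  by move=> i; apply: hJ0; apply: leq_trans hj; exact: leq_bigmax.
exists (fun f : QD j => [forall i, P i (f i)]).
have -> : punion (@ID j) (fun f => [forall i, P i (f i)]) =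
    box (fun i => punion (@I j) (P i)).
  apply/seteqP; split=> t /=.
    by move=> [f /forallP Pf h] i; exists (f i) => //; exact: h.
  move=> h; have /choice[f hf] : forall i : 'I_D, exists x : Q j,
      P i x /\ @I j x (tnth t i).
    by move=> i; have [x Px Ix] := h i; exists x.
  exists (finfun f); first by apply/forallP => i; rewrite ffunE; have [] := hf i.
  by move=> i; rewrite ffunE; have [] := hf i.
have fB i : fmset m (punion (@I j) (P i)) by exact: fmset_punion.
apply: (le_lt_trans (mr_boxY (M := M) fA fB _ _)).
- move=> i; rewrite /M (bigD1 i)//= addrCA lerDl addr_ge0// sumr_ge0// => k _.
  exact: mr_ge0.
- move=> i; apply: (@le_trans _ _ (1 + mr (A i))).
    have := mr_dist (fA i) (fB i); have := hP i.
    have : th <= 1 by rewrite ge_min lexx.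
    by rewrite ler_norml; lra.
  rewrite lerD2l (bigD1 i)//= lerDl sumr_ge0// => k _; exact: mr_ge0.
have sle : \sum_(i < D) mr (A i `+` punion (@I j) (P i)) <= D%:R * th.
  rewrite (_ : D%:R * th = \sum_(i < D) th); last by rewrite sumr_const card_ord mulr_natl.
  by apply: ler_sum => i _; exact: ltW.
apply: (@le_lt_trans _ _ (2 * (M ^+ D.-1 * (D%:R * th)))).
  by rewrite ler_pM2l// ler_pM2l ?exprn_gt0.
have -> : 2 * (M ^+ D.-1 * (D%:R * th)) = (2 * (M ^+ D.-1 * D%:R)) * th by ring.
apply: (@lt_le_trans _ _ ((2 * (M ^+ D.-1 * D%:R) + 1) * th)).
  by rewrite ltr_pM2r// ltrDl.
by rewrite -ler_pdivlMl// mulrC ge_min lexx orbT.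
Qed.

Let approxD A : fmset mD A -> approximable mD ID A.
Proof.
move=> fA; have [F [fF ndF FT _]] := exhaustion m.
pose FD k : set (D.-tuple X) := box (fun=> F k).
have fFD k : fmset mD (FD k) by exact: fmset_box.
have E : A = \bigcup_k (FD k `&` A).
  apply/seteqP; split=> [t At|t [k _ []]//].
  have /choice[k hk] : forall i : 'I_D, exists k, F k (tnth t i).
    move=> i; have : [set: X] (tnth t i) by [].
    by rewrite -FT => -[k _ Fk]; exists k.
  exists (\max_(i < D) k i) => //; split=> // i.
  exact: (nondecreasing_sets ndF (leq_bigmax i)) (hk i).
rewrite E; apply: approximable_bigcup => //.
- by move=> k; apply: fmsetIl => //; exact: fmset_meas fA.
- by rewrite -E.
move=> k.
have aFD : approximable mD ID (FD k) by exact: approximable_box.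
have := @approximable_dynkin _ _ _ mD QD ID fID dID _ _ _ id (FD k)
  (@measurable_id _ _ setT) (@measurable_tuple_boxes _ X D)
  (@boxes_setI_closed _ X D) (fFD k) aFD.
move=> /(_ _ A (fmset_meas fA)); apply.
move=> _ [B mB <-]; rewrite preimage_id /FD boxI; apply: approximable_box => i.
exact: fmsetIl.
Qed.

Let iter_multipower k A :
  iter k (mpt_multipower T kappa) @^-1` (box (D := D) A) =
  box (fun i => iter k (mpt_pow T (tnth kappa i)) @^-1` A i).
Proof.
suff E t i : tnth (iter k (mpt_multipower T kappa) t) i =
    iter k (mpt_pow T (tnth kappa i)) (tnth t i).
  by apply/seteqP; split=> t /= h i; have := h i; rewrite /= E.
by elim: k => //= k IHk; rewrite tnth_mktuple IHk.
Qed.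

(** Boxes of pieces are the pieces of the product space. Their correlations factor over the
    coordinates, and all coordinates share the stage time [n j]. *)
Lemma multipower_srwm : subsequence_rationally_weakly_mixing (mpt_multipower T kappa).
Proof.
have cardQD j : #|QD j|%:R = #|Q j|%:R ^+ D :> R by rewrite card_ffun card_ord natrX.
apply: (srwm_criterion (m := mD) (Q := QD) (I := ID) (e := fun j => e j ^+ D)
  (w := w') (n := n)) => //.
- by move=> j f; rewrite mr_box// (eq_bigr (fun=> e j))// prodr_const card_ord.
- by move=> j; exact: exprn_gt0.
- by move=> j; rewrite card_ffun card_ord expn_gt0 Q0.
- by move=> j; rewrite !mulr_ge0 ?exprn_ge0// ltW.
- move=> j f f'.
  have fV i x k : fmset m (iter k (mpt_pow T (tnth kappa i)) @^-1` @I j x).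
    exact: fmset_iter.
  apply: (@le_trans _ _ (\sum_(0 <= k < n j) (e j ^+ D.-1 * \sum_(i < D)
    `|mr (@I j (f i) `&` iter k (mpt_pow T (tnth kappa i)) @^-1` @I j (f' i)) -
      e j / #|Q j|%:R|))).
    apply: ler_sum => k _; rewrite iter_multipower boxI mr_box; last first.
      by move=> i; apply: fmsetIl => //; exact: fmset_meas (fV _ _ _).
    have -> : e j ^+ D / #|QD j|%:R = \prod_(i < D) (e j / #|Q j|%:R).
      by rewrite prodr_const card_ord cardQD expr_div_n.
    apply: prod_dist => i.
      rewrite mr_ge0/= -(Ie (f i)); apply: mr_le => //.
      exact: fmset_meas (fmsetIl (fI _) (fmset_meas (fV _ _ _))).
    apply/andP; split; first by apply: divr_ge0 => //; exact: ltW.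
    by rewrite ler_pdivrMr ?ltr0n// ler_peMr// ?ler1n//; exact: ltW.
  rewrite -mulr_sumr exchange_big /= /w' [leRHS](_ : _ =
    e j ^+ D.-1 * \sum_(i < D) ((n j)%:R * w j)); last first.
    by rewrite sumr_const card_ord -mulr_natl; ring.
  by apply: ler_wpM2l; [rewrite exprn_ge0// ltW|apply: ler_sum => i _; exact: corr].
- by move=> j; rewrite cardQD.
- by move=> j; rewrite cardQD.
- by move=> A eta fA; exact: approxD.
have [F [fF _ _ hF]] := exhaustion m.
have [N hN] := hF _ measurableT mT0; have := hN N (leqnn N); rewrite setTI => FN.
apply/eqP => mDT; have fB : fmset mD (box (fun=> F N)) by exact: fmset_box.
have : rmeasure mD (box (fun=> F N)) = 0.
  apply: (mr_null_sub (fmset_meas fB) _ (@subsetT _ _)).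
    by split=> //; rewrite [X in (X < _)%E]mDT.
  by rewrite /rmeasure [X in fine X]mDT.
rewrite mr_box//; apply/eqP; apply/prodf_neq0 => i _.
by rewrite gt_eqF.
Qed.

End multipower.

(** * Genericity in the weak topology *)

Lemma finite_pos_lb {R : realType} (L : finType) (f : L -> R) :
  (forall l, 0 < f l) -> exists2 eta, 0 < eta & forall l, eta <= f l.
Proof.
move=> f0; have key (s : seq L) : exists2 eta, 0 < eta & forall l, l \in s -> eta <= f l.
  elim: s => [|l s [eta eta0 h]]; first by exists 1.
  exists (Num.min (f l) eta); first by rewrite lt_min f0 eta0.
  move=> k; rewrite inE => /orP[/eqP ->|/h ek]; first by rewrite ge_min lexx.
  by rewrite ge_min ek orbT.
have [eta eta0 h] := key (enum L); exists eta => // l; apply: h.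
by rewrite mem_enum.
Qed.

Section weak_topology_category.
Context {d} {X : measurableType d} {R : realType}.
Variable m : {measure set X -> \bar R}.
Local Notation mr := (rmeasure m).
Implicit Types (S T : mpt m) (Phi : mpt m -> Prop).

(* The interior of [Phi] is dense in the weak topology. *)
Definition generic_open Phi := forall S (L : finType) (A : L -> set X) (eta : R),
  (forall l, fmset m (A l)) -> 0 < eta ->
  exists S1 (L' : finType) (B : L' -> set X) (e : R),
    [/\ forall l, (weak_gap (A l) S S1 < eta%:E)%E,
      forall l, fmset m (B l), 0 < e &
      forall T, (forall l, (weak_gap (B l) S1 T < e%:E)%E) -> Phi T].

(** The union of the basic open sets contained in [Phi]. Unlike [Phi], it is known to be saturated
    for a.e. equality, so it descends to an open set of the quotient. *)
Let core Phi : set (mpt m) := [set T | exists S1 (L : finType) (B : L -> set X) (e : R),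
  [/\ forall l, fmset m (B l), 0 < e, forall l, (weak_gap (B l) S1 T < e%:E)%E &
    forall T', (forall l, (weak_gap (B l) S1 T' < e%:E)%E) -> Phi T']].

Let weak_subbase_open (S1 : mpt m) A (e : R) : fmset m A -> 0 < e ->
  open [set T | (weak_gap A S1 T < e%:E)%E].
Proof.
move=> [mA Aoo] e0; exists [set weak_subbase (S1, A, e)]; last by rewrite bigcup_set1.
move=> _ ->; have : weak_index (S1, A, e) by [].
exact: (@finI_from1 _ _ (@weak_index _ _ _ m) (@weak_subbase _ _ _ m)).
Qed.

Let open_core Phi : open (core Phi).
Proof.
rewrite openE => T [S1 [L [B [e [fB e0 hT hPhi]]]]].
have : \forall T' \near T, forall l, (weak_gap (B l) S1 T' < e%:E)%E.
  apply: (@filter_forall _ _ (fun l T' => (weak_gap (B l) S1 T' < e%:E)%E)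
    (nbhs T) (nbhs_filter T)) => l.
  by apply: open_nbhs_nbhs; split; [exact: weak_subbase_open|exact: hT].
by apply: filterS => T' h; exists S1, L, B, e.
Qed.

Let core_saturated Phi S T : S = T %[ae m] -> core Phi S -> core Phi T.
Proof.
move=> ST [S1 [L [B [e [fB e0 hS hPhi]]]]]; exists S1, L, B, e; split=> // l.
have mB := fmset_meas (fB l).
apply: le_lt_trans (weak_gap_triangle S1 S T mB) _.
by rewrite (weak_gap_ae_eq mB ST) adde0.
Qed.

Let weak_gap_refl A S : measurable A -> weak_gap A S S = 0%E.
Proof. by move=> mA; apply: weak_gap_ae_eq => //; exact: (ae_eq_refl m setT S). Qed.

Import finmap.

Let dense_core Phi : generic_open Phi -> dense (core Phi).
Proof.
move=> gPhi U [S US] oU.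
move: oU => [D sD UD]; move: US; rewrite -UD => -[B DB BS].
have [F sF FB] : finI_from (@weak_index _ _ _ m) (@weak_subbase _ _ _ m) B := sD _ DB.
have iF (i : F) : weak_index (fsval i) by exact/set_mem/sF/fsvalP.
have gapS (i : F) : (weak_gap (fsval i).1.2 (fsval i).1.1 S < (fsval i).2%:E)%E.
  by move: BS; rewrite -FB => /(_ _ (fsvalP i)).
have nonneg A S0 S' : (0 <= weak_gap A S0 S')%E by rewrite adde_ge0.
(* This is the slack that [S] has in each subbasic condition; moving by less than the smallest slack
   does not leave [B]. *)
pose g (i : F) := (fsval i).2 - fine (weak_gap (fsval i).1.2 (fsval i).1.1 S).
have gapE (i : F) : weak_gap (fsval i).1.2 (fsval i).1.1 S =
    ((fsval i).2 - g i)%:E.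
  rewrite /g subKr fineK// ge0_fin_numE//; exact: lt_trans (gapS i) (ltry _).
have g0 i : 0 < g i.
  by have := gapS i; rewrite gapE lte_fin ltrBlDr ltrDl.
have [eta eta0 etag] := finite_pos_lb g0.
have fA (i : F) : fmset m (fsval i).1.2 by have [] := iF i.
have [S1 [L [C [e [gapS1 fC e0 hPhi]]]]] := gPhi S _ (fun i : F => (fsval i).1.2) eta fA eta0.
exists S1; split.
  exists B; [exact: DB|suff : B S1 by []].
  rewrite -FB => i iF'; pose i' := FSetSub iF'.
  rewrite /weak_subbase /=.
  apply: le_lt_trans (weak_gap_triangle _ S _ (fmset_meas (fA i'))) _.
  rewrite -[weak_gap i.1.2 i.1.1 S]/(weak_gap (fsval i').1.2 (fsval i').1.1 S) gapE.
  apply: (@lt_le_trans _ _ (((fsval i').2 - g i')%:E + eta%:E)).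
    by rewrite lteD2lE//; exact: gapS1 i'.
  by rewrite -EFinD lee_fin; have := etag i'; rewrite /=; lra.
exists S1, L, C, e; split=> // l.
by rewrite weak_gap_refl ?lte_fin//; exact: fmset_meas (fC l).
Qed.

(** The cores of the [Phi k] project to dense open sets, and each point of [A] lies outside one of
    them. *)
Lemma meagre_of_generic_open (P : set (mpt m)) (A : set (MPT m))
    (Phi : nat -> mpt m -> Prop) : A `<=` mpt_class @` P ->
  (forall k, generic_open (Phi k)) ->
  (forall S, P S -> exists k, ~ Phi k S) -> meagre A.
Proof.
move=> AP gPhi PPhi.
have preE k : mpt_class @^-1` (mpt_class @` core (Phi k)) = core (Phi k).
  apply/seteqP; split=> [S [S' cS' /mpt_classP SS']|S cS]; last by exists S.
  exact: core_saturated cS'.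
have oimg k : open (mpt_class @` core (Phi k)).
  by rewrite /open /= /quotient_open preE; exact: open_core.
exists (fun k => ~` (mpt_class @` core (Phi k))) => [k|x /AP[S PS <-]].
  rewrite /nowhere_dense -(closure_id _).1; last exact: open_closedC.
  apply/seteqP; split=> // x; rewrite /interior nbhsE => -[U [oU Ux] UC].
  have [S Sx] : exists S : mpt m, mpt_class S = x.
    by exists (generic_quotient.repr x); rewrite /mpt_class generic_quotient.reprK.
  have [S' [US' cS']] : ((mpt_class @^-1` U) `&` core (Phi k)) !=set0.
    apply: dense_core => //; first by exists S; rewrite /= Sx.
  by apply: (UC _ US'); exists S'.
have [k nPhi] := PPhi _ PS; exists k => // -[S' cS' /mpt_classP SS'].
apply: nPhi; have [S1 [L [B [e [_ _ hS hPhi]]]]] := core_saturated SS' cS'.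
exact: hPhi.
Qed.

End weak_topology_category.

Section perturbations_of_permutations.
Context {d} {X : measurableType d} {R : realType}.
Variable m : {sigma_finite_measure set X -> \bar R}.
Local Notation mr := (rmeasure m).
Hypotheses (dv : divisible m) (sw : swappable m) (mT : m setT = +oo%E).

Definition is_pieces (Q : finType) (I : Q -> set X) (e : R) :=
  [/\ forall x, fmset m (I x), 0 < e, forall x, mr (I x) = e & disjoint_family I].

Let image_close (S S1 : mpt m) (Q : finType) (I : Q -> set X) (s : {perm Q}) A
    (P : pred Q) (th : R) : fmset m A -> (forall x, fmset m (I x)) ->
  mr (A `+` punion I P) < th ->
  mr (S @` A `+` punion I (fun y => P (s^-1%g y))) < th ->
  \sum_i mr (S1 @^-1` I (s i) `+` I i) < th ->
  mr (S @` A `+` S1 @` A) < 3 * th.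
Proof.
move=> fA fI h1 h2 h3.
have fP p : fmset m (punion I p) by exact: fmset_punion.
have fSA (T : mpt m) : fmset m (T @` A) by rewrite image_mpt; exact: fmset_preimage.
apply: le_lt_trans (mrY_tri (fSA S) (fP (fun y => P (s^-1%g y))) (fSA S1)) _.
have E : mr (punion I (fun y => P (s^-1%g y)) `+` S1 @` A) =
    mr (A `+` punion (fun i => S1 @^-1` I (s i)) P).
  rewrite mrYC mr_image_symdiff; [|exact: fmset_meas fA|exact: fmset_meas (fP _)].
  congr (mr (A `+` _)); apply/seteqP; split=> x /= [i Pi Ii].
    by exists (s^-1%g i) => //=; rewrite permKV.
  by exists (s i) => //=; rewrite permK.
have fSI i : fmset m (S1 @^-1` I (s i)) by exact: fmset_preimage.
have fQ := fmset_punion fSI P.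
have := mrY_tri fA (fP P) fQ; rewrite -E.
have := punionY_le P fI fSI.
have : \sum_(i | P i) mr (I i `+` S1 @^-1` I (s i)) <=
    \sum_i mr (S1 @^-1` I (s i) `+` I i).
  rewrite big_mkcond; apply: ler_sum => i _; rewrite mrYC.
  by case: (P i) => //; exact: mr_ge0.
lra.
Qed.

Lemma pieces_near (S : mpt m) (L : finType) (A : L -> set X) (eta : R) :
  (forall l, fmset m (A l)) -> 0 < eta ->
  exists (Q : finType) (I : Q -> set X) (e : R) (s : {perm Q}),
    [/\ is_pieces I e, forall l, exists P : pred Q, mr (A l `+` punion I P) < eta &
      forall S1 : mpt m, \sum_i mr (S1 @^-1` I (s i) `+` I i) < eta / 6 ->
        forall l, (weak_gap (A l) S S1 < eta%:E)%E].
Proof.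
move=> fA eta0; have th0 : 0 < eta / 6 by rewrite divr_gt0.
(* The preimages of [A l] under [S] and [S1] differ by as much as the images, under [S] and [S1], of
   the preimage of [A l] under [S]. Adding these preimages to the family reduces both halves of
   [weak_gap] to images, each contributing less than [3 * (eta / 6)]. *)
pose A2 (p : L * bool) := if p.2 then S @^-1` A p.1 else A p.1.
have fA2 p : fmset m (A2 p) by rewrite /A2; case: p.2 => //; exact: fmset_preimage.
have [Q [I [e [s [fI e0 Ie dI h]]]]] := perm_approx S dv fA2 th0.
exists Q, I, e, s; split=> // [l|S1 hS1 l].
  by have [P [hP _]] := h (l, false); exists P; rewrite /A2/= in hP; lra.
have mA := fmset_meas (fA l).
have [P [h1 h2]] := h (l, false); have [P' [h1' h2']] := h (l, true).
have k1 := image_close (fA2 (l, false)) fI h1 h2 hS1.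
have k2 := image_close (fA2 (l, true)) fI h1' h2' hS1.
rewrite /A2/= in k1 k2.
have fS (T : mpt m) : fmset m (T @` A l) by rewrite image_mpt; exact: fmset_preimage.
have fS' (T : mpt m) : fmset m (T @^-1` A l) by exact: fmset_preimage.
rewrite /weak_gap (mrE (fmsetY (fS S) (fS S1))) (mrE (fmsetY (fS' S) (fS' S1))).
rewrite -EFinD lte_fin.
have E : mr (S @^-1` A l `+` S1 @^-1` A l) =
    mr (S @` (S @^-1` A l) `+` S1 @` (S @^-1` A l)).
  rewrite (_ : S @` (S @^-1` A l) = A l); last first.
    rewrite image_mpt; apply/seteqP; split=> x /=; by rewrite mpt_invK.
  rewrite [RHS]mrYC mr_image_symdiff//; exact: fmset_meas (fS' S).
by rewrite E; lra.
Qed.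

Let refined_close (S1 : mpt m) (Q' : finType) (I' : Q' -> set X) (e e' eta : R)
    (s' : {perm Q'}) (A B : set X) (P : pred Q') :
  is_pieces I' e' -> fmset m A -> fmset m B -> mr A = e -> mr B = e ->
  (forall x, mr (S1 @^-1` I' (s' x) `+` I' x) = 0) ->
  (forall x, P x -> I' x `<=` A /\ I' (s' x) `<=` B) ->
  (1 - eta) * e <= \sum_(x | P x) e' ->
  mr (S1 @^-1` B `+` A) <= 2 * (eta * e).
Proof.
move=> [fI' e'0 Ie' dI'] fA fB Ae Be hS1 hP he.
have fSB := fmset_preimage S1 fB.
have fSI x : fmset m (S1 @^-1` I' (s' x)) by exact: fmset_preimage.
have fII x : fmset m (S1 @^-1` I' (s' x) `&` I' x).
  by apply: fmsetIl => //; exact: fmset_meas (fI' x).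
have IIe x : mr (S1 @^-1` I' (s' x) `&` I' x) = e'.
  have h := mrID (fI' x) (fmset_meas (fSI x)).
  have := mrYE (fSI x) (fI' x); rewrite hS1 -(Ie' x) h setIC.
  have := mr_ge0 m (S1 @^-1` I' (s' x) `\` I' x).
  have := mr_ge0 m (I' x `\` S1 @^-1` I' (s' x)); lra.
have sub : \sum_(x | P x) e' <= mr (S1 @^-1` B `&` A).
  rewrite (eq_bigr (fun x => mr (S1 @^-1` I' (s' x) `&` I' x))); last first.
    by move=> x _; rewrite IIe.
  rewrite -(mr_punion fII); last by move=> x y z [_ zx] [_ zy]; exact: dI' zx zy.
  apply: mr_le.
  - exact: fmset_meas (fmset_punion fII P).
  - by apply: fmsetIl => //; exact: fmset_meas fA.
  - by move=> z [x /hP[IA IB] [z1 z2]]; split; [exact: IB|exact: IA].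
have mSB : mr (S1 @^-1` B) = e by rewrite mr_preimage//; exact: fmset_meas fB.
rewrite mrYE//.
have := mrID fSB (fmset_meas fA); have := mrID fA (fmset_meas fSB).
by rewrite (setIC A); lra.
Qed.

(** The fraction [eta] is fixed only after the pieces, because the errors of all [#|Q|] pieces add
    up. The sets [C] join the sets to be approximated by pieces, so that [Phi] may speak of them. *)
Lemma generic_open_of_perm (Phi : mpt m -> Prop) (Lc : finType) (C : Lc -> set X)
    (th : R) : (forall l, fmset m (C l)) -> 0 < th ->
  (forall (Q : finType) (I : Q -> set X) (e : R) (s : {perm Q}) (eta : R),
    is_pieces I e -> (0 < #|Q|)%N -> 0 < eta ->
    (forall l, exists P : pred Q, mr (C l `+` punion I P) < th) ->
    exists (Q' : finType) (I' : Q' -> set X) (e' : R) (s' : {perm Q'}) (e2 : R),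
    [/\ is_pieces I' e', 0 < e2,
      forall i, exists P : pred Q',
        (forall x, P x -> I' x `<=` I i /\ I' (s' x) `<=` I (s i)) /\
        (1 - eta) * e <= \sum_(x | P x) e' &
      forall T : mpt m, (forall x, mr (T @^-1` I' (s' x) `+` I' x) <= e2) -> Phi T]) ->
  generic_open Phi.
Proof.
move=> fC th0 H S L A eta fA eta0.
(* A set of measure at least 1, approximated to within 1/2, forces the family of pieces to be
   nonempty. *)
have [Z [fZ _ Z1]] := infinite_complement 1 mT (fmset0 m).
pose A3 (o : option (L + Lc)) := match o with
  | Some (inl l) => A l | Some (inr l) => C l | None => Z end.
have fA3 o : fmset m (A3 o) by case: o => [[l|l]|] /=.
pose eta1 := Num.min (Num.min eta th) (2^-1).
have eta10 : 0 < eta1 by rewrite !lt_min eta0 th0 invr_gt0 ltr0n.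
have e1eta : eta1 <= eta by rewrite !ge_min lexx.
have e1th : eta1 <= th by rewrite !ge_min lexx orbT.
have e1h : eta1 <= 2^-1 by rewrite ge_min lexx orbT.
have [Q [I [e [s [pI apx close]]]]] := pieces_near S fA3 eta10.
have [fI e0 Ie dI] := pI.
have Q0 : (0 < #|Q|)%N.
  rewrite lt0n; apply/negP => /eqP cQ.
  have [P hP] := apx None; rewrite /A3 in hP.
  move: hP; rewrite (_ : punion I P = set0) ?setY0; first lra.
  by apply/seteqP; split=> // x [i]; have := fintype0 i cQ.
have q0 : 0 < #|Q|%:R :> R by rewrite ltr0n.
(* By [refined_close], all pieces together contribute [#|Q| * (2 * (eta2 * e)) = eta1 / 12], below
   the bound [eta1 / 6] of [pieces_near]. *)
pose eta2 := eta1 / 24 / (#|Q|%:R * e).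
have eta20 : 0 < eta2 by rewrite !divr_gt0// mulr_gt0.
have apC l : exists P : pred Q, mr (C l `+` punion I P) < th.
  by have [P hP] := apx (Some (inr l)); exists P; exact: lt_le_trans hP e1th.
have [Q' [I' [e' [s' [e2 [pI' e20 hP hPhi]]]]]] := H Q I e s eta2 pI Q0 eta20 apC.
have [fI' e'0 Ie' dI'] := pI'.
have [S1 hS1] := realize_perm s' sw fI' Ie' dI'.
have cl i : mr (S1 @^-1` I (s i) `+` I i) <= 2 * (eta2 * e).
  have [P [P1 P2]] := hP i.
  exact: (refined_close pI' (fI i) (fI (s i)) (Ie i) (Ie (s i)) hS1 P1 P2).
exists S1, Q', I', e2; split=> //.
  move=> l; apply: lt_le_trans (close S1 _ (Some (inl l))) _; last by rewrite lee_fin.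
  apply: (@le_lt_trans _ _ (\sum_(i : Q) 2 * (eta2 * e))).
    by apply: ler_sum => i _; exact: cl.
  rewrite sumr_const -[_ *+ _]mulr_natl.
  have -> : #|Q|%:R * (2 * (eta2 * e)) = eta1 / 12.
    by rewrite /eta2; field; rewrite !gt_eqF.
  lra.
move=> T hT; apply: hPhi => x.
have mI := fmset_meas (fI' (s' x)).
have f1 := fmset_preimage T (fI' (s' x)); have f2 := fmset_preimage S1 (fI' (s' x)).
apply: le_trans (mrY_tri f1 f2 (fI' x)) _; rewrite hS1 addr0.
have fim (U : mpt m) : fmset m (U @` I' (s' x)) by rewrite image_mpt; exact: fmset_preimage.
have := hT (s' x); rewrite /weak_gap (mrE (fmsetY (fim S1) (fim T))) (mrE (fmsetY f2 f1)).
rewrite -EFinD lte_fin => h; rewrite mrYC.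
by have := mr_ge0 m (S1 @` I' (s' x) `+` T @` I' (s' x)); lra.
Qed.

End perturbations_of_permutations.

(** * Mixing along a random walk *)

Section random_walk.
Variables (R : realType) (Q : finType) (s : {perm Q}) (M L : nat).
Hypothesis Q0 : (0 < #|Q|)%N.

(* A letter either prescribes an arbitrary permutation of the sites (this happens
   with probability [1 / M.+1]) or asks to follow [s]. *)
Definition letter := ('I_M.+1 * {perm Q})%type.
Definition word := {ffun 'I_L.+1 -> letter}.
(** This realises the random walk by a deterministic permutation: a state holds a site, a clock and
    a word, and the clock reads the letters cyclically. Under a uniformly distributed word distinct
    letters are independent, so the site performs the walk as long as no letter is read twice. *)
Definition walk_state := (Q * ('I_L.+1 * word))%type.

(** A jump letter carries a permutation and not a target, so that a step is injective; a uniform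
    permutation still sends each site to a uniform one. *)
Definition letter_move (a : letter) : {perm Q} := if a.1 == ord0 then a.2 else s.

Definition walk_step (x : walk_state) : walk_state :=
  (letter_move (x.2.2 x.2.1) x.1, (x.2.1 + inZp 1, x.2.2)).

Lemma walk_step_inj : injective walk_step.
Proof.
move=> [i [t w]] [i' [t' w']] E.
have /= ww' := congr1 (fun x : walk_state => x.2.2) E.
have /= /addIr tt' := congr1 (fun x : walk_state => x.2.1) E.
have /= := congr1 fst E; rewrite ww' tt' => /perm_inj ->.
by [].
Qed.

Definition walk_perm : {perm walk_state} := perm walk_step_inj.

Let upd (w : word) (c : 'I_L.+1) (a : letter) : word :=
  [ffun t => if t == c then a else w t].

Fixpoint walk_path k (i : Q) (t : 'I_L.+1) (w : word) : Q :=
  if k is k'.+1 then letter_move (w (t + inZp k')) (walk_path k' i t w) else i.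

Lemma iter_walk k i t w :
  iter k walk_perm (i, (t, w)) = (walk_path k i t w, (t + inZp k, w)).
Proof.
elim: k => [|k IHk] /=.
  by congr (_, (_, _)); apply/val_inj; rewrite /= mod0n addn0 modn_small.
rewrite IHk permE /walk_step /=; congr (_, (_, _)).
by apply/val_inj; rewrite /= !modnDmr !modnDml -addnA addn1.
Qed.

(** The first [k] steps read only letters that precede position [t + l] in the reading order;
    [l <= L] excludes wrapping around. *)
Let walk_path_upd k l i t w a : (k <= l <= L)%N ->
  walk_path k i t (upd w (t + inZp l) a) = walk_path k i t w.
Proof.
elim: k => //= k IHk /andP[kl lL]; rewrite IHk ?(ltnW kl)// ffunE.
case: eqP => // /addrI /(congr1 val) /=.
by rewrite !modn_small; lia.
Qed.

(** Resampling one letter of a uniform word leaves it uniform: [phi] exchanges the fresh letter with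
    the old one. *)
Let sum_upd (c : 'I_L.+1) (F : word -> R) :
  #|{: letter}|%:R * \sum_w F w = \sum_w \sum_a F (upd w c a).
Proof.
rewrite (pair_big predT predT (fun w a => F (upd w c a))) /=.
pose phi (p : word * letter) := (upd p.1 c p.2, p.1 c).
have phiK : involutive phi.
  move=> [w a]; rewrite /phi /=; congr pair; last by rewrite ffunE eqxx.
  by apply/ffunP => t; rewrite !ffunE; case: eqP => // ->.
rewrite (reindex_inj (inv_inj phiK)) /=.
rewrite (eq_bigr (fun p : word * letter => F p.1)); last first.
  move=> [w a] _ /=; congr F; apply/ffunP => t; rewrite !ffunE.
  by case: eqP => // ->.
rewrite -(pair_big predT predT (fun (w : word) (a : letter) => F w)) /= mulr_sumr.
by apply: eq_bigr => w _; rewrite sumr_const mulr_natl.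
Qed.

Let card_letter : #|{: letter}|%:R = M.+1%:R * #|{perm Q}|%:R :> R.
Proof. by rewrite card_prod card_ord natrM. Qed.

(** Multiplication by a transposition shows that all targets [j] are equally likely. *)
Let perm_count (i j : Q) :
  #|Q|%:R * \sum_(c : {perm Q}) ((c i == j) : nat)%:R = #|{perm Q}|%:R :> R.
Proof.
have same j' : \sum_(c : {perm Q}) ((c i == j') : nat)%:R =
    \sum_(c : {perm Q}) ((c i == j) : nat)%:R :> R.
  rewrite (reindex_inj (mulIg (tperm j j'))); apply: eq_bigr => c _.
  by rewrite permM -{2}(tpermL j j') (inj_eq perm_inj).
rewrite mulr_natl -sumr_const (eq_bigr _ (fun j' _ => esym (same j'))).
rewrite exchange_big /= (eq_bigr (fun=> 1)) ?sumr_const// => c _.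
rewrite (bigD1 (c i))//= eqxx big1 ?addr0// => j'.
by rewrite eq_sym => /negbTE ->.
Qed.

Let letter_count (i j : Q) :
  \sum_(a : letter) ((letter_move a i == j) : nat)%:R =
  #|{: letter}|%:R * (M.+1%:R^-1 * #|Q|%:R^-1 +
    (1 - M.+1%:R^-1) * ((s i == j) : nat)%:R) :> R.
Proof.
rewrite card_letter.
rewrite -(pair_big predT predT (fun a c => ((letter_move (a, c) i == j) : nat)%:R)) /=.
rewrite big_ord_recl /= (eq_bigr (fun c : {perm Q} => ((c i == j) : nat)%:R)); last first.
  by move=> c _; rewrite /letter_move eqxx.
rewrite [X in _ + X](eq_bigr (fun=> #|{perm Q}|%:R * ((s i == j) : nat)%:R)); last first.
  by move=> a _; rewrite mulr_natl -sumr_const; apply: eq_bigr.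
rewrite sumr_const card_ord -[X in _ + X]mulr_natl.
have q0 : #|Q|%:R != 0 :> R by rewrite pnatr_eq0 -lt0n.
have M0 : M.+1%:R != 0 :> R by rewrite pnatr_eq0.
apply: (mulfI q0); rewrite mulrDr perm_count.
by move: M0; rewrite -[M.+1%:R]natr1; move: (M%:R : R) => y y0; field; rewrite q0 y0.
Qed.

Definition walk_prob k i t j : R :=
  (\sum_w ((walk_path k i t w == j) : nat)%:R) / #|{: word}|%:R.

Let word0 : #|{: word}|%:R != 0 :> R.
Proof.
rewrite pnatr_eq0 -lt0n; apply/card_gt0P.
by exists [ffun=> (ord0, 1%g)].
Qed.

Let letter0 : #|{: letter}|%:R != 0 :> R.
Proof. by rewrite pnatr_eq0 -lt0n; apply/card_gt0P; exists (ord0, 1%g). Qed.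

(** The letter of the last step is independent of the path before it, so it may be resampled. *)
Let walk_probS k i t j : (k <= L)%N -> walk_prob k.+1 i t j =
  M.+1%:R^-1 / #|Q|%:R + (1 - M.+1%:R^-1) * walk_prob k i t (s^-1%g j).
Proof.
move=> kL; rewrite /walk_prob; apply: (mulIf word0); rewrite mulrDl divfK// -[X in _ + X]mulrA divfK//.
apply: (mulfI letter0).
rewrite (sum_upd (t + inZp k)) /=.
rewrite (eq_bigr (fun w => #|{: letter}|%:R * (M.+1%:R^-1 * #|Q|%:R^-1 +
    (1 - M.+1%:R^-1) * ((walk_path k i t w == s^-1%g j) : nat)%:R))); last first.
  move=> w _; rewrite -(can2_eq (permK s) (permKV s)) -letter_count.
  apply: eq_bigr => a _; rewrite walk_path_upd ?leqnn// ffunE eqxx//.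
rewrite -mulr_sumr big_split/= sumr_const -mulr_sumr; congr (_ * (_ + _)).
by rewrite mulr_natr.
Qed.

Lemma walk_prob_mixing k i t j : (k <= L.+1)%N ->
  `|walk_prob k i t j - #|Q|%:R^-1| <= (1 - M.+1%:R^-1) ^+ k.
Proof.
have q1 : #|Q|%:R^-1 <= 1 :> R by rewrite invf_le1 ?ltr0n// ler1n.
have q0 : 0 <= #|Q|%:R^-1 :> R by [].
elim: k j => [|k IHk] j kL.
  rewrite /walk_prob /= sumr_const -[_ *+ _]mulr_natr mulfK//.
  rewrite expr0 ler_norml; move: q0 q1; set u := _^-1 => u0 u1.
  by case: eqP => _ /=; lra.
rewrite walk_probS// exprS.
have M1 : 0 <= 1 - M.+1%:R^-1 :> R by rewrite subr_ge0 invf_le1 ?ltr0n// ler1n.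
have -> : M.+1%:R^-1 / #|Q|%:R + (1 - M.+1%:R^-1) * walk_prob k i t (s^-1%g j) -
    #|Q|%:R^-1 = (1 - M.+1%:R^-1) * (walk_prob k i t (s^-1%g j) - #|Q|%:R^-1) by ring.
by rewrite normrM (ger0_norm M1) ler_wpM2l// IHk// ltnW.
Qed.

(** This fraction of the words obeys [s] at clock [t], which bounds the size of the perturbation. *)
Lemma walk_follow_count t :
  \sum_(w : word) (((w t).1 != ord0) : nat)%:R =
  (1 - M.+1%:R^-1) * #|{: word}|%:R :> R.
Proof.
apply: (mulfI letter0); rewrite (sum_upd t).
rewrite (eq_bigr (fun=> #|{: letter}|%:R * (1 - M.+1%:R^-1))); last first.
  move=> w _; rewrite (eq_bigr (fun a : letter => ((a.1 != ord0) : nat)%:R)); last first.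
    by move=> a _; rewrite ffunE eqxx.
  rewrite card_letter.
  rewrite -(pair_big predT predT (fun (a : 'I_M.+1) (c : {perm Q}) => ((a != ord0) : nat)%:R)) /=.
  rewrite big_ord_recl /= sumr_const mul0rn add0r.
  rewrite (eq_bigr (fun=> #|{perm Q}|%:R)); last by move=> a _; rewrite sumr_const.
  rewrite sumr_const card_ord -[LHS]mulr_natl.
  have M0 : M.+1%:R != 0 :> R by rewrite pnatr_eq0.
  by move: M0; rewrite -[M.+1%:R]natr1; move: (M%:R : R) => y y0; field.
by rewrite sumr_const -[LHS]mulr_natr mulrA.
Qed.

End random_walk.

Section powers.
Context {d} {X : measurableType d} {R : realType}.
Variable m : {measure set X -> \bar R}.
Implicit Type T : mpt m.

Lemma mpt_pow_pos T (a : nat) x : mpt_pow T (Posz a) x = iter a T x.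
Proof. by rewrite /mpt_pow; elim: a => //= a ->. Qed.

Lemma mpt_pow_neg T (a : nat) x : mpt_pow T (Negz a) x = iter a.+1 (mpt_inverse T) x.
Proof. by rewrite /mpt_pow; elim: a => //= a ->. Qed.

Lemma iter_mpt_pow T (a : nat) k A :
  iter k (mpt_pow T (Posz a)) @^-1` A = iter (k * a) T @^-1` A.
Proof.
suff E x : iter k (mpt_pow T (Posz a)) x = iter (k * a) T x.
  by apply/seteqP; split=> x /=; rewrite E.
by rewrite iterM; apply: eq_iter => y; exact: mpt_pow_pos.
Qed.

Lemma mr_iter_mpt_pow_neg T (a : nat) k A B : measurable A -> measurable B ->
  rmeasure m (A `&` iter k (mpt_pow T (Negz a)) @^-1` B) =
  rmeasure m (B `&` iter (k * a.+1) T @^-1` A).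
Proof.
move=> mA mB; rewrite -[RHS]mr_iter_inverse//; congr (rmeasure m (A `&` _)).
suff E x : iter k (mpt_pow T (Negz a)) x = iter (k * a.+1) (mpt_inverse T) x.
  by apply/seteqP; split=> x /=; rewrite E.
by rewrite iterM; apply: eq_iter => y; exact: mpt_pow_neg.
Qed.

End powers.

Section walk_correlations.
Context {d} {X : measurableType d} {R : realType}.
Variable m : {sigma_finite_measure set X -> \bar R}.
Local Notation mr := (rmeasure m).
Variables (Q : finType) (I : Q -> set X) (e : R) (s : {perm Q}) (M L : nat).
Hypotheses (pI : is_pieces m I e) (Q0 : (0 < #|Q|)%N).
Local Notation K := ('I_L.+1 * word Q M L)%type.
Variables (I' : Q * K -> set X) (e' e2 : R).
Hypotheses (pI' : is_pieces m I' e') (I'I : forall i k, I' (i, k) `<=` I i).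
Hypotheses (Ke : #|{: K}|%:R * e' = e) (e20 : 0 <= e2).
Variable T : mpt m.
Hypothesis hT : forall x, mr (T @^-1` I' (walk_perm s M L x) `+` I' x) <= e2.

Let arrivals k i j : R :=
  \sum_(x : K) (((iter k (walk_perm s M L) (i, x)).1 == j) : nat)%:R.

Let arrivals_lb k i j :
  e' * arrivals k i j - #|{: K}|%:R * (e2 *+ k) <= mr (I i `&` iter k T @^-1` I j).
Proof.
have [fI e0 Ie dI] := pI; have [fI' e'0 Ie' dI'] := pI'.
pose W := walk_perm s M L.
have fV A : fmset m A -> fmset m (iter k T @^-1` A) by exact: fmset_iter.
pose B (x : K) := I' (i, x) `&` iter k T @^-1` I j.
have fB x : fmset m (B x) by apply: fmsetIl => //; exact: fmset_meas (fV _ (fI j)).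
have ek0 : 0 <= e2 *+ k by rewrite mulrn_wge0.
apply: (@le_trans _ _ (\sum_(x : K) mr (B x))); last first.
  rewrite -(mr_punion fB); last by move=> x y z [zx _] [zy _]; exact: (congr1 snd (dI' _ _ _ zx zy)).
  apply: mr_le.
  - exact: fmset_meas (fmset_punion fB _).
  - by apply: fmsetIl => //; exact: fmset_meas (fV _ (fI j)).
  - by move=> z [x _ [zx zj]]; split=> //; exact: I'I zx.
rewrite /arrivals mulr_sumr lerBlDr.
rewrite mulr_natl -sumr_const -big_split/=; apply: ler_sum => x _.
case: eqP => [E|_]; last by rewrite mulr0 addr_ge0 ?mr_ge0.
rewrite mulr1.
have h : mr (iter k T @^-1` I' (iter k W (i, x)) `+` I' (i, x)) <= e2 *+ k.
  exact: mr_iter_pieces.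
have f1 := fV _ (fI' (iter k W (i, x))).
have sub : I' (i, x) `&` iter k T @^-1` I' (iter k W (i, x)) `<=` B x.
  move=> z [zx zk]; split=> //=; rewrite -E.
  by move: zk => /=; rewrite [iter k W _]surjective_pairing; exact: I'I.
have := mr_le (fmset_meas (fmsetIl (fI' _) (fmset_meas f1))) (fB x) sub.
have := mrID (fI' (i, x)) (fmset_meas f1).
have := mrYE f1 (fI' (i, x)).
rewrite Ie'; have := mr_ge0 m (iter k T @^-1` I' (iter k W (i, x)) `\` I' (i, x)).
lra.
Qed.

Let sum_arrivals k i : \sum_j arrivals k i j = #|{: K}|%:R.
Proof.
rewrite exchange_big /= (eq_bigr (fun=> 1)) ?sumr_const// => x _.
rewrite (bigD1 (iter k (walk_perm s M L) (i, x)).1)//= eqxx big1 ?addr0// => j.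
by rewrite eq_sym => /negbTE ->.
Qed.

(** The parts of [I i] that go to the various targets have total measure at most [e]; hence the
    lower bounds for the other targets give the upper bound for [j]. *)
Let arrivals_ub k i j : mr (I i `&` iter k T @^-1` I j) <=
  e' * arrivals k i j + #|Q|%:R * (#|{: K}|%:R * (e2 *+ k)).
Proof.
have [fI e0 Ie dI] := pI; have [fI' e'0 Ie' dI'] := pI'.
have fV A : fmset m A -> fmset m (iter k T @^-1` A) by exact: fmset_iter.
have fB j' : fmset m (I i `&` iter k T @^-1` I j').
  by apply: fmsetIl => //; exact: fmset_meas (fV _ (fI j')).
have tot : \sum_j' mr (I i `&` iter k T @^-1` I j') <= e.
  rewrite -(mr_punion fB); last by move=> x y z [_ zx] [_ zy]; exact: dI zx zy.
  rewrite -(Ie i); apply: mr_le => //; first exact: fmset_meas (fmset_punion fB _).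
  by move=> z [j' _ []].
rewrite (bigD1 j)//= in tot.
have := sum_arrivals k i; rewrite (bigD1 j)//= => sa.
set err := #|{: K}|%:R * (e2 *+ k).
have err0 : 0 <= err by rewrite mulr_ge0// mulrn_wge0.
have low : e' * \sum_(j' | j' != j) arrivals k i j' - #|Q|%:R * err <=
    \sum_(j' | j' != j) mr (I i `&` iter k T @^-1` I j').
  apply: (@le_trans _ _ (\sum_(j' | j' != j) (e' * arrivals k i j' - err))); last first.
    by apply: ler_sum => j' _; exact: arrivals_lb.
  rewrite big_split/= -mulr_sumr sumrN lerD2l lerN2 sumr_const -[err *+ _]mulr_natl.
  by rewrite ler_wpM2r// ler_nat max_card.
have E : e' * arrivals k i j + e' * \sum_(j' | j' != j) arrivals k i j' = e.
  by rewrite -mulrDr sa mulrC.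
lra.
Qed.

(** Summing [walk_prob] over the clock counts the arrivals, whence the first term; the second is the
    accumulated deviation of [T] from the permutation. *)
Lemma walk_correlations k i j : (k <= L.+1)%N ->
  `|mr (I i `&` iter k T @^-1` I j) - e / #|Q|%:R| <=
  e * (1 - M.+1%:R^-1) ^+ k + #|Q|%:R * (#|{: K}|%:R * (e2 *+ k)).
Proof.
move=> kL; have [fI e0 Ie dI] := pI.
have q1 : 1 <= #|Q|%:R :> R by rewrite ler1n.
set err := #|{: K}|%:R * (e2 *+ k).
have err0 : 0 <= err by rewrite mulr_ge0// mulrn_wge0.
have aE : arrivals k i j =
    #|{: word Q M L}|%:R * \sum_(t < L.+1) walk_prob R s M k i t j.
  rewrite /arrivals mulr_sumr (eq_bigr (fun x : K =>
    (((iter k (walk_perm s M L) (i, (x.1, x.2))).1 == j) : nat)%:R)); last by move=> [].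
  rewrite -(pair_big predT predT (fun t (w : word Q M L) =>
    (((iter k (walk_perm s M L) (i, (t, w))).1 == j) : nat)%:R)) /=.
  apply: eq_bigr => t _; rewrite /walk_prob mulrC divfK; last first.
    by rewrite pnatr_eq0 -lt0n; apply/card_gt0P; exists [ffun=> (ord0, 1%g)].
  by apply: eq_bigr => w _; rewrite iter_walk.
have mid : `|e' * arrivals k i j - e / #|Q|%:R| <= e * (1 - M.+1%:R^-1) ^+ k.
  have -> : e' * arrivals k i j - e / #|Q|%:R =
      e' * #|{: word Q M L}|%:R * \sum_(t < L.+1) (walk_prob R s M k i t j - #|Q|%:R^-1).
    rewrite aE sumrB sumr_const card_ord -[#|Q|%:R^-1 *+ _]mulr_natl mulrBr mulrA -Ke.
    by rewrite card_prod card_ord natrM; ring.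
  have e'0 : 0 < e' by have [] := pI'.
  rewrite normrM ger0_norm; last by rewrite mulr_ge0// ltW.
  have -> : e * (1 - M.+1%:R^-1) ^+ k = e' * #|{: word Q M L}|%:R *
      \sum_(t < L.+1) (1 - M.+1%:R^-1) ^+ k.
    by rewrite sumr_const card_ord -[_ *+ L.+1]mulr_natl -Ke card_prod card_ord natrM; ring.
  apply: ler_wpM2l; first by rewrite mulr_ge0// ltW.
  apply: le_trans (ler_norm_sum _ _ _) _; apply: ler_sum => t _.
  exact: walk_prob_mixing.
have := arrivals_lb k i j; have := arrivals_ub k i j; rewrite -/err => ub lb.
have qerr : err <= #|Q|%:R * err by rewrite ler_peMl.
by move: mid; rewrite !ler_norml; lra.
Qed.

End walk_correlations.

Lemma sum_geometric_le {R : realType} (M n : nat) :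
  \sum_(0 <= k < n) (1 - M.+1%:R^-1) ^+ k <= M.+1%:R :> R.
Proof.
have M0 : M.+1%:R != 0 :> R by rewrite pnatr_eq0.
have r0 : 0 <= 1 - M.+1%:R^-1 :> R by rewrite subr_ge0 invf_le1 ?ltr0n// ler1n.
suff -> : \sum_(0 <= k < n) (1 - M.+1%:R^-1) ^+ k =
    M.+1%:R * (1 - (1 - M.+1%:R^-1) ^+ n) :> R.
  by rewrite ler_piMr// lerBlDr lerDl exprn_ge0.
elim: n => [|n IHn]; first by rewrite big_nil subrr mulr0.
rewrite big_nat_recr//= IHn exprS mulrBl mul1r !mulrBr.
by rewrite mulrA mulfV//; ring.
Qed.

Section mixing_stages.
Context {d} {X : measurableType d} {R : realType}.
Variable m : {sigma_finite_measure set X -> \bar R}.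
Local Notation mr := (rmeasure m).

(** The last clause collects the smallness conditions of [multipower_srwm] for all [D <= J];
    together with the bound on [kappa] it lets one stage serve all products of at most [J] powers
    with exponents up to [J]. *)
Definition mixing_pieces (C : (set X)^nat) (J : nat) (T : mpt m)
    (Q : finType) (I : Q -> set X) (e w : R) (n : nat) :=
  [/\ is_pieces m I e /\ (0 < #|Q|)%N, 0 <= w /\ (J < n)%N,
    forall l, (l <= J)%N -> exists P : pred Q, mr (C l `+` punion I P) < J.+1%:R^-1,
    forall kappa : int, kappa != 0 -> (`|kappa| <= J)%N -> forall x y,
      \sum_(0 <= k < n) `|mr (I x `&` iter k (mpt_pow T kappa) @^-1` I y) -
        e / #|Q|%:R| <= n%:R * w &
    forall D, (0 < D <= J)%N ->
      4 * ((#|Q|%:R ^+ D) ^+ 2 * (D%:R * e ^+ D.-1 * w)) <=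
        (#|Q|%:R ^+ D * e ^+ D)^-1 ^+ 2 * J.+1%:R^-1 /\
      (#|Q|%:R ^+ D) ^+ 2 * (D%:R * e ^+ D.-1 * w) <=
        (#|Q|%:R ^+ D * e ^+ D)^-1 * J.+1%:R^-1].

Definition mixing_stage C J T := exists (Q : finType) (I : Q -> set X) e w n,
  mixing_pieces C J T I e w n.

Let small_w (q e : R) (J : nat) : 0 < q -> 0 < e -> exists2 w : R, 0 < w &
  forall D, (0 < D <= J)%N ->
      4 * ((q ^+ D) ^+ 2 * (D%:R * e ^+ D.-1 * w)) <= (q ^+ D * e ^+ D)^-1 ^+ 2 * J.+1%:R^-1 /\
      (q ^+ D) ^+ 2 * (D%:R * e ^+ D.-1 * w) <= (q ^+ D * e ^+ D)^-1 * J.+1%:R^-1.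
Proof.
move=> q0 e0.
pose b D := (q ^+ D * e ^+ D)^-1.
pose a D : R := (q ^+ D) ^+ 2 * (D%:R * e ^+ D.-1).
have b0 D : 0 < b D by rewrite invr_gt0 mulr_gt0// exprn_gt0.
have a0 D : 0 <= a D by rewrite mulr_ge0 ?exprn_ge0 ?mulr_ge0 ?exprn_ge0// ltW.
have J0 : 0 < J.+1%:R^-1 :> R by rewrite invr_gt0 ltr0n.
pose f (D : 'I_J.+1) := Num.min (b D ^+ 2 * J.+1%:R^-1) (b D * J.+1%:R^-1) / (4 * a D + 1).
have d0 D : 0 < 4 * a D + 1 by rewrite ltr_pwDr// mulr_ge0.
have f0 D : 0 < f D.
  by rewrite divr_gt0// lt_min !mulr_gt0//= exprn_gt0.
have [w w0 wf] := finite_pos_lb f0; exists w => // D /andP[_ DJ].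
have DJ' : (D < J.+1)%N by [].
have := wf (Ordinal DJ'); rewrite /f /= ler_pdivlMr//.
have aw : (q ^+ D) ^+ 2 * (D%:R * e ^+ D.-1 * w) = a D * w by rewrite /a; ring.
have aw0 : 0 <= a D * w by rewrite mulr_ge0// ltW.
rewrite aw le_min -/(b D) => /andP[].
by move: (b D ^+ 2 * _) (b D * _) => K1 K2 h1 h2; split; lra.
Qed.

Lemma generic_open_mixing_stage C J : divisible m -> swappable m ->
  m setT = +oo%E -> (forall l, fmset m (C l)) -> generic_open (mixing_stage C J).
Proof.
move=> dv sw mT fC.
have J0 : 0 < J.+1%:R^-1 :> R by rewrite invr_gt0 ltr0n.
apply: (generic_open_of_perm dv sw mT (C := fun l : 'I_J.+1 => C l) _ J0) => //.
move=> Q I e s eta pI Q0 eta0 tests; have [fI e0 Ie dI] := pI.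
have q0 : 0 < #|Q|%:R :> R by rewrite ltr0n.
have [w w0 hw] := small_w J q0 e0.
(* The jump probability [M.+1%:R^-1] must not exceed the permitted fraction [eta]. *)
pose M := Num.trunc eta^-1.
have hM : M.+1%:R^-1 <= eta.
  rewrite invf_ple ?posrE ?ltr0n//; apply: ltW.
  exact: (truncnS_gt eta^-1).
(* The mixing errors of the walk sum to at most [e * M.+1%:R] over any time; [n] is so large that on
   average they are below [w / 2]. The other half of [w] is left for the deviation of [T]. *)
pose n := (J + (Num.trunc (2 * (e * M.+1%:R) / w)).+1)%N.
have nJ : (J < n)%N by rewrite /n addnS ltnS leq_addr.
have hn : e * M.+1%:R <= n%:R * (w / 2).
  have h : 2 * (e * M.+1%:R) / w <= n%:R.
    apply: le_trans (ltW (truncnS_gt _)) _.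
    by rewrite ler_nat /n leq_addl.
  by move: h; rewrite ler_pdivrMr//; lra.
(* A power of exponent at most [J] makes at most [J * n] steps up to time [n], so no letter is read
   twice. *)
pose L := (J * n)%N.
pose K : finType := ('I_L.+1 * word Q M L)%type.
have K0 : (0 < #|K|)%N by apply/card_gt0P; exists (ord0, [ffun=> (ord0, 1%g)]).
have k0 : 0 < #|K|%:R :> R by rewrite ltr0n.
pose e' := e / #|K|%:R.
have e'0 : 0 < e' by rewrite divr_gt0.
have Ke : #|K|%:R * e' = e by rewrite /e' mulrC divfK// gt_eqF.
have sub i : exists F : K -> set X, [/\ forall k, fmset m (F k),
    forall k, F k `<=` I i, forall k, mr (F k) = e' & disjoint_family F].
  apply: subdivide => //; first exact: ltW.
  by rewrite Ie -[e' *+ _]mulr_natl Ke.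
have /choice[F hF] := sub.
pose I' (x : Q * K) := F x.1 x.2.
have I'I i k : I' (i, k) `<=` I i by have [_ h _ _] := hF i; exact: h.
have pI' : is_pieces m I' e'.
  split=> //.
  - by move=> [i k]; have [h _ _ _] := hF i; exact: h.
  - by move=> [i k]; have [_ _ h _] := hF i; exact: h.
  - move=> [i k] [i' k'] z zi zi'.
    have ii' : i = i' by apply: (dI _ _ z); [exact: I'I zi|exact: I'I zi'].
    rewrite -ii' in zi' *; congr pair; have [_ _ _ h] := hF i; exact: (h _ _ z zi zi').
(* With this closeness the deviation after at most [L] steps, summed over all subpieces and targets,
   stays below [w / 2]. *)
pose e2 := w / 2 / (#|Q|%:R * #|K|%:R * L.+1%:R).
have e20 : 0 < e2 by rewrite !divr_gt0// !mulr_gt0// ltr0n.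
exists (Q * K)%type, I', e', (walk_perm s M L), e2; split=> //.
- move=> i; exists (fun x : walk_state Q M L => (x.1 == i) && ((x.2.2 x.2.1).1 != ord0)); split.
    move=> [j [t v]] /andP[/eqP /= -> h]; split; first exact: I'I.
    by rewrite permE /walk_step /= /letter_move (negbTE h); exact: I'I.
  rewrite big_mkcond /=.
  rewrite -(pair_big predT predT (fun j (k : K) =>
    if (j == i) && ((k.2 k.1).1 != ord0) then e' else 0)) /=.
  rewrite (bigD1 i)//= [X in _ <= _ + X]big1 ?addr0; last first.
    by move=> j /negbTE ->; rewrite big1.
  rewrite -(pair_big predT predT (fun t (v : word Q M L) =>
    if (i == i) && ((v t).1 != ord0) then e' else 0)) /= eqxx /=.
  rewrite (eq_bigr (fun=> e' * ((1 - M.+1%:R^-1) * #|{: word Q M L}|%:R))); last first.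
    move=> t _; rewrite -(walk_follow_count R Q M t) mulr_sumr; apply: eq_bigr => v _.
    by case: (_ != _); rewrite ?mulr1 ?mulr0.
  rewrite sumr_const card_ord -[_ *+ L.+1]mulr_natl.
  have -> : L.+1%:R * (e' * ((1 - M.+1%:R^-1) * #|{: word Q M L}|%:R)) =
      (1 - M.+1%:R^-1) * e.
    by rewrite -Ke card_prod card_ord natrM; ring.
  by rewrite ler_pM2r// lerD2l lerN2.
move=> T hT; exists Q, I, e, w, n; split=> //; first by split=> //; exact: ltW.
- by move=> l lJ; have [P hP] := tests (Ordinal (lJ : (l < J.+1)%N)); exists P.
have key (a : nat) x y : (0 < a <= J)%N ->
    \sum_(0 <= k < n) `|mr (I x `&` iter (k * a) T @^-1` I y) - e / #|Q|%:R| <= n%:R * w.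
  move=> /andP[a0 aJ].
  apply: (@le_trans _ _ (\sum_(0 <= k < n) (e * (1 - M.+1%:R^-1) ^+ k + w / 2))).
    apply: ler_sum_nat => k /andP[_ kn].
    have kaL : (k * a <= L)%N by rewrite /L mulnC leq_mul// ltnW.
    apply: le_trans (walk_correlations pI Q0 pI' I'I Ke (ltW e20) hT _ _ (leqW kaL)) _.
    have r1 : 1 - M.+1%:R^-1 <= 1 :> R by rewrite lerBlDr lerDl invr_ge0 ler0n.
    have r0 : 0 <= 1 - M.+1%:R^-1 :> R by rewrite subr_ge0 invf_le1 ?ltr0n// ler1n.
    apply: lerD.
      by rewrite ler_pM2l//; apply: ler_wiXn2l => //; exact: leq_pmulr.
    have -> : w / 2 = #|Q|%:R * (#|K|%:R * (L.+1%:R * e2)).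
      by rewrite /e2; field; rewrite !gt_eqF// ltr0n.
    do 2 (apply: ler_wpM2l; first exact: ltW).
    rewrite -(mulr_natl e2); apply: ler_wpM2r; first exact: ltW.
    rewrite ler_nat.
    exact: leqW.
  rewrite big_split/= sumr_const_nat subn0 -mulr_sumr -[_ *+ n]mulr_natl.
  have := sum_geometric_le (R := R) M n.
  by rewrite -(ler_pM2l e0); lra.
move=> [a|a] k0' kJ x y.
  under eq_bigr do rewrite iter_mpt_pow.
  by apply: key; rewrite kJ andbT lt0n.
(* A negative power is treated as a positive one with the roles of the two pieces exchanged. *)
rewrite (eq_bigr (fun k => `|mr (I y `&` iter (k * a.+1) T @^-1` I x) - e / #|Q|%:R|)).
  exact: key.
by move=> k _; rewrite mr_iter_mpt_pow_neg//; exact: fmset_meas (fI _).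
Qed.

Lemma power_srwm_of_mixing_stages C (T : mpt m) : m setT = +oo%E ->
  test_family m C ->
  (forall J, mixing_stage C J T) -> power_subsequence_rationally_weakly_mixing T.
Proof.
move=> mT hC stages D kappa D0 k0.
have mT0 : m setT != 0%E by rewrite mT.
(* From stage [J0] on, [D] and the exponents in [kappa] are within the range that a stage
   controls. *)
pose J0 := maxn D (\max_(i < D) `|tnth kappa i|%N).
have /choice[S hS] : forall j, exists
    s : {Q : finType & ((Q -> set X) * (R * R * nat))%type},
    mixing_pieces C (J0 + j) T (tagged s).1 (tagged s).2.1.1 (tagged s).2.1.2 (tagged s).2.2.
  by move=> j; have [Q [I [e [w [n h]]]]] := stages (J0 + j)%N;
    exists (Tagged (fun Q : finType => ((Q -> set X) * (R * R * nat))%type) (I, (e, w, n))).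
have DJ j : (0 < D <= J0 + j)%N.
  by rewrite D0 (leq_trans _ (leq_addr _ _))// leq_maxl.
have inv_le j : (J0 + j).+1%:R^-1 <= j.+1%:R^-1 :> R.
  by rewrite lef_pV2 ?posrE ?ltr0n// ler_nat ltnS leq_addl.
have fI j x : fmset m ((tagged (S j)).1 x) by have [[[h _ _ _] _] _ _ _ _] := hS j.
have dI j : disjoint_family (tagged (S j)).1 by have [[[_ _ _ h] _] _ _ _ _] := hS j.
have e0 j : 0 < (tagged (S j)).2.1.1 by have [[[_ h _ _] _] _ _ _ _] := hS j.
have q0 j : (0 < #|tag (S j)|)%N by have [[_ h] _ _ _ _] := hS j.
have b0 j : 0 < (#|tag (S j)|%:R ^+ D * (tagged (S j)).2.1.1 ^+ D)^-1 :> R.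
  by rewrite invr_gt0 mulr_gt0// exprn_gt0// ltr0n.
apply: (@multipower_srwm _ _ _ m D D0 T kappa (fun j => tag (S j)) (fun j => (tagged (S j)).1)
  (fun j => (tagged (S j)).2.1.1) (fun j => (tagged (S j)).2.1.2)
  (fun j => (tagged (S j)).2.2)) => //.
- by move=> j x; have [[[_ _ h _] _] _ _ _ _] := hS j.
- by move=> j; have [_ [h _] _ _ _] := hS j.
- move=> j; have [_ [_ h] _ _ _] := hS j.
  by apply: leq_trans h; rewrite ltnS leq_addl.
- move=> i j x y; have [_ _ _ h _] := hS j; apply: h => //.
  apply: leq_trans (leq_addr _ _); rewrite leq_max; apply/orP; right.
  exact: (leq_bigmax i).
- move=> j; have [_ _ _ _ /(_ D (DJ j))[h _]] := hS j.
  by apply: le_trans h _; apply: ler_wpM2l => //; rewrite exprn_ge0// ltW.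
- move=> j; have [_ _ _ _ /(_ D (DJ j))[_ h]] := hS j.
  by apply: le_trans h _; apply: ler_wpM2l => //; rewrite ltW.
- apply: hC => // l eta eta0; exists (maxn l (Num.trunc eta^-1)) => j.
  rewrite geq_max => /andP[lj ej]; have [_ _ h _ _] := hS j.
  have [P hP] := h l (leq_trans lj (leq_addl _ _)); exists P.
  apply: lt_le_trans hP _; apply: le_trans (inv_le j) _.
  rewrite invf_ple ?posrE ?ltr0n//; apply: ltW; apply: lt_le_trans (truncnS_gt _) _.
  by rewrite ler_nat.
Qed.

End mixing_stages.

(** * Slow excursions *)

Section sums_over_blocks.
Context {R : realType}.
Implicit Type f : nat -> R.

Lemma sum_periodic f N V : (forall k, f (k + V)%N = f k) ->
  \sum_(0 <= k < N * V) f k = N%:R * \sum_(0 <= k < V) f k.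
Proof.
move=> fV; rewrite big_nat_mul (eq_bigr (fun=> \sum_(0 <= k < V) f k)).
  by rewrite sumr_const_nat subn0 mulr_natl.
move=> i _; rewrite -{1}[(i * V)%N]add0n big_addn mulSn addnK.
apply: eq_bigr => k _; elim: i => [|i IHi]; first by rewrite mul0n addn0.
by rewrite mulSn addnCA [(V + _)%N]addnC fV.
Qed.

Lemma sum_multiples_le f V N : (0 < N)%N -> (forall k, 0 <= f k) ->
  \sum_(0 <= k < V) f (k * N)%N <= \sum_(0 <= k < V * N) f k.
Proof.
move=> N0 f0; rewrite big_nat_mul; apply: ler_sum => k _.
have kN : (k * N < k.+1 * N)%N by rewrite ltn_pmul2r.
by rewrite big_ltn// lerDl sumr_ge0.
Qed.

End sums_over_blocks.

Section slow_permutation.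
Variables (Q : finType) (s : {perm Q}) (p W : nat).

(** Each piece is cut into [p.+1] columns. Column [ord0] keeps its level forever and merely follows
    [s]; the others climb one level per step around a cycle of length [W.+1], of which only the
    lowest levels will lie in the original pieces. *)
Definition slow_state := (Q * ('I_p.+1 * 'I_W.+1))%type.

Definition slow_step (x : slow_state) : slow_state :=
  (s x.1, (x.2.1, if x.2.1 == ord0 then x.2.2 else x.2.2 + inZp 1)).

Lemma slow_step_inj : injective slow_step.
Proof.
move=> [i [a t]] [i' [a' t']] [/perm_inj -> ->].
by case: (a' == ord0) => [->|/addIr ->].
Qed.

Definition slow_perm : {perm slow_state} := perm slow_step_inj.

Lemma iter_slow k i a t : iter k slow_perm (i, (a, t)) =
  (iter k s i, (a, if a == ord0 then t else t + inZp k)).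
Proof.
elim: k => [|k IHk] /=.
  congr (_, (_, _)); case: (a == ord0) => //.
  by apply/val_inj; rewrite /= mod0n addn0 modn_small.
rewrite IHk permE /slow_step /=; congr (_, (_, _)); case: (a == ord0) => //.
by apply/val_inj; rewrite /= !modnDmr !modnDml -addnA addn1.
Qed.

Lemma sum_slow_state {R : realType} (f : slow_state -> R) (P : pred Q)
    (A : pred 'I_p.+1) (B : pred 'I_W.+1) :
  \sum_(x | [&& P x.1, A x.2.1 & B x.2.2]) f x =
  \sum_(i | P i) \sum_(a | A a) \sum_(t | B t) f (i, (a, t)).
Proof.
rewrite (eq_bigr (fun i => \sum_(y | A y.1 && B y.2) f (i, (y.1, y.2)))).
  rewrite (pair_big P (fun y : 'I_p.+1 * 'I_W.+1 => A y.1 && B y.2)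
    (fun i y => f (i, (y.1, y.2)))) /=.
  by apply: eq_bigr => -[i [a t]].
by move=> i _; rewrite (pair_big A B (fun a t => f (i, (a, t)))).
Qed.

(** During one turn a climbing point meets each level exactly once, and [s] only permutes the sites.
    With [M] starting levels and [N] turns, each state of the columns in [A] is therefore counted
    [N * M] times. *)
Lemma slow_occupation {R : realType} (g : slow_state -> R) (A : pred 'I_p.+1) (M N : nat) :
  (M <= W.+1)%N -> (forall a, A a -> a != ord0) ->
  \sum_(0 <= k < N * W.+1) \sum_(x : slow_state | A x.2.1 && (x.2.2 < M)%N) g (iter k slow_perm x) =
  (N * M)%:R * \sum_(x : slow_state | A x.2.1) g x.
Proof.
move=> MW A0.
pose h t := \sum_i \sum_(a | A a) g (i, (a, t)).
have sumh : \sum_t h t = \sum_(x : slow_state | A x.2.1) g x.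
  have := sum_slow_state g predT A predT; rewrite /= => E.
  rewrite (eq_bigl (fun x : slow_state => A x.2.1 && true)); last by move=> x; rewrite andbT.
  rewrite E /h exchange_big /=; apply: eq_bigr => i _; rewrite exchange_big.
  by [].
have E k : \sum_(x : slow_state | A x.2.1 && (x.2.2 < M)%N) g (iter k slow_perm x) =
    \sum_(t : 'I_W.+1 | (t < M)%N) h (t + inZp k).
  have := sum_slow_state (fun x => g (iter k slow_perm x)) predT A
    (fun t : 'I_W.+1 => (t < M)%N).
  rewrite /= => ->.
  under eq_bigr do rewrite exchange_big.
  rewrite exchange_big /=; apply: eq_bigr => t _; rewrite /h.
  rewrite [RHS](reindex_inj (@perm_inj _ (s ^+ k)%g)); apply: eq_bigr => i _.
  by apply: eq_bigr => a /A0 /negbTE a0; rewrite iter_slow a0 permX.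
under eq_bigr do rewrite E.
rewrite exchange_big /= (eq_bigr (fun=> N%:R * \sum_t h t)); last first.
  move=> t _; rewrite sum_periodic.
    congr (_ * _); rewrite big_mkord [RHS](reindex_inj (@addrI _ t)).
    apply: eq_bigr => k _; congr (h (_ + _)); apply/val_inj => /=.
    by rewrite modn_small.
  by move=> k; congr (h (_ + _)); apply/val_inj; rewrite /= modnDr.
rewrite sumr_const -sumh -mulrnAl -mulrnA; congr (_ *+ (N * _) * _).
rewrite -sum1_card -(big_ord_widen _ (fun=> 1%N) MW).
by rewrite sum1_card card_ord.
Qed.

End slow_permutation.

Section slow_stages.
Context {d} {X : measurableType d} {R : realType}.
Variable m : {sigma_finite_measure set X -> \bar R}.
Local Notation mr := (rmeasure m).

(* The set [D] carries all but a small fraction of every union of pieces, but its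
   points visit a set [F] of finite measure only rarely up to time [n], compared
   to the points of [F]. *)
Definition slow_pieces (C : (set X)^nat) (p J : nat) (T : mpt m)
    (Q : finType) (I : Q -> set X) (e : R) (D : set X) (n : nat) (c : R) :=
  [/\ [/\ is_pieces m I e, (J < n)%N, fmset m D & 0 < c],
    forall l, (l <= J)%N -> exists P : pred Q, mr (C l `+` punion I P) < J.+1%:R^-1,
    forall P, mr (punion I P `\` D) <= mr (punion I P) / p.+1%:R,
    forall F, fmset m F ->
      \sum_(0 <= k < n) mr (D `&` iter k T @^-1` F) <= c * (mr F + 1) &
    forall F P, fmset m F ->
      J.+1%:R * c * (mr (punion I P) / p.+1%:R - 2 * mr (punion I P `\` F) - J.+1%:R^-1)
        <= \sum_(0 <= k < n) mr (F `&` iter k T @^-1` F)].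

Definition slow_stage C p J T := exists (Q : finType) (I : Q -> set X) e D n c,
  slow_pieces C p J T I e D n c.

Section slow_perm_pieces.
Variables (Q : finType) (I : Q -> set X) (e : R) (s : {perm Q}) (p M0 W J : nat).
Hypotheses (pI : is_pieces m I e) (MW : (M0 < W)%N).
Local Notation S := (slow_state Q p W).
Variables (I' : S -> set X) (e' e2 : R).
Hypotheses (pI' : is_pieces m I' e').
Hypothesis I'I : forall i a (t : 'I_W.+1), (t < M0.+1)%N -> I' (i, (a, t)) `<=` I i.
Hypotheses (Me : (p.+1 * M0.+1)%:R * e' = e) (e20 : 0 <= e2).
Variable T : mpt m.
Hypothesis hT : forall x, mr (T @^-1` I' (slow_perm s p W x) `+` I' x) <= e2.
Variable N : nat.
Hypotheses (N0 : (0 < N)%N) (sN : forall i, iter N s i = i).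
Let n := (N * W.+1)%N.
Let c : R := (N * M0.+1)%:R.
Hypotheses (NW : (J.+1 * (N * M0.+1) <= W.+1)%N)
  (e2n : #|{: S}|%:R * (n * n)%:R * e2 <= J.+1%:R^-1).

Let fI' x : fmset m (I' x). Proof. by have [h _ _ _] := pI'. Qed.
Let Ie' x : mr (I' x) = e'. Proof. by have [_ _ h _] := pI'. Qed.
Let dI' : disjoint_family I'. Proof. by have [_ _ _ h] := pI'. Qed.
Let e'0 : 0 < e'. Proof. by have [_ h _ _] := pI'. Qed.

Let V (A : pred 'I_p.+1) (P : pred Q) :=
  punion I' (fun x => [&& P x.1, A x.2.1 & (x.2.2 < M0.+1)%N]).

Let mr_V A P : mr (V A P) = (#|A| * M0.+1)%:R * e' *+ #|P|.
Proof.
rewrite /V mr_punion// (eq_bigr (fun=> e')); last by move=> x _; rewrite Ie'.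
rewrite (sum_slow_state (fun=> e') P A (fun t : 'I_W.+1 => (t < M0.+1)%N)).
rewrite sumr_const; congr (_ *+ _); rewrite sumr_const natrM -mulrA mulr_natl.
congr (_ *+ _); rewrite sumr_const mulr_natl; congr (_ *+ _).
have MW' : (M0.+1 <= W.+1)%N by exact: ltnW.
by rewrite -sum1_card -(big_ord_widen _ (fun=> 1%N) MW') sum1_card card_ord.
Qed.

Let V_sub A P : V A P `<=` punion I P.
Proof. by move=> z [[i [a t]] /= /and3P[Pi _ tM] Iz]; exists i => //; exact: I'I Iz. Qed.

Let fV A P : fmset m (V A P). Proof. exact: fmset_punion. Qed.

Let mr_P P : mr (punion I P) = e *+ #|P|.
Proof.
have [fI _ Ie dI] := pI.
by rewrite mr_punion// (eq_bigr (fun=> e)) ?sumr_const// => x _; rewrite Ie.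
Qed.

Let mr_rigid P : mr (V (pred1 ord0) P) = mr (punion I P) / p.+1%:R.
Proof.
rewrite mr_V mr_P -Me card1 mul1n natrM [(_ *+ #|P|) / _]mulrnAl; congr (_ *+ _).
by rewrite -[p.+1%:R * _ * _]mulrA [RHS]mulrC mulKf ?pnatr_eq0.
Qed.

Let D := V (predC1 ord0) predT.

Let mr_compl_D P : mr (punion I P `\` D) <= mr (punion I P) / p.+1%:R.
Proof.
have [fI _ _ _] := pI.
have fP := fmset_punion fI P.
have fD : fmset m D := fV _ _.
have h := mrID fP (fmset_meas fD).
have : mr (V (predC1 ord0) P) <= mr (punion I P `&` D).
  apply: mr_le; first exact: fmset_meas (fV _ _).
    exact: fmsetIl (fmset_meas fD).
  move=> z Vz; split; first exact: V_sub Vz.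
  by case: Vz => x /and3P[_ A tM] Iz; exists x => //; apply/and3P.
have -> : mr (V (predC1 ord0) P) = mr (punion I P) * (1 - p.+1%:R^-1).
  rewrite mr_V mr_P -Me cardC1 card_ord /= [(_ *+ #|P|) * _]mulrnAl; congr (_ *+ _).
  have p0 : p.+1%:R != 0 :> R by rewrite pnatr_eq0.
  by move: p0; rewrite !natrM -[p.+1%:R]natr1; move: (p%:R : R) => y y0; field.
by rewrite mulrBr mulr1; move: (mr (punion I P) / _) h => u; lra.
Qed.

Let orbit_close k x : (k <= n)%N ->
  mr (iter k T @^-1` I' (iter k (slow_perm s p W) x) `+` I' x) <= n%:R * e2.
Proof.
move=> kn; apply: le_trans (mr_iter_pieces k x fI' hT) _.
by rewrite -[e2 *+ k]mulr_natl ler_wpM2r// ler_nat.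
Qed.

Let transported F k x : fmset m F -> (k <= n)%N ->
  mr (I' x `&` iter k T @^-1` F) <=
    mr (I' (iter k (slow_perm s p W) x) `&` F) + n%:R * e2.
Proof.
move=> fF kn; set y := iter k _ x.
have f1 : fmset m (iter k T @^-1` I' y) by exact: fmset_iter.
have f2 : fmset m (iter k T @^-1` F) by exact: fmset_iter.
have f0 : fmset m (I' y `&` F) by apply: fmsetIl => //; exact: fmset_meas fF.
have f3 := fmset_iter T k f0.
have f4 : fmset m (iter k T @^-1` I' y `+` I' x) by exact: fmsetY.
rewrite -(mr_iter T k (fmset_meas f0)).
apply: (@le_trans _ _ (mr (iter k T @^-1` (I' y `&` F) `|` (iter k T @^-1` I' y `+` I' x)))).
  apply: mr_le; [|exact: fmsetU|].
    by apply: fmset_meas; apply: fmsetIl => //; exact: fmset_meas f2.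
  move=> z [Ix Fz]; have [Iy|nIy] := pselect ((iter k T @^-1` I' y) z); first by left.
  by right; right.
by apply: le_trans (mr_leU f3 f4) _; rewrite lerD2l orbit_close.
Qed.

Let errE : #|{: S}|%:R * (n%:R * e2) *+ n <= J.+1%:R^-1.
Proof. by apply: le_trans e2n; rewrite -mulr_natr [leLHS](_ : _ = #|{: S}|%:R * (n * n)%:R * e2)// natrM; ring. Qed.

Let c1 : 1 <= c. Proof. by rewrite /c ler1n muln_gt0 N0. Qed.

Let J1 : J.+1%:R^-1 <= 1 :> R. Proof. by rewrite invf_le1 ?ltr0n// ler1n. Qed.

(** The added 1 absorbs the deviation of [T] from the permutation over all [n] steps. *)
Let visits_D F : fmset m F ->
  \sum_(0 <= k < n) mr (D `&` iter k T @^-1` F) <= c * (mr F + 1).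
Proof.
move=> fF; pose A : pred 'I_p.+1 := predC1 ord0.
pose B (x : S) := A x.2.1 && (x.2.2 < M0.+1)%N.
pose g x := mr (I' x `&` F).
have step k : (k <= n)%N -> mr (D `&` iter k T @^-1` F) <=
    \sum_(x | B x) g (iter k (slow_perm s p W) x) + #|{: S}|%:R * (n%:R * e2).
  move=> kn.
  have fk x : fmset m (I' x `&` iter k T @^-1` F).
    by apply: fmsetIl => //; exact: fmset_meas (fmset_iter _ _ fF).
  have -> : D `&` iter k T @^-1` F = punion (fun x => I' x `&` iter k T @^-1` F) B.
    apply/seteqP; split=> z; first by move=> [[x /= Bx Ix] Fz]; exists x.
    by move=> [x Bx [Ix Fz]]; split=> //; exists x.
  rewrite mr_punion//; last by move=> x y z [zx _] [zy _]; exact: dI' zx zy.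
  apply: (@le_trans _ _ (\sum_(x | B x) (g (iter k (slow_perm s p W) x) + n%:R * e2))).
    by apply: ler_sum => x _; exact: transported.
  rewrite big_split/= lerD2l sumr_const -[n%:R * e2 *+ _]mulr_natl.
  by rewrite ler_wpM2r ?mulr_ge0// ler_nat max_card.
apply: (@le_trans _ _ (\sum_(0 <= k < n) (\sum_(x | B x) g (iter k (slow_perm s p W) x) +
    #|{: S}|%:R * (n%:R * e2)))).
  by apply: ler_sum_nat => k /andP[_ kn]; apply: step; exact: ltnW.
rewrite big_split/= sumr_const_nat subn0 slow_occupation//; last exact: ltnW.
rewrite -/c mulrDr mulr1; apply: lerD; last first.
  by apply: le_trans errE _; exact: le_trans J1 c1.
rewrite ler_pM2l; last exact: lt_le_trans ltr01 c1.
have fg x : fmset m (I' x `&` F) by apply: fmsetIl => //; exact: fmset_meas fF.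
rewrite /g -(mr_punion fg); last by move=> x y z [zx _] [zy _]; exact: dI' zx zy.
apply: mr_le => //; first exact: fmset_meas (fmset_punion fg _).
by move=> z [x _ []].
Qed.

(** The rigid part [E] of the pieces in [P] returns to itself at every multiple of [N]; passing from
    [E] to [F] loses the part outside [F] at both ends, hence the factor 2. *)
Let visits_F F P : fmset m F ->
  J.+1%:R * c * (mr (punion I P) / p.+1%:R - 2 * mr (punion I P `\` F) - J.+1%:R^-1)
    <= \sum_(0 <= k < n) mr (F `&` iter k T @^-1` F).
Proof.
move=> fF; have [fI _ _ _] := pI; have fP := fmset_punion fI P.
have mF := fmset_meas fF.
set b := (X in _ * X <= _).
have fk k : fmset m (iter k T @^-1` F) by exact: fmset_iter.
have [b0|b0] := lerP b 0.
  apply: (@le_trans _ _ 0); last by apply: sumr_ge0 => k _; exact: mr_ge0.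
  by rewrite mulr_ge0_le0// mulr_ge0// (le_trans _ c1).
pose E := V (pred1 ord0) P; have fE : fmset m E := fV _ _.
have fEF : fmset m (E `\` F) by exact: fmsetD.
have EF : mr (E `\` F) <= mr (punion I P `\` F).
  apply: mr_le; [exact: fmset_meas fEF|exact: fmsetD|].
  by move=> z [Ez Fz]; split=> //; exact: V_sub Ez.
have key k : (k < W.+1)%N -> b <= mr (F `&` iter (k * N) T @^-1` F).
  move=> kW; have kn : (k * N <= n)%N by rewrite /n mulnC leq_mul// ltnW.
  have fEk A : fmset m A -> fmset m (iter (k * N) T @^-1` A) by exact: fmset_iter.
  have EE : mr E - J.+1%:R^-1 <= mr (E `&` iter (k * N) T @^-1` E).
    pose G (x : S) := I' x `&` iter (k * N) T @^-1` I' x.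
    have fG x : fmset m (G x) by apply: fmsetIl => //; exact: fmset_meas (fEk _ (fI' x)).
    pose B (x : S) := [&& P x.1, x.2.1 == ord0 & (x.2.2 < M0.+1)%N].
    apply: (@le_trans _ _ (mr (punion G B))); last first.
      apply: mr_le; [exact: fmset_meas (fmset_punion fG _)| |].
        by apply: fmsetIl => //; exact: fmset_meas (fEk _ fE).
      by move=> z [x Bx [zx zx']]; split; exists x.
    rewrite (mr_punion fG)//; last by move=> x y z [zx _] [zy _]; exact: dI' zx zy.
    rewrite /E /V (mr_punion fI')//.
    apply: (@le_trans _ _ (\sum_(x | B x) (mr (I' x) - n%:R * e2))).
      rewrite sumrB lerD2l lerN2 sumr_const.
      apply: le_trans errE; rewrite -[n%:R * e2 *+ _]mulr_natl -[leRHS]mulr_natl.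
      apply: (@le_trans _ _ (#|{: S}|%:R * (n%:R * e2))).
        by rewrite ler_wpM2r ?mulr_ge0// ler_nat max_card.
      by rewrite ler_peMl ?mulr_ge0// ler1n muln_gt0 N0.
    apply: ler_sum => -[i [a t]] /and3P[/= _ /eqP -> _].
    have := orbit_close (i, (ord0, t)) kn; rewrite iter_slow eqxx.
    have -> : iter (k * N) s i = i by rewrite iterM; apply: iter_fix; exact: sN.
    have f1 := fEk _ (fI' (i, (ord0, t))).
    have := mrYE f1 (fI' (i, (ord0, t))).
    have := mrID (fI' (i, (ord0, t))) (fmset_meas f1).
    have := mr_ge0 m (iter (k * N) T @^-1` I' (i, (ord0, t)) `\` I' (i, (ord0, t))).
    rewrite /G; lra.
  have sub : E `&` iter (k * N) T @^-1` E `<=` (F `&` iter (k * N) T @^-1` F) `|`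
      ((E `\` F) `|` iter (k * N) T @^-1` (E `\` F)).
    move=> z [Ez Ekz]; have [Fz|nFz] := pselect (F z); last by right; left.
    have [Fkz|nFkz] := pselect ((iter (k * N) T @^-1` F) z); first by left.
    by right; right.
  have f1 : fmset m (F `&` iter (k * N) T @^-1` F) by exact: fmsetIl (fmset_meas (fk _)).
  have f2 := fEk _ fEF; have f3 := fmsetU fEF f2.
  have := mr_le (fmset_meas (fmsetIl fE (fmset_meas (fEk _ fE)))) (fmsetU f1 f3) sub.
  have := mr_leU f1 f3; have := mr_leU fEF f2.
  rewrite (mr_iter T (k * N) (fmset_meas fEF)).
  move: EE EF; rewrite /b -mr_rigid -/E; move: (J.+1%:R^-1) => u; lra.
apply: (@le_trans _ _ (\sum_(0 <= k < W.+1) mr (F `&` iter (k * N) T @^-1` F))); last first.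
  rewrite /n mulnC; apply: (sum_multiples_le (f := fun k => mr (F `&` iter k T @^-1` F))) => //.
  by move=> k; exact: mr_ge0.
apply: (@le_trans _ _ (\sum_(0 <= k < W.+1) b)).
  rewrite sumr_const_nat subn0 -[b *+ _]mulr_natl ler_pM2r//.
  by rewrite -natrM ler_nat.
by apply: ler_sum_nat => k /andP[_ kW]; exact: key.
Qed.

Lemma slow_pieces_of_perm C : (J < n)%N ->
  (forall l, (l <= J)%N -> exists P : pred Q, mr (C l `+` punion I P) < J.+1%:R^-1) ->
  slow_pieces C p J T I e D n c.
Proof.
move=> Jn tests; split=> //; split=> //; first exact: fV.
exact: lt_le_trans ltr01 c1.
Qed.

End slow_perm_pieces.

End slow_stages.

Section slow_stages_generic.
Context {d} {X : measurableType d} {R : realType}.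
Variable m : {sigma_finite_measure set X -> \bar R}.
Local Notation mr := (rmeasure m).

Lemma generic_open_slow_stage C p J : divisible m -> swappable m ->
  m setT = +oo%E -> (forall l, fmset m (C l)) -> generic_open (@slow_stage _ _ _ m C p J).
Proof.
move=> dv sw mT fC.
have J0 : 0 < J.+1%:R^-1 :> R by rewrite invr_gt0 ltr0n.
apply: (generic_open_of_perm dv sw mT (C := fun l : 'I_J.+1 => C l) _ J0) => //.
move=> Q I e s eta pI Q0 eta0 tests; have [fI e0 Ie dI] := pI.
pose N := #[s]%g; have N0 : (0 < N)%N by exact: order_gt0.
have sN i : iter N s i = i by rewrite -permX expg_order perm1.
(* With [M0.+1] levels inside a piece, the top one is a fraction at most [eta] of it. *)
pose M0 := Num.trunc eta^-1.
have hM : M0.+1%:R^-1 <= eta.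
  by rewrite invf_ple ?posrE ?ltr0n//; exact/ltW/(truncnS_gt eta^-1).
(* Large enough for the levels inside the pieces, for the comparison [NW] and for [J < n]. *)
pose W := (M0 + N * M0.+1 * J.+1)%N.
have NMJ : (J.+1 <= N * M0.+1 * J.+1)%N by rewrite leq_pmull// muln_gt0 N0.
have MW : (M0 < W)%N by rewrite /W -{1}[M0]addn0 ltn_add2l (leq_trans _ NMJ).
have NW : (J.+1 * (N * M0.+1) <= W.+1)%N by rewrite mulnC leqW// leq_addl.
pose n := (N * W.+1)%N.
have Jn : (J < n)%N.
  apply: (@leq_trans W.+1); last exact: leq_pmull.
  by rewrite ltnS ltnW// (leq_trans NMJ)// leq_addl.
pose S : finType := slow_state Q p W.
pose K : finType := ('I_p.+1 * 'I_M0.+1)%type.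
have cK : #|K| = (p.+1 * M0.+1)%N by rewrite card_prod !card_ord.
have k0 : 0 < (p.+1 * M0.+1)%:R :> R by rewrite ltr0n.
pose e' := e / (p.+1 * M0.+1)%:R.
have e'0 : 0 < e' by rewrite divr_gt0.
have Me : (p.+1 * M0.+1)%:R * e' = e by rewrite /e' mulrC divfK// gt_eqF.
have /choice[F hF] : forall i, exists F : K -> set X, [/\ forall k, fmset m (F k),
    forall k, F k `<=` I i, forall k, mr (F k) = e' & disjoint_family F].
  move=> i; apply: subdivide => //; first exact: ltW.
  by rewrite Ie -[e' *+ _]mulr_natl cK Me.
(* Room outside all pieces for the levels beyond [M0]; it exists because the total measure is
   infinite. *)
have [Z [fZ ZY Ze]] := infinite_complement (e' *+ #|S|) mT (fmset_punion fI predT).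
have [G [fG GZ Ge dG]] := subdivide (K := S) dv fZ (ltW e'0) Ze.
pose I' (x : S) := if (x.2.2 < M0.+1)%N then F x.1 (x.2.1, inord x.2.2) else G x.
have I'I i a (t : 'I_W.+1) : (t < M0.+1)%N -> I' (i, (a, t)) `<=` I i.
  by move=> tM; rewrite /I' /= tM; have [_ h _ _] := hF i; exact: h.
have far (x y : S) z : (x.2.2 < M0.+1)%N -> (y.2.2 < M0.+1)%N = false -> I' x z -> I' y z -> False.
  case: x => [i [a t]] /= tM yM Ixz; rewrite /I' yM => /GZ Zz.
  suff : (Z `&` punion I predT) z by rewrite ZY.
  by split=> //; exists i => //; exact: I'I Ixz.
have pI' : is_pieces m I' e'.
  split=> //.
  - by move=> x; rewrite /I'; case: ifP => // _; have [h _ _ _] := hF x.1; exact: h.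
  - by move=> x; rewrite /I'; case: ifP => // _; have [_ _ h _] := hF x.1; exact: h.
  - move=> x y z Ix Iy.
    have [xM|xM] := boolP (x.2.2 < M0.+1)%N; have [yM|yM] := boolP (y.2.2 < M0.+1)%N.
    + move: x y xM yM Ix Iy => [i [a t]] [j [b u]] /= tM uM Ix Iy.
      have ij : i = j by apply: (dI _ _ z); [exact: I'I Ix|exact: I'I Iy].
      move: Ix Iy; rewrite /I' /= tM uM -ij => Ix Iy.
      have [_ _ _ /(_ _ _ z Ix Iy)[-> /(congr1 val)]] := hF i.
      by rewrite /= !inordK// => /val_inj ->.
    + by have := far x y z xM (negbTE yM) Ix Iy.
    + by have := far y x z yM (negbTE xM) Iy Ix.
    + move: Ix Iy; rewrite /I' (negbTE xM) (negbTE yM); exact: dG.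
have S0 : (0 < #|S|)%N.
  by move/card_gt0P : Q0 => [i _]; apply/card_gt0P; exists (i, (ord0, ord0)).
have n0 : (0 < n)%N by exact: leq_ltn_trans Jn.
have d0 : 0 < #|S|%:R * (n * n)%:R :> R by rewrite mulr_gt0 ?ltr0n// muln_gt0 n0.
pose e2 := J.+1%:R^-1 / (#|S|%:R * (n * n)%:R) : R.
have e20 : 0 < e2 by rewrite divr_gt0.
exists S, I', e', (slow_perm s p W), e2; split=> //.
(* Level [M0] is left out because a climbing column leaves the pieces from there. *)
- move=> i; exists (fun x : S => (x.1 == i) && (x.2.2 < M0)%N); split.
    move=> [j [a t]] /= /andP[/eqP -> tM].
    have tM' : (t < M0.+1)%N := leqW tM.
    split; first exact: I'I.
    rewrite permE /slow_step /=; apply: I'I; case: (a == ord0) => //=.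
    rewrite modnDmr addn1 modn_small ltnS//.
    exact: ltn_trans tM MW.
  have := sum_slow_state (W := W) (fun=> e') (pred1 i) (@predT 'I_p.+1) (fun t => (t < M0)%N).
  rewrite /= => ->; rewrite (big_pred1 i)// sumr_const card_ord.
  have MW' : (M0 <= W.+1)%N by rewrite ltnW// ltnW.
  rewrite -(big_ord_widen _ (fun=> e') MW') sumr_const card_ord.
  rewrite -mulrnA -[e' *+ _]mulr_natl -Me.
  apply: (@le_trans _ _ ((1 - M0.+1%:R^-1) * ((p.+1 * M0.+1)%:R * e'))).
    by rewrite ler_pM2r ?lerD2l ?lerN2// mulr_gt0.
  rewrite mulrA ler_pM2r// mulnC !natrM.
  have M00 : M0.+1%:R != 0 :> R by rewrite pnatr_eq0.
  rewrite le_eqVlt; apply/orP; left; apply/eqP.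
  by move: M00; rewrite -[M0.+1%:R]natr1; move: (M0%:R : R) => y y0; field.
- move=> T hT; exists Q, I, e; eexists; exists n; eexists.
  apply: (slow_pieces_of_perm pI MW pI' I'I Me (ltW e20) hT N0 sN NW) => //.
    by rewrite /e2 mulrC divfK// gt_eqF.
  by move=> l lJ; exact: (tests (Ordinal (lJ : (l < J.+1)%N))).
Qed.

(** For fixed [p], however small the rigid fraction of [F] is, its returns dominate the visits of
    [D] once [J] is large. *)
Lemma slow_stage_return C (T : mpt m) F p :
  test_family m C ->
  (forall p J, slow_stage C p J T) -> fmset m F -> 0 < mr F ->
  exists D n, [/\ fmset m D, (p < n)%N, mr (F `\` D) <= 3 * mr F / p.+1%:R &
    8 * \sum_(0 <= k < n) mr (D `&` iter k T @^-1` F) <=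
      \sum_(0 <= k < n) mr (F `&` iter k T @^-1` F)].
Proof.
move=> hC stages fF F0.
have /choice[S hS] : forall J, exists
    s : {Q : finType & ((Q -> set X) * (R * set X * nat * R))%type},
    slow_pieces C p J T (tagged s).1 (tagged s).2.1.1.1 (tagged s).2.1.1.2
      (tagged s).2.1.2 (tagged s).2.2.
  by move=> J; have [Q [I [e [D [n [c h]]]]]] := stages p J;
    exists (Tagged (fun Q : finType => ((Q -> set X) * (R * set X * nat * R))%type)
      (I, (e, D, n, c))).
have p0 : 0 < p.+1%:R :> R by rewrite ltr0n.
pose a := mr F / p.+1%:R.
have a0 : 0 < a by rewrite divr_gt0.
have aF : a <= mr F by rewrite ler_pdivrMr// ler_peMr ?ler1n// ltW.
have inv_le J (r : R) : 0 < r -> (Num.trunc r^-1 <= J)%N -> J.+1%:R^-1 <= r.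
  move=> r0 rJ; rewrite invf_ple ?posrE ?ltr0n//; apply: ltW.
  by apply: lt_le_trans (truncnS_gt _) _; rewrite ler_nat.
have [J1 hJ1] : exists J1, forall J, (J1 <= J)%N -> exists P : pred (tag (S J)),
    mr (F `+` punion (tagged (S J)).1 P) < a / 16.
  have: approximable m (fun J => (tagged (S J)).1) F.
    apply: hC => //.
    - by move=> J x; have [[[h _ _ _] _ _ _] _ _ _ _] := hS J.
    - by move=> J; have [[[_ _ _ h] _ _ _] _ _ _ _] := hS J.
    - move=> l eta eta0; exists (maxn l (Num.trunc eta^-1)) => j.
      rewrite geq_max => /andP[lj ej]; have [_ h _ _ _] := hS j.
      by have [P hP] := h l lj; exists P; exact: lt_le_trans hP (inv_le _ _ eta0 ej).
  by apply; rewrite divr_gt0.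
(* The summands provide, in turn, a union of pieces within [a / 16] of [F], a time beyond [p],
   [J.+1%:R^-1 <= a / 4], and [16 * (mr F + 1) <= J.+1%:R * a]. The bracket in the last clause of
   [slow_pieces] is then at least [a / 2]. *)
pose J := (J1 + (p + (Num.trunc (a / 4)^-1 + Num.trunc (16 * (mr F + 1) / a))))%N.
have [P hP] := hJ1 J (leq_addr _ _).
have [[[fI _ _ _] Jn fD c0] _ h3 h4 h5] := hS J.
move: (tagged (S J)).1 (tagged (S J)).2.1.1.2 (tagged (S J)).2.1.2 (tagged (S J)).2.2
  fI Jn fD c0 h3 h4 h5 hP => I D n c fI Jn fD c0 h3 h4 h5 hP.
exists D, n; split=> //.
- by apply: leq_ltn_trans Jn; rewrite /J addnCA leq_addr.
- have fU := fmset_punion fI P; have mD := fmset_meas fD.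
  have sub : F `\` D `<=` (F `\` punion I P) `|` (punion I P `\` D).
    by move=> z [Fz Dz]; have [Uz|nUz] := pselect (punion I P z); [right|left].
  have f1 := fmsetD fF (fmset_meas fU); have f2 := fmsetD fU mD.
  have g1 := mr_le (fmset_meas (fmsetD fF mD)) (fmsetU f1 f2) sub.
  have g2 := mr_leU f1 f2; have g3 := h3 P; have g4 := mrYE fF fU.
  have g5 := mr_ge0 m (punion I P `\` F).
  have g6 : mr (punion I P) / p.+1%:R <= a + a / 16.
    rewrite ler_pdivrMr// mulrDl {1}/a divfK ?gt_eqF//.
    have := mr_dist fF fU; have : a / 16 <= a / 16 * p.+1%:R.
      by rewrite ler_peMr ?ler1n// divr_ge0// ltW.
    by move: hP; rewrite ler_norml; lra.
  have -> : 3 * mr F / p.+1%:R = 3 * a by rewrite /a mulrA.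
  by move: (mr (punion I P) / _) g3 g6 => u g3 g6; lra.
- have fU := fmset_punion fI P.
  have g4 := mrYE fF fU; have g5 := mr_ge0 m (F `\` punion I P).
  have g6 : a - a / 16 <= mr (punion I P) / p.+1%:R.
    rewrite ler_pdivlMr// mulrBl {1}/a divfK ?gt_eqF//.
    have := mr_dist fF fU; have : a / 16 <= a / 16 * p.+1%:R.
      by rewrite ler_peMr ?ler1n// divr_ge0// ltW.
    by move: hP; rewrite ler_norml; lra.
  have g7 : J.+1%:R^-1 <= a / 4.
    by apply: inv_le; [rewrite divr_gt0|rewrite /J addnA addnA addnAC leq_addl].
  have g8 : 16 * (mr F + 1) <= J.+1%:R * a.
    rewrite -ler_pdivrMr//; apply: ltW; apply: lt_le_trans (truncnS_gt _) _.
    by rewrite ler_nat ltnS /J !addnA leq_addl.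
  apply: le_trans (h5 F P fF).
  apply: (@le_trans _ _ (J.+1%:R * c * (a / 2))); last first.
    apply: ler_wpM2l; first by rewrite mulr_ge0// ltW.
    by move: (mr (punion I P) / _) (J.+1%:R^-1) g6 g7 => u v g6 g7; lra.
  apply: le_trans (ler_wpM2l _ (h4 F fF)) _ => //.
  have := ler_wpM2l (ltW c0) g8; lra.
Qed.

(** With witness [F], the visits of [G] to [F] would have to be asymptotic to [mr G * mr F * a], at
    least half of [mr F ^+ 2 * a]. At the time of each stage they are at most an eighth of it, since
    [G] is contained in the set [D] of that stage. *)
Lemma not_rwm_of_slow_stages C (T : mpt m) :
  test_family m C ->
  (forall p J, slow_stage C p J T) -> ~ rationally_weakly_mixing T.
Proof.
move=> hC stages [_ _ [F [mF F0 Foo hF]]].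
have fF : fmset m F by split.
have F0' : 0 < mr F by rewrite -lte_fin -mrE.
have /choice[D hD] : forall i, exists Dn : set X * nat, [/\ fmset m Dn.1, (i < Dn.2)%N,
    mr (F `\` Dn.1) <= mr F / 4 / 2 ^+ i &
    8 * \sum_(0 <= k < Dn.2) mr (Dn.1 `&` iter k T @^-1` F) <=
      \sum_(0 <= k < Dn.2) mr (F `&` iter k T @^-1` F)].
  (* With [p = 12 * 2 ^ i] the loss [3 * mr F / p.+1%:R] is at most [mr F / 4 / 2 ^+ i], and these
     losses sum to [mr F / 2]. *)
  move=> i; have [D [n [fD pn h1 h2]]] := slow_stage_return (12 * 2 ^ i)%N hC stages fF F0'.
  exists (D, n); split=> //=.
    by apply: leq_ltn_trans pn; rewrite (leq_trans (ltnW (ltn_expl i (ltnSn 1))))// leq_pmull.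
  apply: le_trans h1 _; rewrite ler_pdivrMr ?ltr0n//.
  have -> : 3 * mr F = mr F / 4 / 2 ^+ i * (12 * 2 ^+ i).
    by field; rewrite expf_neq0.
  rewrite ler_wpM2l// ?divr_ge0 ?exprn_ge0 ?mr_ge0//.
  by rewrite -natrX -natrM ler_nat leqnSn.
pose G := F `&` \bigcap_i (D i).1.
have mD i : measurable (D i).1 by have [h _ _ _] := hD i; exact: fmset_meas h.
have fG : fmset m G by apply: fmsetIl => //; exact: bigcapT_measurable.
have Ghalf : mr F / 2 <= mr G.
  pose H i := F `&` \big[setI/setT]_(j < i) (D j).1.
  have mH i : measurable (\big[setI/setT]_(j < i) (D j).1).
    by apply: bigsetI_measurable => j _.
  have fH i : fmset m (H i) by exact: fmsetIl.
  have lb i : mr F / 2 + mr F / 2 / 2 ^+ i <= mr (H i).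
    elim: i => [|i IHi].
      by rewrite /H big_ord0 setIT expr0 divr1; lra.
    have := mrID (fH i) (mD i).
    have E : H i.+1 = H i `&` (D i).1 by rewrite /H big_ord_recr /= setIA.
    rewrite -E; have [_ _ h _] := hD i.
    have : mr (H i `\` (D i).1) <= mr (F `\` (D i).1).
      apply: mr_le; [exact: fmset_meas (fmsetD (fH i) (mD i))|exact: fmsetD|].
      by move=> z [[Fz _] nD].
    have : mr F / 2 / 2 ^+ i.+1 = mr F / 2 / 2 ^+ i - mr F / 4 / 2 ^+ i.
      by rewrite exprS; field; rewrite expf_neq0.
    lra.
  have -> : G = \bigcap_i H i.
    apply/seteqP; split=> [z [Fz Dz] i _|z Hz].
      by split=> //; rewrite -(bigcap_mkord i (fun j => (D j).1)) => j _; exact: Dz.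
    split=> [|i _]; first by have [] := Hz 0%N I.
    have [_] := Hz i.+1 I; rewrite -(bigcap_mkord i.+1 (fun j => (D j).1)); apply => /=; exact: ltnSn.
  apply: mr_bigcap_ge => // [i z|i].
    by rewrite /H big_ord_recr setIA => -[].
  by apply: le_trans (lb i); rewrite lerDl divr_ge0 ?exprn_ge0// divr_ge0// ltW.
have mG := fmset_meas fG.
(* The normalised deviation will be at least 1/2 - 1/8 = 3/8 of [mr F ^+ 2], above this
   threshold. *)
have eps0 : 0 < mr F ^+ 2 / 4 by rewrite divr_gt0// exprn_gt0.
have := hF G F mG mF (@subIsetl _ _ _) (@subset_refl _ _).
rewrite withinET => /cvgrPdist_lt /(_ _ eps0)[N0 _ /(_ (D N0).2)].
have [_ nN _ hn] := hD N0; set n := (D N0).2 in nN hn *.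
move=> /(_ (ltnW nN)) /=; rewrite sub0r normrN.
set a := return_sequence T F n.
set sG := \sum_(0 <= k < n) _.
have aE : \sum_(0 <= k < n) mr (F `&` iter k T @^-1` F) = mr F ^+ 2 * a.
  rewrite /a /return_sequence mulr_sumr; apply: eq_bigr => k _.
  by rewrite /return_rate mulrC divfK// expf_neq0// gt_eqF.
have a0 : 0 < a.
  rewrite -(pmulr_rgt0 a (exprn_gt0 2 F0')) -aE; apply: (@lt_le_trans _ _ (mr F)) => //.
  rewrite (big_ltn (leq_ltn_trans (leq0n _) nN)) /= (_ : F `&` _ = F); last exact: setIid.
  by rewrite lerDl sumr_ge0// => k _; exact: mr_ge0.
have sG_ge : mr G * mr F * a - \sum_(0 <= k < n) mr (G `&` iter k T @^-1` F) <= sG.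
  rewrite /a /return_sequence mulr_sumr -sumrB; apply: ler_sum => k _.
  by rewrite -normrN opprB; exact: ler_norm.
have GD : \sum_(0 <= k < n) mr (G `&` iter k T @^-1` F) <=
    \sum_(0 <= k < n) mr ((D N0).1 `&` iter k T @^-1` F).
  have [fD _ _ _] := hD N0.
  have fk k : fmset m (iter k T @^-1` F) by exact: fmset_iter.
  apply: ler_sum => k _; apply: mr_le.
  - exact: fmset_meas (fmsetIl fG (fmset_meas (fk k))).
  - exact: fmsetIl fD (fmset_meas (fk k)).
  - by move=> z [[_ Dz] Fz]; split=> //; exact: Dz.
rewrite ger0_norm; last by apply: divr_ge0; [exact: sumr_ge0|exact: ltW].
rewrite ltr_pdivrMr// aE in hn *.
have FF : mr F ^+ 2 * a / 2 <= mr G * mr F * a.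
  have := ler_wpM2r (ltW (mulr_gt0 F0' a0)) Ghalf; lra.
have := mulr_gt0 (exprn_gt0 2 F0') a0; lra.
Qed.

End slow_stages_generic.

Theorem theoremF (d : measure_display) (X : measurableType d) (R : realType)
    (m : {sigma_finite_measure set X -> \bar R}) :
  standard_borel X R -> non_atomic m -> m [set: X] = +oo%E ->
  meagre (RWM m) /\ residual (PSRWM m).
Proof.
move=> stX na mT.
have [f [g [mf mg fK]]] := standard_borel_retract stX.
have dv : divisible m by move=> A t; exact: (exists_subset_mr mf (can_inj fK) na).
have sw : swappable m by move=> A B; exact: (mpt_swap mf mg fK na).
have [C [fC hC]] := countable_test_family m mf mg fK.
split.
  pose pq (k : nat) : nat * nat := odflt (0%N, 0%N) (@unpickle (nat * nat)%type k).
  apply: (meagre_of_generic_open (P := [set S | rationally_weakly_mixing S])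
    (Phi := fun k => @slow_stage _ _ _ m C (pq k).1 (pq k).2)) => // [k|S /= rwm].
    exact: generic_open_slow_stage.
  apply: contrapT => noPhi; apply: (not_rwm_of_slow_stages hC _ rwm) => p J.
  apply: contrapT => nstage; apply: noPhi; exists (pickle (p, J)).
  by rewrite /pq pickleK.
apply: (meagre_of_generic_open
  (P := [set S | ~ power_subsequence_rationally_weakly_mixing S])
  (Phi := fun J => @mixing_stage _ _ _ m C J)) => [x nx|J|S /= npsrwm].
- have [S Sx] : exists S : mpt m, mpt_class S = x.
    by exists (generic_quotient.repr x); rewrite /mpt_class generic_quotient.reprK.
  by exists S => // hS; apply: nx; exists S.
- exact: generic_open_mixing_stage.
- apply: contrapT => noPhi; apply: npsrwm; apply: (power_srwm_of_mixing_stages mT hC) => J.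
  by apply: contrapT => nstage; apply: noPhi; exists J.
Qed.
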